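(* Let $(X,d)$ be a CAT(0) space and let $Y:[0,\infty)\to X$, $t\mapsto Y_t$, be a curve of points with speed $\le1$, i.e. $d(Y_t,Y_{t'})\le|t-t'|$ for all $t,t'\ge 0$. Then for any $x_0\in X$ there is a unique simple pursuit curve $\sigma_{x_0}$ chasing the curve $Y$ such that $\sigma_{x_0}(0)=x_0$.
   Context: CAT(0) space: a complete geodesic metric space $(X,d)$ (not necessarily locally compact) whose geodesic triangles are no fatter than their Euclidean comparison triangles. $[xy]$ is the unit-speed geodesic from $x$ to $y$. Tangent cone: the angle $\angle_x(\gamma_1,\gamma_2)$ of two geodesics starting at $x$ is the Alexandrov angle. $\Sigma_x$ is the completion, with respect to the intrinsic metric induced by $\angle_x$, of the set of geodesics starting at $x$ modulo $\angle_x=0$. $T_x$ is the Euclidean cone over $\Sigma_x$: elements are pairs $v=(\xi,r)$, $\xi\in\Sigma_x$, $r\ge0$, all $(\xi,0)$ being identified with the vertex $o_x$; $\|(\xi,r)\|=r$; $\langle v,w\rangle=\|v\|\|w\|\cos\theta$ with $\theta$ the angle between $v$ and $w$ (and $0$ if $v$ or $w$ is $o_x$). Right-side tangent vector: a rectifiable curve $\gamma$ has right-side tangent vector $\gamma'(t+)=(\xi,r)\in T_{\gamma(t)}$ if $r=\lim_{t'\to t+}d(\gamma(t'),\gamma(t))/(t'-t)$ exists and $\xi=\lim_{t'\to t+}\xi_{t'}$ exists, where $\xi_{t'}$ is the direction at $\gamma(t)$ of $[\gamma(t)\gamma(t')]$ (if $r=0$, it is the vertex). Gradient: for $G:X\to\mathbb{R}$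 locally Lipschitz and convex, the differential $d_xG:T_x\to\mathbb{R}$ is the unique Lipschitz function with $d_xG(\gamma'(0+))=\lim_{t\to0+}(G(\gamma(t))-G(\gamma(0)))/t$ for every curve $\gamma$ with $\gamma(0)=x$ for which $\gamma'(0+)$ is defined; $\nabla_x(-G)$ is the unique $v\in T_x$ with $d_xG(w)\ge-\langle v,w\rangle$ for all $w\in T_x$ and $d_xG(v)=-\langle v,v\rangle$. A simple pursuit curve chasing $Y$ is a time-dependent gradient curve of $F(t,p)=d(p,Y_t)$, i.e. a locally Lipschitz curve $\sigma$ such that the right-side tangent vector $\sigma'(t+)$ exists and equals $\nabla_{\sigma(t)}(-F_t)$, $F_t=F(t,\cdot)$, at each time $t$ of its domain other than the right endpoint. It runs until capture: it is defined on $[0,t_1]$, where $t_1\ge0$ is the first time with $\sigma(t_1)=Y_{t_1}$, and stops there; it is defined on $[0,\infty)$ if there is no such time.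
   Formalization: The differential d_xG is required to give the derivative of G only along rectifiable curves with a right-side tangent vector that are approximated to first order by constant-speed geodesics; required along all curves with a right-side tangent vector, it need not exist, even for G=d(.,y). *)

(* Defs.v *)
From HB Require Import structures.
From mathcomp Require Import all_boot all_order all_algebra.
From mathcomp Require Import all_classical all_reals all_analysis.
From mathcomp Require Import ring.

Set Implicit Arguments.
Unset Strict Implicit.
Unset Printing Implicit Defensive.

Import Order.TTheory GRing.Theory Num.Theory.
Import numFieldNormedType.Exports.

Local Open Scope classical_set_scope.
Local Open Scope ring_scope.

Section Length.
Context {R : realType} {T : Type}.
Variable dist : T -> T -> R.

Definition curve_length (a b : R) (c : R -> T) : \bar R :=
  ereal_sup [set (\sum_(0 <= i < size s)
      dist (c (nth b (a :: s) i)) (c (nth b (a :: s) i.+1)))%:E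
    | s in itv_partition a b].

Definition curve_continuous (a b : R) (c : R -> T) : Prop :=
  forall s, s \in `[a, b] ->
    dist (c s) (c t) @[t --> within `[a, b] (nbhs s)] --> (0 : R).

(* The infimum of an empty set of lengths is +oo. *)
Definition intrinsic_dist (x y : T) : \bar R :=
  ereal_inf [set curve_length 0 1 c
    | c in [set c | [/\ curve_continuous 0 1 c, c 0 = x & c 1 = y]]].

End Length.

Section Completion.
Context {R : realType} {T : Type}.
Variable d : T -> T -> \bar R.

Record cauchy_seq := CauchySeq {
  cauchy_fun :> nat -> T;
  _ : forall e : R, 0 < e -> exists N, forall m n, (N <= m)%N -> (N <= n)%N ->
        (d (cauchy_fun m) (cauchy_fun n) < e%:E)%E }.

Definition cauchy_dist (u v : cauchy_seq) : \bar R := limn (fun n => d (u n) (v n)).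

(* Points are classes of Cauchy sequences at distance 0; if [d] is only a
   pseudometric, its points at distance 0 are identified at the same time. *)
Definition cauchy_class (u : cauchy_seq) : set cauchy_seq :=
  [set v | cauchy_dist u v = 0%E].

Definition completion := {A : set cauchy_seq | exists u, A = cauchy_class u}.

Definition completion_repr (A : completion) : cauchy_seq :=
  projT1 (cid (proj2_sig A)).

Definition completion_dist (A B : completion) : \bar R :=
  cauchy_dist (completion_repr A) (completion_repr B).

Hypothesis d0 : forall x, d x x = 0%E.

Lemma cst_cauchy (x : T) (e : R) : 0 < e ->
  exists N, forall m n, (N <= m)%N -> (N <= n)%N -> (d x x < e%:E)%E.
Proof. by move=> e0; exists 0%N => m n _ _; rewrite d0 lte_fin. Qed.

Definition to_completion (x : T) : completion :=
  exist _ (cauchy_class (CauchySeq (cst_cauchy x))) (ex_intro _ _ erefl).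

End Completion.

Section CAT0.
Context {R : realType}.

Definition eucl_dist (u v : R * R) : R :=
  Num.sqrt ((u.1 - v.1) ^+ 2 + (u.2 - v.2) ^+ 2).

Definition eucl_point (u v : R * R) (a : R) : R * R :=
  ((1 - a) * u.1 + a * v.1, (1 - a) * u.2 + a * v.2).

Variable X : metricType R.

(* [c] is the unit-speed geodesic from [x] to [y]; its values outside
   [0, mdist x y] are irrelevant. *)
Definition geodesic (x y : X) (c : R -> X) : Prop :=
  [/\ c 0 = x, c (mdist x y) = y
    & {in `[0, mdist x y] &, forall s t, mdist (c s) (c t) = `|s - t|}].

(* [p], [q], [r] range over all triples, so every pair of sides of a triangle is
   covered as the two sides issuing from [p]; [P], [Q], [S] is a comparison
   triangle. *)
Definition thin_triangles : Prop :=
  forall (p q r : X) (c c' : R -> X), geodesic p q c -> geodesic p r c' ->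
  forall P Q S : R * R, eucl_dist P Q = mdist p q ->
    eucl_dist P S = mdist p r -> eucl_dist Q S = mdist q r ->
  forall a b : R, a \in `[0, 1] -> b \in `[0, 1] ->
    mdist (c (a * mdist p q)) (c' (b * mdist p r)) <=
    eucl_dist (eucl_point P Q a) (eucl_point P S b).

(* Completeness is spelled out because the library's complete spaces are
   bundled with a distinguished point. *)
Definition CAT0 : Prop :=
  [/\ forall F : set_system X, ProperFilter F -> cauchy F -> exists x : X, F --> x,
      forall x y : X, exists c, geodesic x y c
    & thin_triangles].

End CAT0.

Section TangentCone.
Context {R : realType} {X : metricType R}.

Record geodesic_from (x : X) := GeodesicFrom {
  geod_end : X;
  geod_path :> R -> X;
  geod_neq : x != geod_end;
  geodP : geodesic x geod_end geod_path }.

Definition comparison_angle (x y z : X) : R :=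
  acos ((mdist x y ^+ 2 + mdist x z ^+ 2 - mdist y z ^+ 2) /
        (2 * mdist x y * mdist x z)).

Definition alexandrov_angle (x : X) (g h : geodesic_from x) : R :=
  fine (limf_esup (fun st : R * R => (comparison_angle x (g st.1) (h st.2))%:E)
                  (filter_prod 0^'+ 0^'+)).

Definition direction_dist (x : X) : geodesic_from x -> geodesic_from x -> \bar R :=
  intrinsic_dist (@alexandrov_angle x).

Definition directions (x : X) := completion (@direction_dist x).

Definition dist_directions (x : X) : directions x -> directions x -> \bar R :=
  @completion_dist _ _ (@direction_dist x).

Lemma comparison_angle_refl (x : X) (g : geodesic_from x) (s t : R) :
  0 < s <= mdist x (geod_end g) -> 0 < t <= mdist x (geod_end g) ->
  comparison_angle x (g s) (g t) = 0.
Proof.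
move=> /andP[s0 sl] /andP[t0 tl]; case: (geodP g) => g0 _ gi.
have l0 := le_trans (ltW s0) sl.
have i0 : 0 \in `[0, mdist x (geod_end g)] by rewrite in_itv/= lexx.
have is_ : s \in `[0, mdist x (geod_end g)] by rewrite in_itv/= sl ltW.
have it : t \in `[0, mdist x (geod_end g)] by rewrite in_itv/= tl ltW.
have xs : mdist x (g s) = s by rewrite -{1}g0 gi// sub0r normrN gtr0_norm.
have xt : mdist x (g t) = t by rewrite -{1}g0 gi// sub0r normrN gtr0_norm.
rewrite /comparison_angle xs xt gi// real_normK ?num_real// sqrrB.
have -> : s ^+ 2 + t ^+ 2 - (s ^+ 2 - s * t *+ 2 + t ^+ 2) = 2 * s * t by ring.
by rewrite divff ?acos1// !mulf_neq0 ?gt_eqF.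
Qed.

Lemma alexandrov_angle_refl (x : X) (g : geodesic_from x) :
  alexandrov_angle g g = 0.
Proof.
have l0 : 0 < mdist x (geod_end g) by rewrite mdist_gt0 geod_neq.
set F : set_system (R * R) := filter_prod 0^'+ 0^'+.
pose f (st : R * R) := comparison_angle x (g st.1) (g st.2).
have nearF : F [set st | f st = 0].
  pose A := [set s : R | 0 < s <= mdist x (geod_end g)].
  have nearA : 0^'+ A.
    near=> s; rewrite /A/=; apply/andP; split; near: s.
      exact: nbhs_right_gt.
    exact: nbhs_right_le.
  by exists (A, A) => // -[s t] [/= As At]; exact: comparison_angle_refl.
suff e0 : limf_esup (EFin \o f) F = 0%E by rewrite /alexandrov_angle e0.
apply/eqP; rewrite eq_le; apply/andP; split.
  apply: ge_ereal_inf; eexists; first by exists [set st | f st = 0].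
  by apply: ge_ereal_sup => _ [st /= st0 <-]; rewrite st0.
apply: le_ereal_inf_tmp => _ [V FV <-]; apply: le_ereal_sup_tmp.
have [st [Vst st0]] := filter_ex (filterI FV nearF).
by exists (EFin (f st)); [exists st | rewrite st0].
Unshelve. all: by end_near. Qed.

Lemma direction_dist_refl (x : X) (g : geodesic_from x) :
  direction_dist g g = 0%E.
Proof.
apply/eqP; rewrite eq_le; apply/andP; split.
  apply: ge_ereal_inf; eexists.
    exists (fun=> g) => //; split=> // s _.
    by under eq_fun do rewrite alexandrov_angle_refl; exact: cvg_cst.
  apply: ge_ereal_sup => _ [s _ <-].
  by rewrite big1// => i _; rewrite alexandrov_angle_refl.
apply: le_ereal_inf_tmp => _ [c [_ c0 c1] <-].
apply: le_ereal_sup_tmp; exists 0%E => //; exists [:: 1].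
  by split; rewrite /= ?ltr01 ?eqxx.
by rewrite big_nat1/= c0 c1 alexandrov_angle_refl.
Qed.

Definition direction (x : X) (g : geodesic_from x) : directions x :=
  to_completion (@direction_dist_refl x) g.

(* The vertex is a separate constructor, so that the cone over an empty space of
   directions is a point; all other vectors have positive norm. *)
Variant tangent_cone (x : X) :=
  | Vertex
  | Ray of directions x & {posnum R}.

Definition tnorm (x : X) (v : tangent_cone x) : R :=
  match v with Vertex => 0 | Ray _ r => r%:num end.

(* The angle at the vertex of a Euclidean cone is the distance between the
   directions truncated at pi. *)
Definition tinner (x : X) (v w : tangent_cone x) : R :=
  match v, w with
  | Ray xi r, Ray eta s =>
      r%:num * s%:num * cos (fine (mine (dist_directions xi eta) pi%:E))
  | _, _ => 0
  end.

Definition cone_dist (x : X) (v w : tangent_cone x) : R :=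
  Num.sqrt (tnorm v ^+ 2 + tnorm w ^+ 2 - 2 * tinner v w).

(* [right_tangent v c t] : the right-side tangent vector of [c] at [t] is [v].
   When the speed is positive, [c t'] differs from [x = c t] for t' > t close to
   t, and in a CAT(0) space [g] is the unique geodesic from [x] to [c t']. *)
Definition right_tangent (x : X) (v : tangent_cone x) (c : R -> X) (t : R) : Prop :=
  [/\ c t = x,
      mdist (c t') (c t) / (t' - t) @[t' --> t^'+] --> tnorm v
    & match v with
      | Vertex => True
      | Ray xi _ => forall e : R, 0 < e -> \forall t' \near t^'+,
          forall g : geodesic_from x, geod_end g = c t' ->
            (dist_directions (direction g) xi < e%:E)%E
      end].

Definition rectifiable (a b : R) (c : R -> X) : Prop :=
  {within `[a, b], continuous c} /\ (curve_length mdist a b c < +oo)%E.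

(* [c] is approximated to first order at 0 by constant-speed geodesics. *)
Definition first_order_geodesic (c : R -> X) : Prop :=
  forall e : R, 0 < e -> exists a r (h : R -> X),
    [/\ 0 < a, 0 <= r,
        {in `[0, a] &, forall s t, mdist (h s) (h t) = r * `|s - t|}
      & \forall t \near 0^'+, mdist (c t) (h t) <= e * t].

Definition tangent_lipschitz (x : X) (D : tangent_cone x -> R) : Prop :=
  exists K : R, forall v w, `|D v - D w| <= K * cone_dist v w.

(* [D] is the differential of [G] at [x]. The curves allowed include the
   constant-speed geodesics issuing from [x], whose initial vectors are dense in
   the tangent cone, so [D] is unique. For curves that only have a right-side
   tangent vector, the slope of [G] need not depend on that vector alone, because
   geodesics may share a direction while having only a very short common part. For
   instance, take rays c_n (n >= 3) with common origin [x] such that c_n and c_n.+1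
   coincide exactly up to distance 2^-n/n, and glue in a flat quarter-plane S_n
   bounded by the remaining parts of c_n and c_n.+1. The result is a CAT(0) space in
   which [directions x] is a single point. The curve at distance t from [x] that
   crosses S_n from c_n.+1 to c_n while t runs from 2^-(n.+1) to 2^-n is rectifiable
   and has the same right-side tangent vector at 0 as c_3, but the distance to a
   point of c_3 has slope -1 along c_3 and does not along this curve. Hence the
   condition [first_order_geodesic]. *)
Definition is_differential (G : X -> R) (x : X) (D : tangent_cone x -> R) : Prop :=
  tangent_lipschitz D /\
  forall (c : R -> X) (a : R) (v : tangent_cone x),
    0 < a -> rectifiable 0 a c -> right_tangent v c 0 -> first_order_geodesic c ->
    (G (c t) - G (c 0)) / t @[t --> 0^'+] --> D v.

(* [v] is the gradient at [x] of -G. *)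
Definition is_gradient_opp (G : X -> R) (x : X) (v : tangent_cone x) : Prop :=
  exists D : tangent_cone x -> R, [/\ is_differential G D,
    forall w, - tinner v w <= D w & D v = - tinner v v].

End TangentCone.

Section Pursuit.
Context {R : realType} {X : metricType R}.

(* The curves below have domain [0, T] if T is finite and [0, +oo) if T = +oo;
   their values outside the domain are irrelevant. *)
Definition time_domain (T : \bar R) : set R := [set t | 0 <= t /\ (t%:E <= T)%E].

Definition is_capture_time (Y s : R -> X) (T : \bar R) : Prop :=
  (exists t1, [/\ T = t1%:E, 0 <= t1, s t1 = Y t1
                & forall t, 0 <= t < t1 -> s t <> Y t]) \/
  (T = +oo%E /\ forall t, 0 <= t -> s t <> Y t).

Definition locally_lipschitz_on (A : set R) (s : R -> X) : Prop :=
  forall t, A t -> exists K e : R, 0 < e /\ forall t1 t2, A t1 -> A t2 ->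
    `|t1 - t| < e -> `|t2 - t| < e -> mdist (s t1) (s t2) <= K * `|t1 - t2|.

Definition simple_pursuit (Y : R -> X) (T : \bar R) (s : R -> X) : Prop :=
  [/\ is_capture_time Y s T,
      locally_lipschitz_on (time_domain T) s
    & forall t, 0 <= t -> (t%:E < T)%E -> exists v : tangent_cone (s t),
        right_tangent v s t /\ is_gradient_opp (fun p => mdist p (Y t)) v].

End Pursuit.

(* Main.v *)
(* Existence: the polygonal curves that move at unit speed towards a position of [Y]
   updated at discrete times form a Cauchy sequence, because moving two points
   towards a common target does not increase their distance. Their limit [s]
   satisfies d(s(t + h), [s(t) Y_t](h)) = o(h), and it is continued until capture.
   By the first variation formula, the gradient of -d(., Y_t) is the unit vector
   towards Y_t; the intrinsic distance of two directions is their Alexandrov angle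
   when that angle is less than pi, so this estimate gives the right-side tangent
   vector.

   Uniqueness: a pursuit curve [c] only has the right directions, and at a given
   time it may leave the geodesic towards Y_t at a linear rate. For times in [a, b],
   the function f(t) = d(c(t), c(b)) + t is nondecreasing. At a time t where f grows
   at an arbitrarily small rate, c(t + h) is close to the geodesic towards c(b), whose
   direction is then close to the direction of c(t + h), hence to that of Y_t, and
   [c] is close to [c(t) Y_t] after all. At the other times the increase of
   d(c, s) is controlled by that of f, whose total increase b - a - d(c(a), c(b)) is
   o(b - a) since [c] has unit speed. So d(c, s) has nonpositive right derivatives. *)

Require Import Defs.
From mathcomp Require Import all_boot all_order all_algebra.
From mathcomp Require Import all_classical all_reals all_analysis.
From mathcomp Require Import ring lra.

Set Implicit Arguments.
Unset Strict Implicit.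
Unset Printing Implicit Defensive.

Import Order.TTheory GRing.Theory Num.Theory.
Import numFieldNormedType.Exports.

Local Open Scope classical_set_scope.
Local Open Scope ring_scope.

(** * Growth estimates for real functions *)

Section RealLemmas.
Context {R : realType}.

(** A tangent vector controls only Alexandrov angles, that is, limits of comparison angles at the
    vertex. Geodesics with nearly the same direction may separate at any scale, so a small angle
    does not bound a distance at time h. Hence two notions are kept apart: [chase_err] is a distance
    estimate, which adds up under the triangle inequality and drives existence; [weak_chase] is what
    can be extracted from an arbitrary pursuit curve. Uniqueness compares such a curve with the
    constructed one, never two arbitrary ones. All comparisons end in [growth_bound], which asks at
    each time only for arbitrarily small good steps, because along a pursuit curve good steps may
    occur just along a sequence of times. The rate [D] depends on the tolerance alone, so it is
    fixed before the time interval shrinks. On the tangent side, the intrinsic distance of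
    directions may exceed their angle or be infinite, but the inner product sees only its truncation
    at pi, which is a limit of Alexandrov angles. The gradient is identified for every differential
    allowed by the definition, by testing it on geodesics. *)

Lemma near_rightP (x : R) (P : R -> Prop) :
  (\forall t \near x^'+, P t) <->
  exists2 e : R, 0 < e & forall t, x < t < x + e -> P t.
Proof.
split=> [/nbhs_ballP[e /= e0 He]|[e e0 He]].
  exists e => // t /andP[xt te]; apply: He => //.
  by rewrite /ball/= distrC gtr0_norm ?subr_gt0// ltrBlDl.
near=> t; apply: He; apply/andP; split; near: t; first exact: nbhs_right_gt.
by apply: nbhs_right_lt; rewrite ltrDl.
Unshelve. all: by end_near. Qed.

Definition continuous_on (a b : R) (f : R -> R) : Prop :=
  forall t, a <= t <= b -> forall e, 0 < e -> exists2 d, 0 < d &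
    forall u, a <= u <= b -> `|u - t| < d -> `|f u - f t| < e.

(** Continuity carries the bound to the supremum of the times at which it holds, and one good step
    goes beyond it. A single arbitrarily small step at each time suffices, so this is a bound by the
    lower right derivative. *)
Lemma growth_bound (a b K : R) (f : R -> R) : a <= b -> continuous_on a b f ->
  (forall t, a <= t < b -> forall d, 0 < d ->
     exists2 h, 0 < h < d & f (t + h) <= f t + K * h) ->
  f b <= f a + K * (b - a).
Proof.
move=> ab fc fstep.
pose S := [set t | a <= t <= b /\ f t <= f a + K * (t - a)].
have Sa : S a by split; rewrite ?lexx ?ab// subrr mulr0 addr0.
have hsS : has_sup S by split; [exists a|exists b => t [/andP[]]].
pose u := sup S.
have au : a <= u by exact: ub_le_sup hsS.2 _ Sa.
have ub : u <= b by apply: ge_sup; [exists a|move=> t [/andP[]]].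
have fu : f u <= f a + K * (u - a).
  rewrite leNgt; apply/negP => fuK.
  pose e := f u - (f a + K * (u - a)).
  have e0 : 0 < e by rewrite subr_gt0.
  have e20 : 0 < e / 2 by lra.
  have [d d0 Hd] := fc u (introT andP (conj au ub)) _ e20.
  have K0 : 0 < `|K| + 1 by rewrite ltr_wpDl.
  (* Within [d'] of [u], both [f] and the linear bound change by less than [e / 2]. *)
  pose d' := Num.min d (e / 2 / (`|K| + 1)).
  have d'0 : 0 < d' by rewrite lt_min d0 divr_gt0.
  have [t St ut] := sup_adherent d'0 hsS.
  have tu : t <= u by exact: ub_le_sup hsS.2 _ St.
  case: St => tab ft.
  have utd : `|t - u| < d'.
    by rewrite ler0_norm ?subr_le0// opprB ltrBlDr -ltrBlDl.
  move: utd; rewrite lt_min => /andP[utd].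
  rewrite ltr_pdivlMr// => utd'.
  have := Hd t tab utd; rewrite ltr_norml => /andP[H1 H2].
  have : K * (t - u) <= `|t - u| * (`|K| + 1).
    apply: le_trans (ler_norm _) _; rewrite normrM mulrDr mulr1 mulrC lerDl//.
  rewrite /e in H1 utd'; nra.
have [ub'|bu] := ltP u b; last by have -> : b = u by apply/le_anti; rewrite bu ub.
have bu0 : 0 < b - u by rewrite subr_gt0.
have [h /andP[h0 hb] fh] := fstep u (introT andP (conj au ub')) _ bu0.
suff : S (u + h) by move=> /(ub_le_sup hsS.2); rewrite gerDl leNgt h0.
split; first by apply/andP; split; lra.
by apply: le_trans fh _; nra.
Qed.

End RealLemmas.

Lemma sq_le (R : realType) (a b : R) : 0 <= b -> a ^+ 2 <= b ^+ 2 -> a <= b.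
Proof.
move=> b0; case: (leP a 0) => [a0 _|a0]; first exact: le_trans a0 b0.
by rewrite ler_sqr ?nnegrE// ltW.
Qed.

(** * Geodesics and thin triangles *)

Section Geodesics.
Context {R : realType} {X : metricType R}.
Implicit Types (x y z p q : X) (c : R -> X) (s t : R).

Lemma mdist_diff x y z : `|mdist x z - mdist y z| <= mdist x y.
Proof.
rewrite ler_norml; apply/andP; split.
  by have := metric_triangle y x z; rewrite (metric_sym y x); lra.
by have := metric_triangle x y z; lra.
Qed.

Lemma mdist0_eq x y : mdist x y <= 0 -> x = y.
Proof.
by move=> xy; apply: mdist_positivity; apply/le_anti; rewrite xy mdist_ge0.
Qed.

Lemma geodesic_dist x y c s t : geodesic x y c ->
  0 <= s <= mdist x y -> 0 <= t <= mdist x y -> mdist (c s) (c t) = `|s - t|.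
Proof. by case=> _ _ H s0 t0; apply: H; rewrite in_itv. Qed.

Lemma geodesic_distl x y c s : geodesic x y c -> 0 <= s <= mdist x y ->
  mdist x (c s) = s.
Proof.
move=> g s0; have [c0 _ _] := g; rewrite -{1}c0 (geodesic_dist g)//.
  by rewrite sub0r normrN ger0_norm//; case/andP: s0.
by rewrite lexx mdist_ge0.
Qed.

Lemma geodesic_distr x y c s : geodesic x y c -> 0 <= s <= mdist x y ->
  mdist (c s) y = mdist x y - s.
Proof.
move=> g s0; have [_ c1 _] := g; rewrite -{1}c1 (geodesic_dist g)//.
  by rewrite distrC ger0_norm ?subr_ge0//; case/andP: s0.
by rewrite lexx mdist_ge0.
Qed.

Lemma geodesic_sub x y c s : geodesic x y c -> 0 <= s <= mdist x y ->
  geodesic x (c s) c.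
Proof.
move=> g s0; have [c0 _ H] := g; rewrite /geodesic (geodesic_distl g s0).
split=> // u v; rewrite !in_itv/= => /andP[u0 us] /andP[v0 vs].
by apply: H; rewrite in_itv/= ?u0 ?v0/=; apply: le_trans (andP s0).2.
Qed.

Lemma geodesic_rev x y c : geodesic x y c ->
  geodesic y x (fun t => c (mdist x y - t)).
Proof.
move=> [c0 c1 H]; rewrite /geodesic (metric_sym y x) subr0 subrr; split=> //.
move=> u v; rewrite !in_itv/= => /andP[u0 us] /andP[v0 vs].
rewrite H ?in_itv/= ?subr_ge0 ?us ?vs ?gerBl ?u0 ?v0//.
by rewrite distrC; congr `|_|; ring.
Qed.

Lemma geodesic_shift x y c s : geodesic x y c -> 0 <= s <= mdist x y ->
  geodesic (c s) y (fun t => c (s + t)).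
Proof.
move=> g s0; have [c0 c1 H] := g; rewrite /geodesic (geodesic_distr g s0).
rewrite addr0 subrKC; split=> //.
case/andP: s0 => s0 sl.
move=> u v; rewrite !in_itv/= => /andP[u0 us] /andP[v0 vs].
rewrite H ?in_itv/=; last 2 first.
- by apply/andP; split; lra.
- by apply/andP; split; lra.
by congr `|_|; ring.
Qed.

Section Thin.
Hypothesis hX : @CAT0 R X.

(* Thinness of triangles, with the comparison triangle eliminated by the law of
   cosines. *)
Lemma thin_cos p q r c c' s t : geodesic p q c -> geodesic p r c' ->
  0 <= s <= mdist p q -> 0 <= t <= mdist p r ->
  mdist p q * mdist p r * mdist (c s) (c' t) ^+ 2 <=
  mdist p q * mdist p r * (s ^+ 2 + t ^+ 2) -
    s * t * (mdist p q ^+ 2 + mdist p r ^+ 2 - mdist q r ^+ 2).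
Proof.
move=> gc gc' /andP[s0 sA] /andP[t0 tB].
set A := mdist p q; set B := mdist p r; set C := mdist q r.
have A0 : 0 <= A by exact: mdist_ge0.
have B0 : 0 <= B by exact: mdist_ge0.
have C0 : 0 <= C by exact: mdist_ge0.
have [A_eq0|An0] := eqVneq A 0.
  have -> : s = 0 by apply/le_anti; rewrite s0 andbT -A_eq0.
  by rewrite A_eq0 !mul0r subrr.
have [B_eq0|Bn0] := eqVneq B 0.
  have -> : t = 0 by apply/le_anti; rewrite t0 andbT -B_eq0.
  by rewrite B_eq0 !(mulr0, mul0r) subrr.
have Ap : 0 < A by rewrite lt_neqAle eq_sym An0.
have Bp : 0 < B by rewrite lt_neqAle eq_sym Bn0.
have T1 : A <= B + C by rewrite /A /B /C (metric_sym q r); exact: metric_triangle.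
have T2 : B <= A + C by exact: metric_triangle.
have T3 : C <= A + B.
  by rewrite /A /B /C (metric_sym p q); exact: metric_triangle.
(* The comparison triangle is (0, 0), (A, 0), (u, v): the law of cosines gives [u], and the triangle
   inequalities give [u ^+ 2 <= B ^+ 2]. *)
pose u := (A ^+ 2 + B ^+ 2 - C ^+ 2) / (2 * A).
have uA : 2 * A * u = A ^+ 2 + B ^+ 2 - C ^+ 2.
  by rewrite /u mulrC divfK// mulf_neq0.
have u2 : u ^+ 2 <= B ^+ 2.
  rewrite -subr_ge0 subr_sqr mulr_ge0// -(pmulr_rge0 _ (_ : 0 < 2 * A)) ?mulr_gt0//.
    by rewrite mulrBr uA; nra.
  by rewrite mulrDr uA; nra.
pose v := Num.sqrt (B ^+ 2 - u ^+ 2).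
have v2 : v ^+ 2 = B ^+ 2 - u ^+ 2 by rewrite sqr_sqrtr// subr_ge0.
case: hX => _ _ thin.
have e1 : eucl_dist (0, 0) (A, 0) = A.
  by rewrite /eucl_dist/= !sub0r sqrrN oppr0 expr0n addr0 sqrtr_sqr ger0_norm.
have e2 : eucl_dist (0, 0) (u, v) = B.
  by rewrite /eucl_dist/= !sub0r !sqrrN v2 addrCA subrr addr0 sqrtr_sqr ger0_norm.
have e3 : eucl_dist (A, 0) (u, v) = C.
  rewrite /eucl_dist/= sub0r sqrrN v2 -[RHS]ger0_norm// -sqrtr_sqr.
  by congr Num.sqrt; nra.
have a01 : s / A \in `[0, 1].
  by rewrite in_itv/= divr_ge0//= ler_pdivrMr// mul1r.
have b01 : t / B \in `[0, 1].
  by rewrite in_itv/= divr_ge0//= ler_pdivrMr// mul1r.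
have := thin p q r c c' gc gc' _ _ _ e1 e2 e3 _ _ a01 b01.
rewrite -/A -/B !divfK// => H.
have H2 : mdist (c s) (c' t) ^+ 2 <= s ^+ 2 + t ^+ 2 - 2 * s * (t / B) * u.
  apply: (@le_trans _ _ (eucl_dist (eucl_point (0, 0) (A, 0) (s / A))
     (eucl_point (0, 0) (u, v) (t / B)) ^+ 2)).
    by rewrite ler_sqr ?nnegrE ?mdist_ge0 ?sqrtr_ge0.
  rewrite /eucl_dist/eucl_point/= sqr_sqrtr ?addr_ge0 ?sqr_ge0//.
  rewrite !mulr0 !add0r divfK// sqrrN [(_ * v) ^+ 2]exprMn v2.
  have -> : t ^+ 2 = (t / B) ^+ 2 * B ^+ 2 by rewrite -exprMn divfK.
  nra.
have := ler_wpM2l (mulr_ge0 A0 B0) H2.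
have -> : A * B * (s ^+ 2 + t ^+ 2 - 2 * s * (t / B) * u) =
  A * B * (s ^+ 2 + t ^+ 2) - s * t * (2 * A * u) by field.
by rewrite uA.
Qed.

Lemma geodesic_uniq x y c c' s : geodesic x y c -> geodesic x y c' ->
  0 <= s <= mdist x y -> c s = c' s.
Proof.
move=> g g' s0; have := thin_cos g g' s0 s0; rewrite mdistxx.
set A := mdist x y in s0 *; move=> H; case/andP: s0 => s0 sA.
have [A0|An0] := eqVneq A 0.
  have -> : s = 0 by apply/le_anti; rewrite s0 andbT -A0.
  by case: g g' => -> _ _ [-> _ _].
have A0 : 0 < A by rewrite lt_neqAle eq_sym An0 mdist_ge0.
apply: mdist_positivity; apply/eqP; rewrite -sqrf_eq0 eq_le sqr_ge0 andbT.
rewrite -(pmulr_rle0 _ (_ : 0 < A * A)) ?mulr_gt0//.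
by apply: le_trans H _; nra.
Qed.

Lemma geodesic_exists x y : exists c, geodesic x y c.
Proof. by case: hX. Qed.

Definition geo x y : R -> X := projT1 (cid (geodesic_exists x y)).

Lemma geoP x y : geodesic x y (geo x y).
Proof. exact: (projT2 (cid (geodesic_exists x y))). Qed.

Lemma geo_shift x y s t : 0 <= s -> 0 <= t -> s + t <= mdist x y ->
  geo x y (s + t) = geo (geo x y s) y t.
Proof.
move=> s0 t0 st; have sI : 0 <= s <= mdist x y by apply/andP; split; lra.
apply: (geodesic_uniq (geodesic_shift (geoP x y) sI) (geoP _ _)).
by rewrite (geodesic_distr (geoP _ _) sI); apply/andP; split; lra.
Qed.

Lemma geo0 x y : geo x y 0 = x. Proof. by case: (geoP x y). Qed.

(** The two points cover different fractions of their geodesics, so convexity of the metric does not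
    apply directly. The law of cosines at [y] does: the defect is the product of
    [A * B - (A - h) * (B - h)] and [C ^+ 2 - (A - B) ^+ 2], both nonnegative. *)
Lemma geo_contract p q y h : 0 <= h -> h <= mdist p y -> h <= mdist q y ->
  mdist (geo p y h) (geo q y h) <= mdist p q.
Proof.
move=> h0 hp hq.
have gp := geodesic_rev (geoP p y); have gq := geodesic_rev (geoP q y).
have A0 := mdist_ge0 p y; have B0 := mdist_ge0 q y.
have D1 := mdist_diff p q y; have D2 := metric_triangle y p q.
move: D2; rewrite (metric_sym y q) => D2.
move: hp hq gp gq A0 B0 D1 D2.
set A := mdist p y; set B := mdist q y; set C := mdist p q.
move=> hA hB gp gq A0 B0 D1 D2.
have [A_eq0|An0] := eqVneq A 0.
  have h_eq0 : h = 0 by apply/le_anti; rewrite h0 andbT -A_eq0.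
  by rewrite h_eq0 !geo0.
have [B_eq0|Bn0] := eqVneq B 0.
  have h_eq0 : h = 0 by apply/le_anti; rewrite h0 andbT -B_eq0.
  by rewrite h_eq0 !geo0.
have Ap : 0 < A by rewrite lt_neqAle eq_sym An0.
have Bp : 0 < B by rewrite lt_neqAle eq_sym Bn0.
have sI : 0 <= A - h <= mdist y p.
  by rewrite (metric_sym y p) -/A; apply/andP; split; lra.
have tI : 0 <= B - h <= mdist y q.
  by rewrite (metric_sym y q) -/B; apply/andP; split; lra.
have := thin_cos gp gq sI tI.
rewrite (metric_sym y p) (metric_sym y q) -/A -/B -/C !subKr => H.
apply: sq_le; first exact: mdist_ge0.
rewrite -(ler_pM2l (mulr_gt0 Ap Bp)); apply: le_trans H _.
have D3 : (A - B) ^+ 2 <= C ^+ 2.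
  by rewrite -[leLHS]real_normK ?num_real// ler_sqr ?nnegrE ?mdist_ge0.
rewrite -subr_ge0.
have -> : A * B * C ^+ 2 - (A * B * ((A - h) ^+ 2 + (B - h) ^+ 2) -
   (A - h) * (B - h) * (A ^+ 2 + B ^+ 2 - C ^+ 2)) =
   (A * B - (A - h) * (B - h)) * (C ^+ 2 - (A - B) ^+ 2) by ring.
by apply: mulr_ge0; nra.
Qed.

(** Bounds the cost of aiming at a wrong target: two geodesics from [x] separate at a rate at most
    the distance of their targets divided by a lower bound [l] of the distances to them. *)
Lemma geo_target x y y' l h : 0 < l -> 0 <= h -> h <= l -> l <= mdist x y -> l <= mdist x y' ->
  mdist (geo x y h) (geo x y' h) <= h / l * mdist y y'.
Proof.
move=> l0 h0 hl lA lB.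
have sI : 0 <= h <= mdist x y by rewrite h0 (le_trans hl).
have tI : 0 <= h <= mdist x y' by rewrite h0 (le_trans hl).
have D1 := mdist_diff y y' x; rewrite !(metric_sym _ x) in D1.
have := thin_cos (geoP x y) (geoP x y') sI tI.
move: lA lB D1; set A := mdist x y; set B := mdist x y'; set C := mdist y y'.
move=> lA lB D1 H.
have Ap : 0 < A by exact: lt_le_trans lA.
have Bp : 0 < B by exact: lt_le_trans lB.
have D3 : (A - B) ^+ 2 <= C ^+ 2.
  by rewrite -[leLHS]real_normK ?num_real// ler_sqr ?nnegrE ?mdist_ge0.
have C0 : 0 <= C by exact: mdist_ge0.
apply: sq_le; first by rewrite mulr_ge0// divr_ge0// ltW.
rewrite -(ler_pM2l (mulr_gt0 Ap Bp)); apply: le_trans H _.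
have -> : A * B * (h ^+ 2 + h ^+ 2) - h * h * (A ^+ 2 + B ^+ 2 - C ^+ 2) =
  h ^+ 2 * (C ^+ 2 - (A - B) ^+ 2) by ring.
have : l ^+ 2 <= A * B by rewrite expr2 ler_pM// ltW.
move=> lAB.
have -> : A * B * (h / l * C) ^+ 2 = h ^+ 2 * (C ^+ 2 * (A * B / l ^+ 2)).
  by field; rewrite gt_eqF.
apply: ler_wpM2l; first exact: sqr_ge0.
apply: (@le_trans _ _ (C ^+ 2)); first by rewrite gerBl sqr_ge0.
by rewrite ler_peMr ?sqr_ge0// ler_pdivlMr ?exprn_gt0// mul1r.
Qed.

Lemma cauchy_limit (u : nat -> X) :
  (forall e : R, 0 < e -> exists N, forall m n, (N <= m)%N -> (N <= n)%N ->
     mdist (u m) (u n) < e) ->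
  exists x, forall e : R, 0 < e -> exists N, forall n, (N <= n)%N -> mdist (u n) x < e.
Proof.
move=> uC; case: hX => complete _ _.
have uF : cauchy (u @ \oo).
  apply/cauchy_ballP => e e0; have [N HN] := uC e e0.
  exists (u @` [set n | (N <= n)%N], u @` [set n | (N <= n)%N]) => /=.
    by split; exists N => // n /= Nn; exists n.
  move=> [_ _] [/= [m Hm <-] [n Hn <-]]; rewrite ballEmdist/=; exact: HN.
have [x ux] := complete (u @ \oo) _ uF.
exists x => e e0.
have : nbhs x (ball x e) by exact: nbhsx_ballx.
move=> /ux [N _ HN]; exists N => n Nn.
by have := HN n Nn; rewrite /= ballEmdist/= metric_sym.
Qed.

End Thin.
End Geodesics.

(** * Lipschitz and continuous curves on an interval *)

Section Curves.
Context {R : realType} {X : metricType R}.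
Implicit Types (a b t : R) (c : R -> X).

Definition lip1 a b c : Prop :=
  forall s t, a <= s <= b -> a <= t <= b -> mdist (c s) (c t) <= `|s - t|.

Definition cont_curve a b c : Prop :=
  forall t, a <= t <= b -> forall e, 0 < e -> exists2 d, 0 < d &
    forall u, a <= u <= b -> `|u - t| < d -> mdist (c u) (c t) < e.

Lemma lip1_le a b c :
  (forall s t, a <= s -> s <= t -> t <= b -> mdist (c s) (c t) <= t - s) ->
  lip1 a b c.
Proof.
move=> H s t /andP[as_ sb] /andP[at_ tb]; have [st|/ltW ts] := leP s t.
  by rewrite ler0_norm ?subr_le0// opprB H.
by rewrite metric_sym ger0_norm ?subr_ge0// H.
Qed.

Lemma lip1_sub a b a' b' c : a <= a' -> b' <= b -> lip1 a b c -> lip1 a' b' c.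
Proof.
move=> aa bb H s t /andP[s1 s2] /andP[t1 t2].
by apply: H; apply/andP; split; lra.
Qed.

Lemma lip1_cont a b c : lip1 a b c -> cont_curve a b c.
Proof.
move=> H t tI e e0; exists e => // u uI; exact: le_lt_trans (H _ _ uI tI).
Qed.

Lemma cont_curve_sub a b a' b' c : a <= a' -> b' <= b ->
  cont_curve a b c -> cont_curve a' b' c.
Proof.
move=> aa bb H t /andP[t1 t2] e e0.
have tI : a <= t <= b by apply/andP; split; lra.
have [d d0 Hd] := H t tI e e0; exists d => // u /andP[u1 u2].
by apply: Hd; apply/andP; split; lra.
Qed.

Lemma cont_mdist a b c c' : cont_curve a b c -> cont_curve a b c' ->
  continuous_on a b (fun t => mdist (c t) (c' t)).
Proof.
move=> H H' t tI e e0; have e20 : 0 < e / 2 by rewrite divr_gt0.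
have [d d0 Hd] := H t tI _ e20; have [d' d'0 Hd'] := H' t tI _ e20.
exists (Num.min d d'); first by rewrite lt_min d0.
move=> u uI; rewrite lt_min => /andP[ud ud'].
have := mdist_diff (c u) (c t) (c' u).
have := mdist_diff (c' u) (c' t) (c t).
rewrite !(metric_sym _ (c t)) !ler_norml => /andP[h1 h2] /andP[h3 h4].
have := Hd u uI ud; have := Hd' u uI ud'; rewrite (metric_sym (c u) (c t)).
by move=> h5 h6; rewrite ltr_norml; apply/andP; split; lra.
Qed.

End Curves.

(** * Curves that chase [Y] to first order: comparison, local existence, extension *)

Section Chase.
Context {R : realType} {X : metricType R}.
Hypothesis hX : @CAT0 R X.
Variable Y : R -> X.
Hypothesis hY : forall t t' : R, 0 <= t -> 0 <= t' -> mdist (Y t) (Y t') <= `|t - t'|.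
Implicit Types (a b t e : R) (c : R -> X) (p : X).
Local Notation geo := (geo hX).

(** A fixed [e] measures the defect of an approximate solution; exact solutions satisfy this for
    every positive [e]. Stated with distances rather than directions, it combines with
    [geo_contract]. *)
Definition chase_err c t e : Prop :=
  exists2 d : R, 0 < d &
    forall h, 0 < h < d -> mdist (c (t + h)) (geo (c t) (Y t) h) <= e * h.

(** The estimate is right-sided, so curves glued at a time need only agree there as points, not in
    direction. *)
Lemma chase_err_eq c c' t e d : 0 < d ->
  (forall u, t <= u < t + d -> c u = c' u) -> chase_err c t e -> chase_err c' t e.
Proof.
move=> d0 cc' [d' d'0 H]; exists (Num.min d d'); first by rewrite lt_min d0.
move=> h /andP[h0]; rewrite lt_min => /andP[hd hd'].
rewrite -cc' ?ltrD2l ?hd ?andbT ?lerDl ?(ltW h0)//.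
by rewrite -cc' ?lexx ?ltrDl// H// h0.
Qed.

(** Over a short step each curve is replaced by the geodesic towards [Y t]; by [geo_contract] the
    two geodesic points get no farther apart, so only the errors accumulate. *)
Lemma chase_compare a b c c' e e' : a <= b -> lip1 a b c -> lip1 a b c' ->
  (forall t, a <= t < b -> [/\ c t <> Y t, c' t <> Y t, chase_err c t e & chase_err c' t e']) ->
  mdist (c b) (c' b) <= mdist (c a) (c' a) + (e + e') * (b - a).
Proof.
move=> ab lc lc' H.
apply: (growth_bound (f := fun t => mdist (c t) (c' t))) => //.
  by apply: cont_mdist; exact: lip1_cont.
move=> t tI d d0; have [/eqP cY /eqP c'Y [d1 d10 H1] [d2 d20 H2]] := H t tI.
have D1 : 0 < mdist (c t) (Y t) by rewrite mdist_gt0.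
have D2 : 0 < mdist (c' t) (Y t) by rewrite mdist_gt0.
pose m := Num.min (Num.min d (Num.min d1 d2))
            (Num.min (mdist (c t) (Y t)) (mdist (c' t) (Y t))).
have m0 : 0 < m by rewrite !lt_min d0 d10 d20 D1 D2.
have : m / 2 < m by lra.
rewrite !lt_min => /andP[/andP[md /andP[m1 m2]] /andP[m3 m4]].
have h0 : 0 < m / 2 by lra.
exists (m / 2); first by rewrite h0.
have := H1 (m / 2); rewrite h0 m1 => /(_ isT).
have := H2 (m / 2); rewrite h0 m2 => /(_ isT).
have := geo_contract hX (ltW h0) (ltW m3) (ltW m4).
have := metric_triangle (c (t + m / 2)) (geo (c t) (Y t) (m / 2)) (c' (t + m / 2)).
have := metric_triangle (geo (c t) (Y t) (m / 2)) (geo (c' t) (Y t) (m / 2)) (c' (t + m / 2)).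
by rewrite (metric_sym (c' (t + m / 2)) (geo (c' t) (Y t) (m / 2))); lra.
Qed.

Lemma geo_lip p b h : h <= mdist p (Y b) ->
  lip1 b (b + h) (fun u => geo p (Y b) (u - b)).
Proof.
move=> hp s t /andP[s1 s2] /andP[t1 t2].
rewrite (geodesic_dist (geoP hX _ _)).
- by rewrite opprB addrA subrK.
- by apply/andP; split; lra.
- by apply/andP; split; lra.
Qed.

(** While the target is frozen at [Y b], the true target moves by at most [h], and [geo_target]
    turns this into an error rate [h / l]. *)
Lemma geo_chase p b h l : 0 <= b -> 0 < l -> h <= l ->
  (forall u v, b <= u <= b + h -> b <= v <= b + h ->
     l <= mdist (geo p (Y b) (u - b)) (Y v)) ->
  forall t, b <= t < b + h ->
  chase_err (fun u => geo p (Y b) (u - b)) t (h / l).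
Proof.
move=> b0 l0 hl far t /andP[bt th]; exists (b + h - t); first lra.
move=> k /andP[k0 kh].
have lp : l <= mdist p (Y b).
  have := far b b; rewrite subrr geo0; apply; apply/andP; split; lra.
have tI : 0 <= t - b <= mdist p (Y b) by apply/andP; split; lra.
have -> : t + k - b = (t - b) + k by ring.
have F1 : l <= mdist (geo p (Y b) (t - b)) (Y b) by apply: far; apply/andP; split; lra.
have F2 : l <= mdist (geo p (Y b) (t - b)) (Y t) by apply: far; apply/andP; split; lra.
have D := geodesic_distr (geoP hX p (Y b)) tI.
rewrite geo_shift; [|lra|lra|lra].
have kl : k <= l by lra.
apply: le_trans (geo_target hX l0 (ltW k0) kl F1 F2) _.
have YY : mdist (Y b) (Y t) <= h.
  apply: le_trans (hY _ _) _ => //; first lra.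
  by rewrite ler0_norm; lra.
by rewrite mulrAC [leRHS]mulrAC ler_pM2r ?invr_gt0// mulrC ler_pM2r.
Qed.

Section Local.
Variables (a : R) (p : X).
Hypotheses (a0 : 0 <= a) (pY : p <> Y a).
Let L := mdist p (Y a).

Let L0 : 0 < L. Proof. by rewrite mdist_gt0; exact/eqP. Qed.

(** The origin of the horizon [L / 4] and of the distance [L / 2] below: point and target each use
    up at most a quarter of the initial distance. *)
Let far z v : mdist p z <= L / 4 -> a <= v <= a + L / 4 -> L / 2 <= mdist z (Y v).
Proof.
move=> pz /andP[av vL].
have v0 : 0 <= v by exact: le_trans a0 av.
have := hY a0 v0; rewrite ler0_norm ?subr_le0//.
have := metric_triangle p z (Y a); have := metric_triangle z (Y v) (Y a).
by rewrite -/L (metric_sym (Y v)); lra.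
Qed.

(** Induction on the number of legs: the leg added at time [b] runs for time [h] along the geodesic
    towards [Y b], and [geo_chase] applies with [l = L / 2]. *)
Lemma euler_polygon h (k : nat) : 0 < h -> k%:R * h <= L / 4 ->
  exists c, [/\ c a = p, lip1 a (a + k%:R * h) c &
    forall t, a <= t < a + k%:R * h -> chase_err c t (h / (L / 2))].
Proof.
have a0' := a0; have L0' := L0.
move=> h0; elim: k => [|k IH] kL.
  exists (fun=> p); split=> //; first by move=> s t _ _; rewrite mdistxx.
  by move=> t; rewrite mul0r addr0 => /andP[h1 /(le_lt_trans h1)]; rewrite ltxx.
move: kL; rewrite -(@natr1 _ k) mulrDl mul1r => kL.
have kh0 : 0 <= k%:R * h by rewrite mulr_ge0// ltW.
have [|c [ca lc Hc]] := IH; first lra.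
set b := a + k%:R * h; rewrite addrA -/b.
have ab : a <= b by rewrite lerDl.
rewrite -/b in lc Hc.
have dp t : a <= t <= b -> mdist p (c t) <= t - a.
  move=> tI; rewrite -ca; apply: le_trans (lc _ _ _ tI) _.
    by rewrite lexx.
  by rewrite ler0_norm; case/andP: tI => *; lra.
have bI : a <= b <= b by rewrite ab lexx.
pose q := c b; pose w u := geo q (Y b) (u - b).
have hL2 : h <= L / 2 by lra.
have qY : L / 2 <= mdist q (Y b).
  apply: far; first by apply: le_trans (dp _ bI) _; rewrite /b; lra.
  by rewrite ab /b; lra.
have wl : lip1 b (b + h) w by apply: geo_lip; lra.
have wb : w b = q by rewrite /w subrr geo0.
pose c' t := if t <= b then c t else w t.
have c'c t : t <= b -> c' t = c t by rewrite /c' => ->.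
have c'w t : b <= t -> c' t = w t.
  by rewrite /c' le_eqVlt => /predU1P[<-|/lt_geF->//]; rewrite lexx wb.
exists c'; split; first by rewrite c'c.
  apply: lip1_le => s t as_ st tb.
  have [tb'|bt] := leP t b.
    rewrite !c'c//; last lra.
    apply: le_trans (lc _ _ _ _) _; [apply/andP; split; lra|apply/andP; split; lra|].
    by rewrite ler0_norm; lra.
  have [bs|sb] := leP b s.
    rewrite !c'w//; last lra.
    apply: le_trans (wl _ _ _ _) _; [apply/andP; split; lra|apply/andP; split; lra|].
    by rewrite ler0_norm; lra.
  rewrite c'c ?(ltW sb)// c'w ?(ltW bt)//.
  have := metric_triangle (c s) q (w t).
  have := lc s b; rewrite ler0_norm; last lra.
  have := wl b t; rewrite ler0_norm; last lra.
  rewrite wb -/q => h1 h2 h3.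
  have := h1 _ _; have := h2 _ _.
  have sI : a <= s <= b by apply/andP; split; lra.
  have tI : b <= t <= b + h by apply/andP; split; lra.
  have bI' : b <= b <= b + h by apply/andP; split; lra.
  by move=> /(_ sI bI) ? /(_ bI' tI) ?; lra.
move=> t /andP[at_ tb].
have [bt|tb'] := leP b t.
  apply: (@chase_err_eq w c' _ _ 1) => //.
    by move=> u /andP[tu _]; rewrite c'w//; lra.
  apply: geo_chase; [lra|lra|lra| |by rewrite bt].
  move=> u v /andP[bu ub] /andP[bv vb]; apply: far.
    have := metric_triangle p q (w u); have := dp b bI.
    have := wl b u; rewrite wb ler0_norm; last lra.
    have bI' : b <= b <= b + h by apply/andP; split; lra.
    have uI : b <= u <= b + h by apply/andP; split; lra.
    move=> /(_ bI' uI); rewrite -/q -/(w u) => h1 h2 h3.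
    by apply: le_trans h3 _; move: ub; rewrite /b in h2 *; lra.
  by apply/andP; split; move: bv vb; rewrite /b; lra.
apply: (@chase_err_eq c c' _ _ (b - t)); first lra.
  by move=> u /andP[tu ub]; rewrite c'c//; lra.
by apply: Hc; rewrite at_.
Qed.

(** A uniform limit keeps the Lipschitz bound, but a first-order estimate at a given time need not
    survive it. The polygons are therefore compared with the geodesic [w] from [s t] towards [Y t],
    which has error rate [k / (L / 2)] on [t, t + k]. In the limit, [s] stays within k^2 / (L / 2)
    of it, which is o(k). *)
Lemma chase_local : exists2 b, a < b & exists c, [/\ c a = p, lip1 a b c,
  forall t, a <= t <= b -> c t <> Y t &
  forall t, a <= t < b -> forall e, 0 < e -> chase_err c t e].
Proof.
pose b := a + L / 4; exists b; first by rewrite ltrDl divr_gt0.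
pose h n := L / 4 / n.+1%:R : R.
have h0 n : 0 < h n by rewrite !divr_gt0.
have hb n : n.+1%:R * h n = L / 4 by rewrite mulrC divfK// pnatr_eq0.
have polygon n : exists c, [/\ c a = p, lip1 a b c &
    forall t, a <= t < b -> chase_err c t (h n / (L / 2))].
  by have := @euler_polygon (h n) n.+1 (h0 n); rewrite hb lexx => /(_ isT).
have [C HC] := choice polygon.
have a0' := a0; have L0' := L0.
have bE : b = a + L / 4 by [].
have ab : a <= b by rewrite lerDl divr_ge0// ltW.
have aI : a <= a <= b by rewrite lexx.
have near_p c t : c a = p -> lip1 a b c -> a <= t <= b -> mdist p (c t) <= t - a.
  move=> ca lc tI; rewrite -ca; apply: le_trans (lc _ _ aI tI) _.
  by rewrite ler0_norm; case/andP: tI => *; lra.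
have far' c t v : c a = p -> lip1 a b c -> a <= t <= b -> a <= v <= b ->
    L / 2 <= mdist (c t) (Y v).
  move=> ca lc tI vI; apply: far => //; apply: le_trans (near_p _ _ ca lc tI) _.
  by case/andP: tI; lra.
have nY c t : c a = p -> lip1 a b c -> a <= t <= b -> c t <> Y t.
  by move=> ca lc tI; apply/eqP; rewrite -mdist_gt0 (lt_le_trans _ (far' c t t _ _ _ _))//; lra.
pose e n := h n / (L / 2).
have e0 n : 0 < e n by rewrite divr_gt0// divr_gt0.
have e_small x : 0 < x -> exists N, forall n, (N <= n)%N -> e n < x.
  move=> x0; pose N := Num.truncn (x^-1); exists N => n Nn.
  have En : e n = (2 * n.+1%:R)^-1.
    have alg (l m : R) : l != 0 -> m != 0 -> l / 4 / m / (l / 2) = (2 * m)^-1.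
      by move=> l_neq0 m_neq0; field; rewrite m_neq0.
    by apply: alg; rewrite ?pnatr_eq0// gt_eqF.
  rewrite En invf_plt ?posrE//.
  have : x^-1 < n.+1%:R.
    by rewrite (lt_le_trans (truncnS_gt _))// ler_nat ltnS.
  have : (0 : R) < n.+1%:R by rewrite ltr0n.
  lra.
have Ccmp n m t : a <= t <= b -> mdist (C n t) (C m t) <= (e n + e m) * L.
  case/andP=> at_ tb; have [Can lCn En] := HC n; have [Cam lCm Em] := HC m.
  apply: (@le_trans _ _ ((e n + e m) * (t - a))); last first.
    by apply: ler_wpM2l; [rewrite addr_ge0// ltW|lra].
  have := @chase_compare a t (C n) (C m) (e n) (e m) at_ (lip1_sub (lexx _) tb lCn)
    (lip1_sub (lexx _) tb lCm).
  rewrite Can Cam mdistxx add0r; apply=> u /andP[au ut].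
  have uI : a <= u < b by rewrite au (lt_le_trans ut).
  have uI' : a <= u <= b by rewrite au ltW// (lt_le_trans ut).
  by split; [exact: nY|exact: nY|exact: En|exact: Em].
have limit t : exists x, a <= t <= b -> forall r : R, 0 < r ->
    exists N, forall n, (N <= n)%N -> mdist (C n t) x < r.
  have [tI|tI] := boolP (a <= t <= b); last by exists p.
  have [r r0|x Hx] := cauchy_limit hX (u := fun n => C n t); last by exists x.
  have r0' : 0 < r / (2 * L) by rewrite divr_gt0// mulr_gt0.
  have [N HN] := e_small _ r0'; exists N => m n Nm Nn.
  apply: le_lt_trans (Ccmp _ _ _ tI) _.
  have := HN _ Nm; have := HN _ Nn.
  rewrite !ltr_pdivlMr ?mulr_gt0//; lra.
have [s Hs] := choice limit.
have sa : s a = p.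
  apply: mdist0_eq; apply/ler_addgt0Pr => r r0; rewrite add0r.
  have [N /(_ _ (leqnn N))] := Hs a aI r r0; have [-> _ _] := HC N.
  by rewrite metric_sym => /ltW.
have sl : lip1 a b s.
  move=> t u tI uI; apply/ler_addgt0Pr => r r0.
  have r20 : 0 < r / 2 by rewrite divr_gt0.
  have [N1 H1] := Hs t tI _ r20; have [N2 H2] := Hs u uI _ r20.
  pose N := maxn N1 N2; have [_ lC _] := HC N.
  have := H1 N (leq_maxl _ _); have := H2 N (leq_maxr _ _); have := lC t u tI uI.
  have := metric_triangle (s t) (C N t) (s u).
  have := metric_triangle (C N t) (C N u) (s u).
  by rewrite (metric_sym (s t) (C N t)); lra.
exists s; split=> // [t tI|]; first exact: nY.
move=> t /andP[at_ tb] x x0.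
(* For smaller [k] the error rate [k / (L / 2)] of the geodesic is below [x]. *)
exists (Num.min (b - t) (x * L / 2)).
  by rewrite lt_min subr_gt0 tb divr_gt0// mulr_gt0.
move=> k /andP[k0]; rewrite lt_min => /andP[kb kx].
have tI : a <= t <= b by rewrite at_ ltW.
have tkI : a <= t + k <= b by apply/andP; split; lra.
pose w u := geo (s t) (Y t) (u - t).
have wt : w t = s t by rewrite /w subrr geo0.
have kL : k <= L / 2 by lra.
have wl : lip1 t (t + k) w by apply: geo_lip; apply: le_trans kL _; exact: far'.
have wfar u v : t <= u <= t + k -> t <= v <= t + k -> L / 2 <= mdist (w u) (Y v).
  move=> uI /andP[tv vk]; apply: far; last by apply/andP; split; lra.
  have := metric_triangle p (s t) (w u); have := near_p s t sa sl tI.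
  have tI' : t <= t <= t + k by apply/andP; split; lra.
  have := wl t u tI' uI; rewrite wt; case/andP: uI => tu uk.
  rewrite ler0_norm; last lra.
  move=> h1 h2 h3; apply: le_trans h3 _; lra.
have L20 : 0 < L / 2 by lra.
have t0 : 0 <= t by lra.
have wc := geo_chase t0 L20 kL wfar.
apply/ler_addgt0Pr => r r0.
have r20 : 0 < r / 2 by rewrite divr_gt0.
(* The polygon deviates from [s] by at most [r / 8] at both ends and contributes at most [r / 4]
   through its own error over time [k]. *)
have r40 : 0 < r / 4 / k by rewrite !divr_gt0.
have r41 : 0 < r / 8 by rewrite divr_gt0.
have [N1 H1] := Hs t tI _ r41; have [N2 H2] := Hs _ tkI _ r41.
have [N3 H3] := e_small _ r40.
pose N := maxn N1 (maxn N2 N3); have [CaN lCN EN] := HC N.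
have tk : t <= t + k by lra.
have := @chase_compare t (t + k) (C N) w (e N) (k / (L / 2)) tk
  (lip1_sub at_ (andP tkI).2 lCN) wl.
have step u : t <= u < t + k -> [/\ C N u <> Y u, w u <> Y u,
    chase_err (C N) u (e N) & chase_err w u (k / (L / 2))].
  move=> uI; have /andP[tu uk] := uI.
  split; [by apply: nY => //; apply/andP; split; lra| | |exact: wc].
    apply/eqP; rewrite -mdist_gt0 (lt_le_trans L20)// wfar//; apply/andP; split; lra.
  apply: EN; apply/andP; split; lra.
move=> /(_ step).
have := H1 N (leq_maxl _ _).
have := H2 N; rewrite /N leq_max leq_max leqnn orbT => /(_ isT).
have := H3 N; rewrite /N leq_max leq_max leqnn !orbT => /(_ isT).
rewrite -/N ltr_pdivlMr// wt /w.
have -> : t + k - t = k by ring.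
have kk : k / (L / 2) * k <= x * k.
  by apply: ler_wpM2r; [exact: ltW|rewrite ler_pdivrMr//; lra].
have := metric_triangle (s (t + k)) (C N (t + k)) (geo (s t) (Y t) k).
rewrite (metric_sym (s (t + k)) (C N (t + k))) mulrDl; lra.
Qed.

End Local.

(** Capture is excluded at [b] as well, so that [chase_local] can restart from there. *)
Definition chase_on (x0 : X) b c : Prop := [/\ c 0 = x0, lip1 0 b c,
  forall t, 0 <= t <= b -> c t <> Y t &
  forall t, 0 <= t < b -> forall e, 0 < e -> chase_err c t e].

(** Allows the local solutions to be patched together; it concerns first-order chasing curves only,
    not arbitrary pursuit curves. *)
Lemma chase_on_uniq x0 b b' c c' t : chase_on x0 b c -> chase_on x0 b' c' ->
  0 <= t -> t <= b -> t <= b' -> c t = c' t.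
Proof.
move=> [c0 lc cY Hc] [c'0 lc' c'Y Hc'] t0 tb tb'.
apply: mdist0_eq; apply/ler_addgt0Pr => e e0; rewrite add0r.
have e'0 : 0 < e / (2 * (t + 1)) by rewrite divr_gt0// mulr_gt0//; lra.
have := @chase_compare 0 t c c' (e / (2 * (t + 1))) (e / (2 * (t + 1))) t0
  (lip1_sub (lexx _) tb lc) (lip1_sub (lexx _) tb' lc').
rewrite c0 c'0 mdistxx add0r subr0 => H; apply: le_trans (H _) _.
  move=> u /andP[u0 ut]; split.
  - by apply: cY; apply/andP; split; lra.
  - by apply: c'Y; apply/andP; split; lra.
  - by apply: Hc => //; apply/andP; split; lra.
  - by apply: Hc' => //; apply/andP; split; lra.
rewrite (_ : _ * t = e * (t / (t + 1))); last by field; rewrite gt_eqF//; lra.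
by rewrite ler_piMr ?(ltW e0)// ler_pdivrMr//; lra.
Qed.

Lemma chase_on_extend x0 b c : 0 <= b -> chase_on x0 b c ->
  exists2 b', b < b' & exists c', chase_on x0 b' c'.
Proof.
move=> b0 [c0 lc cY Hc].
have bb : 0 <= b <= b by rewrite b0 lexx.
have [b' bb' [w [wb wl wY Hw]]] := chase_local b0 (cY b bb).
exists b' => //; pose c' t := if t <= b then c t else w t.
have c'c t : t <= b -> c' t = c t by rewrite /c' => ->.
have c'w t : b <= t -> c' t = w t.
  by rewrite /c' le_eqVlt => /predU1P[<-|/lt_geF->//]; rewrite lexx wb.
exists c'; split.
- by rewrite c'c.
- apply: lip1_le => s t as_ st tb.
  have [tb'|bt] := leP t b.
    rewrite !c'c//; last lra.
    apply: le_trans (lc _ _ _ _) _; [apply/andP; split; lra|apply/andP; split; lra|].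
    by rewrite ler0_norm; lra.
  have [bs|sb] := leP b s.
    rewrite !c'w//; last lra.
    apply: le_trans (wl _ _ _ _) _; [apply/andP; split; lra|apply/andP; split; lra|].
    by rewrite ler0_norm; lra.
  rewrite c'c ?(ltW sb)// c'w ?(ltW bt)//.
  have := metric_triangle (c s) (c b) (w t).
  have := lc s b; rewrite ler0_norm; last lra.
  have := wl b t; rewrite ler0_norm; last lra.
  rewrite wb => h1 h2 h3.
  have sI : 0 <= s <= b by apply/andP; split; lra.
  have tI : b <= t <= b' by apply/andP; split; lra.
  have bI' : b <= b <= b' by apply/andP; split; lra.
  by move: (h1 bI' tI) (h2 sI bb) => ? ?; lra.
- move=> t /andP[t0 tb]; have [tb'|bt] := leP t b.
    by rewrite c'c//; apply: cY; rewrite t0.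
  by rewrite c'w ?(ltW bt)//; apply: wY; rewrite ltW.
- move=> t /andP[t0 tb] e e0; have [bt|tb'] := leP b t.
    apply: (@chase_err_eq w c' _ _ 1) => //.
      by move=> u /andP[tu _]; rewrite c'w//; lra.
    by apply: Hw => //; rewrite bt.
  apply: (@chase_err_eq c c' _ _ (b - t)); first lra.
    by move=> u /andP[tu ub]; rewrite c'c//; lra.
  by apply: Hc => //; rewrite t0.
Qed.

End Chase.

(** * Continuation until capture *)

Section GlobalExistence.
Context {R : realType} {X : metricType R}.
Hypothesis hX : @CAT0 R X.
Variable Y : R -> X.
Hypothesis hY : forall t t' : R, 0 <= t -> 0 <= t' -> mdist (Y t) (Y t') <= `|t - t'|.
Variable x0 : X.

(** Completeness provides the endpoint: the values at times increasing to [u] form a Cauchy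
    sequence. *)
Lemma lip1_extend (u : R) (c : R -> X) : 0 < u ->
  (forall b, 0 <= b < u -> lip1 0 b c) ->
  exists x, lip1 0 u (fun t => if t < u then c t else x).
Proof.
move=> u0 lc.
pose v n := u - u / n.+1%:R : R.
have v0 n : 0 <= v n < u.
  have n0 : (0 : R) < n.+1%:R by rewrite ltr0n.
  by rewrite gtrBl divr_gt0// subr_ge0 ler_pdivrMr// ler_peMr ?ler1n// ltW.
have v_near d : 0 < d -> exists N, forall n, (N <= n)%N -> u - v n < d.
  move=> d0; exists (Num.truncn (u / d)) => n Nn; rewrite subKr.
  rewrite ltr_pdivrMr ?ltr0n// mulrC -ltr_pdivrMr//.
  by rewrite (lt_le_trans (truncnS_gt _))// ler_nat ltnS.
have lc' s t : 0 <= s -> 0 <= t -> s < u -> t < u -> mdist (c s) (c t) <= `|s - t|.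
  move=> s0 t0 su tu; apply: (lc (Num.max s t)).
  - by rewrite gt_max su tu le_max s0.
  - by rewrite s0 le_max lexx.
  - by rewrite t0 le_max lexx orbT.
have [e e0|x Hx] := cauchy_limit hX (u := fun n => c (v n)).
  have [N HN] := v_near e e0; exists N => m n Nm Nn.
  have /andP[m0 mu] := v0 m; have /andP[n0 nu] := v0 n.
  apply: le_lt_trans (lc' _ _ m0 n0 mu nu) _.
  have := HN m Nm; have := HN n Nn => h1 h2.
  by rewrite ltr_norml; apply/andP; split; lra.
have cx s : 0 <= s -> s < u -> mdist (c s) x <= u - s.
  move=> s0 su; apply/ler_addgt0Pr => e e0.
  have su0 : 0 < u - s by rewrite subr_gt0.
  have [N1 H1] := Hx e e0; have [N2 H2] := v_near _ su0.
  pose N := maxn N1 N2.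
  have := H1 N (leq_maxl _ _); have := H2 N (leq_maxr _ _).
  have /andP[n0 nu] := v0 N.
  move=> h1 h2; have := lc' s (v N) s0 n0 su nu.
  rewrite ler0_norm; last lra.
  have := metric_triangle (c s) (c (v N)) x; lra.
exists x; apply: lip1_le => s t s0 st tu.
have [tu'|ut] := ltP t u.
  rewrite (le_lt_trans st tu').
  apply: le_trans (lc' _ _ _ _ _ _) _; rewrite ?(le_trans s0 st)//.
    exact: le_lt_trans tu'.
  by rewrite ler0_norm ?subr_le0// opprB.
case: ifPn => [su|]; first by apply: le_trans (cx _ s0 su) _; lra.
by rewrite mdistxx subr_ge0.
Qed.

Lemma chase_exists : exists (T : \bar R) (s : R -> X),
  [/\ s 0 = x0, is_capture_time Y s T,
      forall b, 0 <= b -> (b%:E <= T)%E -> lip1 0 b s &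
      forall t, 0 <= t -> (t%:E < T)%E -> forall e, 0 < e -> chase_err hX Y s t e].
Proof.
have [xY|xY] := EM (x0 = Y 0).
  exists 0%E, (fun=> x0); split=> //.
  - by left; exists 0; split=> // t /andP[t0 /(le_lt_trans t0)]; rewrite ltxx.
  - by move=> b _ _ u t _ _; rewrite mdistxx.
  - by move=> t t0; rewrite lte_fin => /(le_lt_trans t0); rewrite ltxx.
pose D t := exists b, t <= b /\ exists c, chase_on hX Y x0 b c.
have D0 : D 0.
  exists 0; split=> //; exists (fun=> x0); split=> //.
  - by move=> s t _ _; rewrite mdistxx.
  - by move=> t /le_anti <-.
  - by move=> t /andP[t0 /(le_lt_trans t0)]; rewrite ltxx.
(* By [chase_on_uniq] all chasing curves that reach time [t] agree there; their common value defines
   the maximal curve. *)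
have val t : exists x, 0 <= t -> D t -> forall b c, chase_on hX Y x0 b c ->
    t <= b -> x = c t.
  have [t0|/negP t0] := boolP (0 <= t); last by exists x0.
  have [[b [tb [c Hc]]]|nD] := EM (D t); last by exists x0.
  by exists (c t) => _ _ b' c' Hc' tb'; exact: chase_on_uniq Hc Hc' t0 tb tb'.
have [s Hs] := choice val.
have sE b c : chase_on hX Y x0 b c -> forall t, 0 <= t <= b -> s t = c t.
  by move=> Hc t /andP[t0 tb]; apply: (Hs t t0 _ b c) => //; exists b; split=> //; exists c.
have onD t : 0 <= t -> D t -> [/\ lip1 0 t s, s t <> Y t &
    forall e, 0 < e -> chase_err hX Y s t e].
  move=> t0 [b [tb [c Hc]]].
  have b0 : 0 <= b by exact: le_trans tb.
  have [b' bb' [c' Hc']] := chase_on_extend hY b0 Hc.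
  have E := sE _ _ Hc'; have [c'0 lc' c'Y Hc'e] := Hc'.
  split.
  - move=> u v /andP[u0 ut] /andP[v0 vt].
    rewrite !E; [|apply/andP; split; lra|apply/andP; split; lra].
    by apply: lc'; apply/andP; split; lra.
  - by rewrite E ?c'Y//; [|apply/andP; split; lra]; apply: c'Y; apply/andP; split; lra.
  - move=> e e0; apply: (@chase_err_eq _ _ _ _ c' s _ _ (b' - t)); first lra.
      by move=> u /andP[tu ub]; rewrite E//; apply/andP; split; lra.
    by apply: Hc'e => //; apply/andP; split; lra.
have s0 : s 0 = x0.
  have [b [b0 [c Hc]]] := D0; rewrite (sE _ _ Hc) ?lexx//.
  by case: Hc.
have [allD|/existsNP[t1 /not_implyP[t10 nD]]] := EM (forall t, 0 <= t -> D t).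
  exists +oo%E, s; split=> //.
  - by right; split=> // t t0; have [] := onD t t0 (allD t t0).
  - by move=> b b0 _; have [] := onD b b0 (allD b b0).
  - by move=> t t0 _; have [] := onD t t0 (allD t t0).
pose B := [set b | 0 <= b /\ D b].
have hB : has_sup B.
  split; first by exists 0; split.
  exists t1 => b [b0 [b' [bb' Hb']]]; rewrite leNgt; apply/negP => tb.
  by apply: nD; exists b'; split=> //; apply: le_trans bb'; exact: ltW.
pose u := sup B.
have Du t : 0 <= t -> t < u -> D t.
  move=> t0 tu; have ut0 : 0 < u - t by rewrite subr_gt0.
  have [b [b0 [b' [bb' Hb']]] ub] := sup_adherent ut0 hB.
  by exists b'; split=> //; apply: le_trans bb'; rewrite ltW//; move: ub; rewrite subKr.
have nDu b : u < b -> ~ D b.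
  move=> ub Db; have b0 : 0 <= b.
    by apply: le_trans (ltW ub); apply: ub_le_sup hB.2 _ _; split.
  suff : b <= u by rewrite leNgt ub.
  by apply: ub_le_sup hB.2 _ _; split.
have u0 : 0 < u.
  have [b [b0 [c Hc]]] := D0; have [b' bb' [c' Hc']] := chase_on_extend hY b0 Hc.
  apply: (@lt_le_trans _ _ b'); first exact: le_lt_trans bb'.
  by apply: ub_le_sup hB.2 _ _; split; [lra|exists b'; split=> //; exists c'].
have [|x Hx] := lip1_extend (c := s) u0.
  by move=> b /andP[b0 bu]; have [] := onD b b0 (Du b b0 bu).
pose s' t := if t < u then s t else x.
have s's t : t < u -> s' t = s t by rewrite /s' => ->.
have He t : 0 <= t < u -> forall e, 0 < e -> chase_err hX Y s' t e.
  move=> /andP[t0 tu] e e0; have [_ _ /(_ e e0) H] := onD t t0 (Du t t0 tu).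
  apply: (@chase_err_eq _ _ _ _ s s' _ _ (u - t)) H; first by rewrite subr_gt0.
  by move=> v /andP[tv vu]; rewrite s's//; lra.
have HY t : 0 <= t < u -> s' t <> Y t.
  by move=> /andP[t0 tu]; rewrite s's//; have [] := onD t t0 (Du t t0 tu).
have s'0 : s' 0 = x0 by rewrite s's.
(* Otherwise [s'] chases on the closed interval up to [u] and extends beyond it, against the choice
   of [u]. *)
have s'u : s' u = Y u.
  apply: contrapT => s'Y.
  have Hc : chase_on hX Y x0 u s'.
    split=> // t /andP[t0]; rewrite le_eqVlt => /predU1P[->//|tu].
    by apply: HY; rewrite t0.
  have [b' bb' [c' Hc']] := chase_on_extend hY (ltW u0) Hc.
  by apply: (nDu b' bb'); exists b'; split=> //; exists c'.
exists u%:E, s'; split=> //.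
- by left; exists u; split=> //; exact: ltW.
- by move=> b b0; rewrite lee_fin => bu; apply: lip1_sub Hx.
- by move=> t t0; rewrite lte_fin => tu; apply: He; rewrite t0.
Qed.

End GlobalExistence.

(** * Comparison angles and the law of cosines *)

Section CosineLaw.
Context {R : realType} {X : metricType R}.
Implicit Types (x p q : X).

Lemma ler_cos0pi (a b : R) : 0 <= a <= pi -> 0 <= b <= pi ->
  (cos b <= cos a) = (a <= b).
Proof.
by move=> a0 b0; rewrite leNgt ltr_cos ?in_itv// -leNgt.
Qed.

Lemma comparison_cos_bounds x p q : x != p -> x != q ->
  -1 <= (mdist x p ^+ 2 + mdist x q ^+ 2 - mdist p q ^+ 2) /
    (2 * mdist x p * mdist x q) <= 1.
Proof.
rewrite -!mdist_gt0 => A0 B0; have C0 := mdist_ge0 p q.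
have T1 := metric_triangle x q p; have T2 := metric_triangle x p q.
have T3 := metric_triangle p x q; rewrite (metric_sym q p) in T1.
rewrite (metric_sym p x) in T3.
have AB0 : 0 < 2 * mdist x p * mdist x q by rewrite !mulr_gt0.
by rewrite ler_pdivlMr// ler_pdivrMr//; apply/andP; split; nra.
Qed.

Lemma comparison_angle_bounds x p q : x != p -> x != q ->
  0 <= comparison_angle x p q <= pi.
Proof.
by move=> xp xq; have H := comparison_cos_bounds xp xq; rewrite acos_ge0// acos_lepi.
Qed.

Lemma cos_comparison x p q : x != p -> x != q ->
  cos (comparison_angle x p q) = (mdist x p ^+ 2 + mdist x q ^+ 2 - mdist p q ^+ 2) /
    (2 * mdist x p * mdist x q).
Proof. by move=> xp xq; rewrite acosK// in_itv/= comparison_cos_bounds. Qed.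

(** If [x] is [p] or [q], the angle takes a default value, but its coefficient vanishes. *)
Lemma cosine_law x p q : mdist p q ^+ 2 = mdist x p ^+ 2 + mdist x q ^+ 2 -
  2 * mdist x p * mdist x q * cos (comparison_angle x p q).
Proof.
have [->|xp] := eqVneq x p; first by rewrite mdistxx !(mulr0, mul0r) expr0n add0r subr0.
have [->|xq] := eqVneq x q.
  by rewrite mdistxx !(mulr0, mul0r) expr0n addr0 subr0 metric_sym.
by rewrite cos_comparison// mulrC divfK ?subKr// !mulf_neq0// gt_eqF// mdist_gt0.
Qed.

Lemma comparison_angle_sym x p q : comparison_angle x p q = comparison_angle x q p.
Proof.
by rewrite /comparison_angle (metric_sym p q) addrC; congr (acos (_ / _)); ring.
Qed.

Lemma comparison_le x p q (a : R) : x != p -> x != q -> 0 <= a <= pi ->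
  mdist p q ^+ 2 <= mdist x p ^+ 2 + mdist x q ^+ 2 - 2 * mdist x p * mdist x q * cos a ->
  comparison_angle x p q <= a.
Proof.
move=> xp xq aI H; rewrite -ler_cos0pi ?comparison_angle_bounds//.
have A0 : 0 < mdist x p by rewrite mdist_gt0.
have B0 : 0 < mdist x q by rewrite mdist_gt0.
rewrite -(ler_pM2l (_ : 0 < 2 * mdist x p * mdist x q)) ?mulr_gt0//.
by have := cosine_law x p q; lra.
Qed.

Lemma dist_le_comparison x p q (a : R) : x != p -> x != q -> 0 <= a <= pi ->
  comparison_angle x p q <= a ->
  mdist p q ^+ 2 <= mdist x p ^+ 2 + mdist x q ^+ 2 - 2 * mdist x p * mdist x q * cos a.
Proof.
move=> xp xq aI; rewrite -ler_cos0pi ?comparison_angle_bounds// => H.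
have A0 : 0 < mdist x p by rewrite mdist_gt0.
have B0 : 0 < mdist x q by rewrite mdist_gt0.
rewrite (cosine_law x) lerD2l lerN2.
by rewrite (ler_pM2l (_ : 0 < 2 * mdist x p * mdist x q)) ?mulr_gt0.
Qed.

End CosineLaw.

(** For the planar computation in [angle_triangle]: with cosines and sines [cs], [ss] of S and [cd],
    [sd] of D, sides [r] and t = r cos S / cos D at angle S + D have the third side r sin (S + D) /
    cos D. *)
Lemma chord_identity (R : realType) (r t cs ss cd sd : R) : t * cd = r * cs ->
  cs ^+ 2 + ss ^+ 2 = 1 -> cd ^+ 2 + sd ^+ 2 = 1 ->
  (r ^+ 2 + t ^+ 2 - 2 * r * t * (cs * cd - ss * sd)) * cd ^+ 2 =
  (r * (ss * cd + cs * sd)) ^+ 2.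
Proof.
move=> tE E1 E2; transitivity (r ^+ 2 * cd ^+ 2 + (t * cd) ^+ 2 - 2 * r * (t * cd) *
    (cs * cd - ss * sd) * cd); first by ring.
rewrite tE; apply/eqP; rewrite -subr_eq0.
set d := (X in X == 0).
have -> : d = r ^+ 2 * (cd ^+ 2 * (1 - (cs ^+ 2 + ss ^+ 2)) +
    cs ^+ 2 * (1 - (cd ^+ 2 + sd ^+ 2))) by rewrite /d; ring.
by rewrite E1 E2 subrr !mulr0 addr0 mulr0.
Qed.

(** * Alexandrov angles *)

Section Angles.
Context {R : realType} {X : metricType R}.
Hypothesis hX : @CAT0 R X.
Variable x : X.
Implicit Types (g h k : geodesic_from x) (s t : R).

Definition glen g := mdist x (geod_end g).

Lemma glen_gt0 g : 0 < glen g. Proof. by rewrite mdist_gt0 geod_neq. Qed.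

Lemma gdist g s : 0 <= s <= glen g -> mdist x (g s) = s.
Proof. exact: geodesic_distl (geodP g). Qed.

Lemma gneq g s : 0 < s <= glen g -> x != g s.
Proof.
by move=> /andP[s0 sl]; rewrite -mdist_gt0 gdist// sl ltW.
Qed.

(** Thinness read through the law of cosines at [x]. *)
Lemma comparison_mono p q c c' s t : geodesic x p c -> geodesic x q c' ->
  0 < s <= mdist x p -> 0 < t <= mdist x q ->
  comparison_angle x (c s) (c' t) <= comparison_angle x p q.
Proof.
move=> gc gc' /andP[s0 sA] /andP[t0 tB].
have A0 : 0 < mdist x p by exact: lt_le_trans sA.
have B0 : 0 < mdist x q by exact: lt_le_trans tB.
have sI : 0 <= s <= mdist x p by rewrite sA ltW.
have tI : 0 <= t <= mdist x q by rewrite tB ltW.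
have Ds := geodesic_distl gc sI; have Dt := geodesic_distl gc' tI.
have := thin_cos hX gc gc' sI tI; rewrite (cosine_law x p q) => H.
apply: comparison_le; rewrite -?mdist_gt0 ?Ds ?Dt//.
  by rewrite comparison_angle_bounds -?mdist_gt0.
rewrite -(ler_pM2l (mulr_gt0 A0 B0)); apply: le_trans H _.
by rewrite le_eqVlt; apply/orP; left; apply/eqP; ring.
Qed.

Let angles g h := [set a | exists s t,
  [/\ 0 < s <= glen g, 0 < t <= glen h & a = comparison_angle x (g s) (h t)]].

Lemma angles_lb g h : lbound (angles g h) 0.
Proof.
move=> _ [s [t [sI tI ->]]].
by have /andP[] := comparison_angle_bounds (gneq sI) (gneq tI).
Qed.

Lemma angles_inf g h : has_inf (angles g h).
Proof.
split; last by exists 0; exact: angles_lb.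
exists (comparison_angle x (g (glen g)) (h (glen h))), (glen g), (glen h).
by rewrite !glen_gt0 !lexx.
Qed.

Lemma comparison_mono_geod g h s t s' t' : 0 < s <= s' -> s' <= glen g ->
  0 < t <= t' -> t' <= glen h ->
  comparison_angle x (g s) (h t) <= comparison_angle x (g s') (h t').
Proof.
move=> /andP[s0 ss] sg /andP[t0 tt] th.
have sI : 0 <= s' <= glen g by rewrite sg andbT; lra.
have tI : 0 <= t' <= glen h by rewrite th andbT; lra.
apply: comparison_mono; rewrite ?gdist ?s0 ?t0//.
  exact: geodesic_sub (geodP g) sI.
exact: geodesic_sub (geodP h) tI.
Qed.

(* The comparison angles decrease towards the vertex, so the upper limit that
   defines the Alexandrov angle is an infimum. *)
Lemma alexandrov_angleE g h : alexandrov_angle g h = inf (angles g h).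
Proof.
have hI := angles_inf g h; set I := inf _.
set F : set_system (R * R) := filter_prod 0^'+ 0^'+.
pose f (st : R * R) := comparison_angle x (g st.1) (h st.2).
suff e0 : limf_esup (EFin \o f) F = I%:E by rewrite /alexandrov_angle e0.
have near0 (r : R) : 0 < r -> (0 : R)^'+ [set s | 0 < s <= r].
  move=> r0; near=> s; rewrite /=; apply/andP; split; near: s.
    exact: nbhs_right_gt.
  exact: nbhs_right_le.
have nearF (r r' : R) : 0 < r -> 0 < r' ->
    F [set st | 0 < st.1 <= r /\ 0 < st.2 <= r'].
  move=> r0 r'0; exists ([set s | 0 < s <= r], [set s | 0 < s <= r']) => /=.
    by split; exact: near0.
  by move=> [s t] [].
apply/eqP; rewrite eq_le; apply/andP; split.
  apply/lee_addgt0Pr => e e0.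
  have [_ [s [t [sI tI ->]]] se] := inf_adherent e0 hI.
  have /andP[s0 sl] := sI; have /andP[t0 tl] := tI.
  apply: ge_ereal_inf; eexists.
    by exists [set st | 0 < st.1 <= s /\ 0 < st.2 <= t]; first exact: nearF.
  apply: ge_ereal_sup => _ [[s' t'] /= [s'I t'I] <-].
  rewrite lee_fin; apply: le_trans (ltW se).
  exact: comparison_mono_geod.
apply: le_ereal_inf_tmp => _ [V FV <-]; apply: le_ereal_sup_tmp.
have [[s t] [Vst [/= sI tI]]] := filter_ex (filterI FV (nearF _ _ (glen_gt0 g) (glen_gt0 h))).
exists (EFin (f (s, t))); first by exists (s, t).
by rewrite lee_fin; apply: ge_inf hI.2 _ _; exists s, t.
Unshelve. all: by end_near. Qed.

Lemma angle_le g h s t : 0 < s <= glen g -> 0 < t <= glen h ->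
  alexandrov_angle g h <= comparison_angle x (g s) (h t).
Proof.
move=> sI tI; rewrite alexandrov_angleE.
by apply: ge_inf (angles_inf g h).2 _ _; exists s, t.
Qed.

Lemma angle_near g h (e : R) : 0 < e -> exists r, [/\ 0 < r, r <= glen g, r <= glen h &
  forall s t, 0 < s <= r -> 0 < t <= r ->
    comparison_angle x (g s) (h t) < alexandrov_angle g h + e].
Proof.
move=> e0; rewrite alexandrov_angleE.
have [_ [s [t [/andP[s0 sl] /andP[t0 tl] ->]]] se] := inf_adherent e0 (angles_inf g h).
exists (Num.min s t); split.
- by rewrite lt_min s0.
- by rewrite ge_min sl.
- by rewrite ge_min tl orbT.
- move=> s' t' /andP[s'0]; rewrite le_min => /andP[ss' _] /andP[t'0].
  rewrite le_min => /andP[_ tt']; apply: le_lt_trans se.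
  by apply: comparison_mono_geod; rewrite ?s'0 ?t'0.
Qed.

Lemma angle_bounds g h : 0 <= alexandrov_angle g h <= pi.
Proof.
have gI : 0 < glen g <= glen g by rewrite glen_gt0 lexx.
have hI : 0 < glen h <= glen h by rewrite glen_gt0 lexx.
rewrite (le_trans (angle_le gI hI)) ?andbT; last first.
  by have /andP[] := comparison_angle_bounds (gneq gI) (gneq hI).
by rewrite alexandrov_angleE; apply: lb_le_inf (angles_inf g h).1 (@angles_lb g h).
Qed.

Lemma angle_ge0 g h : 0 <= alexandrov_angle g h.
Proof. by have /andP[] := angle_bounds g h. Qed.

Lemma angle_lepi g h : alexandrov_angle g h <= pi.
Proof. by have /andP[] := angle_bounds g h. Qed.

Lemma angle_sym g h : alexandrov_angle g h = alexandrov_angle h g.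
Proof.
suff H g' h' : alexandrov_angle g' h' <= alexandrov_angle h' g'.
  by apply/le_anti; rewrite !H.
apply/ler_addgt0Pr => e e0; have [r [r0 rh rg H]] := angle_near h' g' e0.
apply: le_trans (ltW (H r r _ _)); rewrite ?r0 ?lexx//.
by rewrite comparison_angle_sym angle_le// r0.
Qed.

(* The segment between the points at distance [r] in two directions of the plane
   at angle [a + b < pi] meets the intermediate direction at distance
   [r cos((a+b)/2) / cos((a-b)/2)] and is cut by it into pieces of lengths
   [r sin a / cos((a-b)/2)] and [r sin b / cos((a-b)/2)]. *)
Lemma angle_triangle h g k :
  alexandrov_angle g k <= alexandrov_angle g h + alexandrov_angle h k.
Proof.
rewrite leNgt; apply/negP => lt_gk.
set al := alexandrov_angle g h in lt_gk; set be := alexandrov_angle h k in lt_gk.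
set th := alexandrov_angle g k in lt_gk.
have thpi : th <= pi by exact: angle_lepi.
(* With this choice [a + b] is the mean of [al + be] and [th], hence below [th] and below pi, while
   [a] and [b] are positive. *)
pose e := (th - al - be) / 4; have e0 : 0 < e by rewrite divr_gt0//; lra.
have al0 : 0 <= al by exact: angle_ge0.
have be0 : 0 <= be by exact: angle_ge0.
have [r1 [r10 r1g r1h H1]] := angle_near g h e0.
have [r2 [r20 r2h r2k H2]] := angle_near h k e0.
pose r := Num.min r1 r2.
have r0 : 0 < r by rewrite lt_min r10.
have rr1 : r <= r1 by rewrite ge_min lexx.
have rr2 : r <= r2 by rewrite ge_min lexx orbT.
pose a := al + e; pose b := be + e.
pose S := (a + b) / 2; pose D := (a - b) / 2.
have aE : a = S + D by rewrite /S /D; field.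
have bE : b = S - D by rewrite /S /D; field.
have SI : 0 < S < pi / 2 by rewrite /S /a /b /e; apply/andP; split; lra.
have DI : - S < D < S by rewrite /D /S /a /b; apply/andP; split; lra.
have abpi : a + b < th by rewrite /a /b /e; lra.
have cS : 0 < cos S by apply: cos_gt0_pihalf; apply/andP; split; lra.
have cD : 0 < cos D by apply: cos_gt0_pihalf; apply/andP; split; lra.
have sS := cos2Dsin2 S; have sD := cos2Dsin2 D.
have sS0 : 0 < sin S by apply: sin_gt0_pihalf.
have cDS : cos S <= cos D.
  rewrite -(cos_norm D) ler_cos0pi.
  - by rewrite ler_norml; apply/andP; split; lra.
  - by rewrite normr_ge0 ler_norml; apply/andP; split; lra.
  - by apply/andP; split; lra.
pose t := r * cos S / cos D.
have t0 : 0 < t by rewrite !mulr_gt0// invr_gt0.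
have tr : t <= r by rewrite ler_pdivrMr// ler_pM2l.
have tE : t * cos D = r * cos S by rewrite divfK// gt_eqF.
have a0 : 0 < a by rewrite /a; lra.
have b0 : 0 < b by rewrite /b; lra.
have aI : 0 <= a <= pi by apply/andP; split; lra.
have bI : 0 <= b <= pi by apply/andP; split; lra.
have sa : 0 <= sin a by exact: sin_ge0_pi.
have sb : 0 <= sin b by exact: sin_ge0_pi.
have rI1 : 0 < r <= r1 by rewrite r0.
have tI1 : 0 < t <= r1 by rewrite t0 (le_trans tr).
have rI2 : 0 < r <= r2 by rewrite r0.
have tI2 : 0 < t <= r2 by rewrite t0 (le_trans tr).
have rg : 0 < r <= glen g by rewrite r0 (le_trans rr1).
have th' : 0 < t <= glen h by rewrite t0 (le_trans tr)// (le_trans rr1).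
have rk : 0 < r <= glen k by rewrite r0 (le_trans rr2).
have wI g' s : 0 < s <= glen g' -> 0 <= s <= glen g' by move=> /andP[/ltW-> ->].
have d1 : mdist (g r) (h t) * cos D <= r * sin a.
  apply: sq_le; first by rewrite mulr_ge0// ltW.
  have := dist_le_comparison (gneq rg) (gneq th') aI (ltW (H1 _ _ rI1 tI1)).
  rewrite !gdist ?wI// => /(ler_wpM2r (sqr_ge0 (cos D))); rewrite -exprMn => H.
  by apply: le_trans H _; rewrite aE sinD cosD (chord_identity tE sS sD).
have d2 : mdist (h t) (k r) * cos D <= r * sin b.
  apply: sq_le; first by rewrite mulr_ge0// ltW.
  have := dist_le_comparison (gneq rk) (gneq th') bI.
  rewrite comparison_angle_sym => /(_ (ltW (H2 _ _ tI2 rI2))).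
  rewrite !gdist ?wI// (metric_sym (k r)) => /(ler_wpM2r (sqr_ge0 (cos D))).
  rewrite -exprMn => H; apply: le_trans H _; rewrite bE sinB cosB.
  have -> : cos S * cos D + sin S * sin D = cos S * cos D - sin S * - sin D by ring.
  have -> : sin S * cos D - cos S * sin D = sin S * cos D + cos S * - sin D by ring.
  by rewrite (chord_identity tE sS)// sqrrN.
have d3 : mdist (g r) (k r) <= 2 * r * sin S.
  rewrite -(ler_pM2r cD).
  have := ler_wpM2r (ltW cD) (metric_triangle (g r) (h t) (k r)).
  move: d1 d2; rewrite aE bE sinD sinB; lra.
suff : th <= a + b by lra.
apply: le_trans (angle_le rg rk) _.
apply: comparison_le (gneq rg) (gneq rk) _ _.
  by apply/andP; split; lra.
rewrite !gdist ?wI//.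
have d4 : mdist (g r) (k r) ^+ 2 <= (2 * r * sin S) ^+ 2.
  by rewrite ler_sqr ?nnegrE ?mdist_ge0// !mulr_ge0// ltW.
apply: le_trans d4 _.
have -> : a + b = S *+ 2 by rewrite /S mulr2n -splitr.
rewrite cos_mulr2n; nra.
Qed.

End Angles.

(** * Length of concatenated curves and the triangle inequality of the intrinsic metric *)

Section LengthConcat.
Context {R : realType} {T : Type}.
Variable dist : T -> T -> R.
Hypothesis dist_xx : forall x, dist x x = 0.
Hypothesis dist_triangle : forall y x z, dist x z <= dist x y + dist y z.

(** The sums of [curve_length] as a recursion on the partition, suited to induction. *)
Fixpoint chain (c : R -> T) (a : R) (s : seq R) : R :=
  if s is x :: s' then dist (c a) (c x) + chain c x s' else 0.

Lemma chainE (c : R -> T) a b s :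
  \sum_(0 <= i < size s) dist (c (nth b (a :: s) i)) (c (nth b (a :: s) i.+1)) =
  chain c a s.
Proof.
elim: s a => [|x s IH] a /=; first by rewrite big_geq.
by rewrite big_nat_recl//= -IH.
Qed.

Lemma chain_cat (c : R -> T) a s1 s2 :
  chain c a (s1 ++ s2) = chain c a s1 + chain c (last a s1) s2.
Proof. by elim: s1 a => [|x s IH] a /=; rewrite ?add0r// IH addrA. Qed.

(** Refining a partition at [m] does not decrease the sum. If [m] is already a point of the
    partition, [s1] ends there and the middle term is 0; hence the weak inequality for its last
    point. *)
Lemma chain_insert (c : R -> T) a m s : path <%R a s -> a <= m -> m <= last a s ->
  exists s1 s2, [/\ path <%R a s1, last a s1 <= m, path <%R m s2, last m s2 = last a s &
    chain c a s <= chain c a s1 + dist (c (last a s1)) (c m) + chain c m s2].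
Proof.
elim: s a => [|x s IH] a /=.
  move=> _ am ma; exists [::], [::]; split=> //=; first by apply/le_anti; rewrite am ma.
  have -> : m = a by apply/le_anti; rewrite am ma.
  by rewrite dist_xx !addr0.
move=> /andP[ax px] am ml; have [xm|mx] := leP x m.
  have [s1 [s2 [p1 l1 p2 l2 H]]] := IH x px xm ml.
  by exists (x :: s1), s2; split; rewrite //= ?ax// -!addrA lerD2l !addrA.
exists [::], (x :: s); split=> //=; first by rewrite mx.
by have := dist_triangle (c m) (c a) (c x); lra.
Qed.

Lemma chain_length (c : R -> T) a b s : path <%R a s -> last a s = b ->
  ((chain c a s)%:E <= curve_length dist a b c)%E.
Proof.
move=> ps ls; apply: ereal_sup_ubound; exists s; first by split=> //; apply/eqP.
by rewrite chainE.
Qed.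

Lemma length_le (c : R -> T) a b (l : \bar R) :
  (forall s, path <%R a s -> last a s = b -> ((chain c a s)%:E <= l)%E) ->
  (curve_length dist a b c <= l)%E.
Proof.
move=> H; apply: ge_ereal_sup => _ [s [ps /eqP ls] <-].
by rewrite chainE; exact: H.
Qed.

Lemma chain_map (c c' : R -> T) (f : R -> R) a s :
  (forall u, u \in a :: s -> c u = c' (f u)) ->
  chain c a s = chain c' (f a) (map f s).
Proof.
elim: s a => [|x s IH] a //= H.
rewrite IH; last by move=> u us; apply: H; rewrite inE us orbT.
by rewrite !H// !inE eqxx ?orbT.
Qed.

Lemma path_map_lt (f : R -> R) (a : R) s : (forall u v : R, u < v -> f u < f v) ->
  path <%R a s -> path <%R (f a) (map f s).
Proof.
by move=> H; rewrite path_map; apply: sub_path => u v /H.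
Qed.

Lemma path_lt_in (a : R) s u : path <%R a s -> u \in a :: s -> a <= u <= last a s.
Proof.
elim: s a u => [|x s IH] a u /=; first by rewrite inE => _ /eqP->; rewrite lexx.
move=> /andP[ax px]; have /andP[xx xl] := IH x x px (mem_head _ _).
rewrite inE => /predU1P[->|/(IH x u px)/andP[xu ->]].
  by rewrite lexx (le_trans _ xl)// ltW.
by rewrite andbT (le_trans _ xu)// ltW.
Qed.

Definition concat (c1 c2 : R -> T) (t : R) : T :=
  if t <= 1 / 2 then c1 (2 * t) else c2 (2 * t - 1).

Lemma concat_l c1 c2 t : t <= 1 / 2 -> concat c1 c2 t = c1 (2 * t).
Proof. by rewrite /concat => ->. Qed.

Lemma concat_r c1 c2 t : c1 1 = c2 0 -> 1 / 2 <= t -> concat c1 c2 t = c2 (2 * t - 1).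
Proof.
move=> E; rewrite /concat le_eqVlt => /predU1P[<-|/lt_geF->//].
by rewrite lexx mulrC divfK// E subrr.
Qed.

Lemma concat_length c1 c2 : c1 1 = c2 0 ->
  (curve_length dist 0 1 (concat c1 c2) <=
   curve_length dist 0 1 c1 + curve_length dist 0 1 c2)%E.
Proof.
move=> E; apply: length_le => s ps ls.
have h0 : 0 <= 1 / 2 :> R by rewrite divr_ge0.
have hl : 1 / 2 <= last 0 s by rewrite ls; lra.
have [s1 [s2 [p1 l1 p2 l2 H]]] := chain_insert (concat c1 c2) ps h0 hl.
apply: (@le_trans _ _ ((chain (concat c1 c2) 0 s1 +
  dist (concat c1 c2 (last 0 s1)) (concat c1 c2 (1 / 2)))%:E +
  (chain (concat c1 c2) (1 / 2) s2)%:E)%E); first by rewrite -EFinD lee_fin.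
apply: leeD.
  pose f (t : R) := 2 * t.
  have f0 : f 0 = 0 by rewrite /f mulr0.
  have H1 : chain (concat c1 c2) 0 s1 = chain c1 0 (map f s1).
    rewrite -[X in _ = chain _ X _]f0; apply: chain_map => u /(path_lt_in p1)/andP[_ ul].
    by rewrite concat_l// (le_trans ul).
  have pf : path <%R 0 (map f s1).
    rewrite -f0; apply: path_map_lt p1 => u v uv; by rewrite /f ltr_pM2l.
  have lf : last 0 (map f s1) = f (last 0 s1).
    by rewrite -[X in last X (map f s1)]f0 last_map.
  have f1 : f (1 / 2) = 1 by rewrite /f mulrC divfK.
  rewrite H1 concat_l// concat_l// -/(f _) -/(f (1 / 2)) f1 -lf.
  (* If 1/2 already belongs to the partition, appending 1 to the image would break strict
     monotonicity. *)
  have [l1E|l1lt] := eqVneq (last 0 s1) (1 / 2).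
    have l1' : last 0 (map f s1) = 1 by rewrite lf l1E f1.
    by rewrite l1' dist_xx addr0; exact: chain_length.
  have -> : chain c1 0 (map f s1) + dist (c1 (last 0 (map f s1))) (c1 1) =
      chain c1 0 (rcons (map f s1) 1) by rewrite -cats1 chain_cat/= addr0.
  apply: chain_length; last by rewrite last_rcons.
  rewrite rcons_path pf lf -f1 /f ltr_pM2l//.
  by rewrite lt_neqAle l1lt.
pose f (t : R) := 2 * t - 1.
have f1 : f (1 / 2) = 0 by rewrite /f mulrC divfK// subrr.
have -> : chain (concat c1 c2) (1 / 2) s2 = chain c2 0 (map f s2).
  rewrite -[X in _ = chain _ X _]f1; apply: chain_map => u /(path_lt_in p2)/andP[ul _].
  by rewrite concat_r.
apply: chain_length.
  by rewrite -f1; apply: path_map_lt p2 => u v uv; rewrite /f ltrD2r ltr_pM2l.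
by rewrite -[X in last X _]f1 last_map l2 ls /f mulr1 addrK.
Qed.

Lemma curve_continuousP a b (c : R -> T) :
  (forall x y, 0 <= dist x y) ->
  curve_continuous dist a b c <->
  forall t, a <= t <= b -> forall e, 0 < e -> exists2 d, 0 < d &
    forall u, a <= u <= b -> `|u - t| < d -> dist (c t) (c u) < e.
Proof.
move=> dist_ge0; split=> H t.
  move=> tI e e0; have /H/cvgrPdist_lt/(_ e e0) : t \in `[a, b] by rewrite in_itv.
  rewrite near_withinE => /nbhs_ballP[d /= d0 Hd]; exists d => // u uI ut.
  have tu : ball t d u by rewrite /ball/= distrC.
  by have := Hd u tu; rewrite in_itv/= uI sub0r normrN ger0_norm// => /(_ isT).
rewrite in_itv/= => tI; apply/cvgrPdist_lt => e e0.
have [d d0 Hd] := H t tI e e0.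
rewrite near_withinE; apply/nbhs_ballP; exists d => //= u.
rewrite /ball/= distrC => ut; rewrite in_itv/= => uI.
by rewrite sub0r normrN ger0_norm// Hd.
Qed.

Lemma concat_continuous c1 c2 : (forall x y, 0 <= dist x y) -> c1 1 = c2 0 ->
  curve_continuous dist 0 1 c1 -> curve_continuous dist 0 1 c2 ->
  curve_continuous dist 0 1 (concat c1 c2).
Proof.
move=> dist_ge0 E /(curve_continuousP _ _ _ dist_ge0) H1.
move=> /(curve_continuousP _ _ _ dist_ge0) H2; apply/curve_continuousP => //.
move=> t /andP[t0 t1] e e0.
have L : t <= 1 / 2 -> exists2 d, 0 < d & forall u, 0 <= u <= 1 / 2 -> `|u - t| < d ->
    dist (concat c1 c2 t) (concat c1 c2 u) < e.
  move=> th; have tI : 0 <= 2 * t <= 1 by apply/andP; split; lra.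
  have [d d0 Hd] := H1 _ tI e e0; exists (d / 2); first by rewrite divr_gt0.
  move=> u /andP[u0 uh] ut; rewrite !concat_l//; apply: Hd.
    by apply/andP; split; lra.
  by rewrite -mulrBr normrM ger0_norm//; lra.
have U : 1 / 2 <= t -> exists2 d, 0 < d & forall u, 1 / 2 <= u <= 1 -> `|u - t| < d ->
    dist (concat c1 c2 t) (concat c1 c2 u) < e.
  move=> th; have tI : 0 <= 2 * t - 1 <= 1 by apply/andP; split; lra.
  have [d d0 Hd] := H2 _ tI e e0; exists (d / 2); first by rewrite divr_gt0.
  move=> u /andP[u0 uh] ut; rewrite !concat_r//; apply: Hd.
    by apply/andP; split; lra.
  have -> : 2 * u - 1 - (2 * t - 1) = 2 * (u - t) by ring.
  by rewrite normrM ger0_norm//; lra.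
have [th|th] := ltP t (1 / 2).
  have [d d0 Hd] := L (ltW th); exists (Num.min d (1 / 2 - t)).
    by rewrite lt_min d0 subr_gt0.
  move=> u /andP[u0 u1]; rewrite lt_min => /andP[ud]; rewrite ltr_norml => /andP[_ uh].
  by apply: Hd => //; apply/andP; split; lra.
have [d d0 Hd] := U th; have [th'|ht] := ltP (1 / 2) t.
  exists (Num.min d (t - 1 / 2)); first by rewrite lt_min d0 subr_gt0.
  move=> u /andP[u0 u1]; rewrite lt_min => /andP[ud]; rewrite ltr_norml => /andP[uh _].
  by apply: Hd => //; apply/andP; split; lra.
have [d' d'0 Hd'] := L ht; exists (Num.min d d'); first by rewrite lt_min d0.
move=> u /andP[u0 u1]; rewrite lt_min => /andP[ud ud'].
have [uh|hu] := leP u (1 / 2); first by apply: Hd' => //; rewrite u0.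
by apply: Hd => //; rewrite ltW.
Qed.

Lemma intrinsic_triangle x y z : (forall x y, 0 <= dist x y) ->
  (intrinsic_dist dist x z <= intrinsic_dist dist x y + intrinsic_dist dist y z)%E.
Proof.
move=> dist_ge0.
have ge0 u v : (0 <= intrinsic_dist dist u v)%E.
  apply: le_ereal_inf_tmp => _ [c [_ c0 c1] <-].
  apply: le_trans (chain_length c (s := [:: 1]) _ _) => //=.
    by rewrite addr0 lee_fin.
  by rewrite ltr01.
have [->|xy] := eqVneq (intrinsic_dist dist x y) +oo%E.
  by rewrite addye ?leey// gt_eqF// (lt_le_trans _ (ge0 _ _)).
have [->|yz] := eqVneq (intrinsic_dist dist y z) +oo%E.
  by rewrite addey ?leey// gt_eqF// (lt_le_trans _ (ge0 _ _)).
have fxy : intrinsic_dist dist x y \is a fin_num by rewrite ge0_fin_numE// ltey.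
have fyz : intrinsic_dist dist y z \is a fin_num by rewrite ge0_fin_numE// ltey.
apply/lee_addgt0Pr => e e0; have e20 : 0 < e / 2 by rewrite divr_gt0.
have [_ [c1 [k1 c10 c11] <-] l1] := lb_ereal_inf_adherent e20 fxy.
have [_ [c2 [k2 c20 c21] <-] l2] := lb_ereal_inf_adherent e20 fyz.
have E : c1 1 = c2 0 by rewrite c11.
apply: (@le_trans _ _ (curve_length dist 0 1 (concat c1 c2))).
  apply: ereal_inf_lbound; exists (concat c1 c2) => //; split.
  - exact: concat_continuous.
  - by rewrite concat_l ?divr_ge0// mulr0.
  - by rewrite concat_r//; [rewrite mulr1 addrK|lra].
apply: le_trans (concat_length E) _; apply: le_trans (leeD (ltW l1) (ltW l2)) _.
by rewrite addeACA -EFinD -splitr.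
Qed.

End LengthConcat.

(** * Superadditivity of comparison angles *)

Section Superadditivity.
Context {R : realType}.

(** Two planar triangles with sides [a], [r], [l] and [r], [b], [m] share the side [r]. The cosines
    of their angles are [ca], [cb] at one end of it and [(r - a * ca) / l], [(r - b * cb) / m] at
    the other. The last hypothesis says that the angles at the other end add up to at least pi;
    since all six add up to two pi, those at the first end add up to at most pi. *)
Lemma obtuse_sum (a b r l m ca cb : R) : 0 < a -> 0 < b -> 0 < r -> 0 < l -> 0 < m ->
  -1 <= ca <= 1 -> -1 <= cb <= 1 ->
  l ^+ 2 = a ^+ 2 + r ^+ 2 - 2 * a * r * ca -> m ^+ 2 = r ^+ 2 + b ^+ 2 - 2 * r * b * cb ->
  m * (r - a * ca) + l * (r - b * cb) <= 0 -> 0 <= ca + cb.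
Proof.
wlog cba : a b l m ca cb / cb <= ca.
  move=> H a0 b0 r0 l0 m0 caI cbI lE mE K; have [cba|/ltW cab] := leP cb ca.
    exact: (H a b l m).
  rewrite addrC; apply: (H b a m l) => //.
  - by rewrite mE; ring.
  - by rewrite lE; ring.
  - by rewrite addrC.
move=> a0 b0 r0 l0 m0 /andP[ca1 ca2] /andP[cb1 cb2] lE mE K.
rewrite leNgt; apply/negP => lt0.
have cb0 : cb < 0 by lra.
pose k := - cb; have k0 : 0 < k by rewrite oppr_gt0.
(* At the other end of [r] the cosines are [- P / l] and [N / m]. The two squared bounds below say
   that [P / l <= ca] and [N / m >= k], while [N / m <= P / l]; this contradicts [ca < k]. *)
pose P := a * ca - r; pose N := r + b * k.
have N0 : 0 < N by rewrite addr_gt0// mulr_gt0.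
have lN : l * N <= m * P by rewrite /N /P /k; lra.
have P0 : 0 < P.
  by rewrite -(pmulr_rgt0 _ m0); apply: lt_le_trans lN; rewrite mulr_gt0.
have ca0 : 0 < ca by rewrite -(pmulr_rgt0 _ a0); rewrite /P in P0; lra.
have cak : ca < k by rewrite /k; lra.
have P2 : P ^+ 2 <= ca ^+ 2 * l ^+ 2.
  rewrite -subr_ge0 lE.
  have -> : ca ^+ 2 * (a ^+ 2 + r ^+ 2 - 2 * a * r * ca) - P ^+ 2 =
    (1 - ca ^+ 2) * r * (2 * P + r) by rewrite /P; ring.
  rewrite !mulr_ge0//; [|exact: ltW|lra].
  by rewrite subr_ge0 expr_le1// ltW.
have N2 : k ^+ 2 * m ^+ 2 <= N ^+ 2.
  rewrite -subr_ge0 mE.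
  have -> : N ^+ 2 - k ^+ 2 * (r ^+ 2 + b ^+ 2 - 2 * r * b * cb) =
    (1 - k ^+ 2) * r * (r + 2 * b * k) by rewrite /N /k; ring.
  rewrite !mulr_ge0//; [|exact: ltW|by rewrite addr_ge0 ?mulr_ge0// ltW].
  by rewrite subr_ge0 expr_le1//; [rewrite /k; lra|exact: ltW].
have lN2 : l ^+ 2 * N ^+ 2 <= m ^+ 2 * P ^+ 2.
  by rewrite -!exprMn ler_sqr ?nnegrE// mulr_ge0// ltW.
have l20 : 0 < l ^+ 2 by rewrite exprn_gt0.
have m20 : 0 < m ^+ 2 by rewrite exprn_gt0.
have : (l ^+ 2 * m ^+ 2) * k ^+ 2 <= (l ^+ 2 * m ^+ 2) * ca ^+ 2.
  have H1 := ler_wpM2l (ltW l20) N2; have H2 := ler_wpM2l (ltW m20) P2.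
  by move: H1 H2 lN2; lra.
by rewrite ler_pM2l ?mulr_gt0// ler_sqr ?nnegrE ?(ltW k0) ?(ltW ca0)// leNgt cak.
Qed.

(** The triangle inequality for the points (a ca, a sa), (r, 0) and (b cb, - b sb), the outer two
    lying in directions on either side of the middle one. *)
Lemma minkowski_plane (a b r l m ca sa cb sb : R) : 0 <= l -> 0 <= m ->
  ca ^+ 2 + sa ^+ 2 = 1 -> cb ^+ 2 + sb ^+ 2 = 1 ->
  l ^+ 2 = a ^+ 2 + r ^+ 2 - 2 * a * r * ca -> m ^+ 2 = r ^+ 2 + b ^+ 2 - 2 * r * b * cb ->
  a ^+ 2 + b ^+ 2 - 2 * a * b * (ca * cb - sa * sb) <= (l + m) ^+ 2.
Proof.
move=> l0 m0 E1 E2 lE mE.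
pose u1 := a * ca - r; pose u2 := a * sa; pose w1 := r - b * cb; pose w2 := b * sb.
have lu : l ^+ 2 = u1 ^+ 2 + u2 ^+ 2.
  rewrite lE; apply/eqP; rewrite -subr_eq0; set d := (X in X == 0).
  have -> : d = a ^+ 2 * (1 - (ca ^+ 2 + sa ^+ 2)) by rewrite /d /u1 /u2; ring.
  by rewrite E1 subrr mulr0.
have mw : m ^+ 2 = w1 ^+ 2 + w2 ^+ 2.
  rewrite mE; apply/eqP; rewrite -subr_eq0; set d := (X in X == 0).
  have -> : d = b ^+ 2 * (1 - (cb ^+ 2 + sb ^+ 2)) by rewrite /d /w1 /w2; ring.
  by rewrite E2 subrr mulr0.
have CS : u1 * w1 + u2 * w2 <= l * m.
  apply: sq_le; first exact: mulr_ge0.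
  rewrite exprMn lu mw -subr_ge0.
  have -> : (u1 ^+ 2 + u2 ^+ 2) * (w1 ^+ 2 + w2 ^+ 2) - (u1 * w1 + u2 * w2) ^+ 2 =
    (u1 * w2 - u2 * w1) ^+ 2 by ring.
  exact: sqr_ge0.
have -> : a ^+ 2 + b ^+ 2 - 2 * a * b * (ca * cb - sa * sb) =
   (u1 + w1) ^+ 2 + (u2 + w2) ^+ 2.
  apply/eqP; rewrite -subr_eq0; set d := (X in X == 0).
  have -> : d = a ^+ 2 * (1 - (ca ^+ 2 + sa ^+ 2)) + b ^+ 2 * (1 - (cb ^+ 2 + sb ^+ 2)).
    by rewrite /d /u1 /u2 /w1 /w2; ring.
  by rewrite E1 E2 subrr !mulr0 addr0.
by rewrite [leRHS]sqrrD lu mw; lra.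
Qed.

Context {X : metricType R}.
Hypothesis hX : @CAT0 R X.

Lemma comparison_self (x p : X) : x != p -> comparison_angle x p p = 0.
Proof.
move=> xp; have A0 : 0 < mdist x p by rewrite mdist_gt0.
rewrite /comparison_angle mdistxx expr0n subr0.
suff -> : (mdist x p ^+ 2 + mdist x p ^+ 2) / (2 * mdist x p * mdist x p) = 1.
  exact: acos1.
by field; rewrite gt_eqF.
Qed.

(* Alexandrov's lemma. By thinness, the two comparison triangles glued along their
   common side have an angle of at least [pi] at [c s], so that their angles at [x]
   add up to at most [pi]; the planar triangle inequality concludes. *)
Lemma comparison_superadditive (x p q : X) c s : geodesic p q c ->
  0 <= s <= mdist p q -> x != p -> x != q -> x != c s ->
  comparison_angle x p (c s) + comparison_angle x (c s) q <= comparison_angle x p q.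
Proof.
move=> gc sI xp xq xm; have pm := geodesic_distl gc sI; have mq := geodesic_distr gc sI.
have a0 : 0 < mdist x p by rewrite mdist_gt0.
have b0 : 0 < mdist x q by rewrite mdist_gt0.
have r0 : 0 < mdist x (c s) by rewrite mdist_gt0.
have [s0|sn0] := eqVneq s 0.
  by case: gc => c0 _ _; rewrite s0 c0 comparison_self// add0r.
have [s1|sn1] := eqVneq s (mdist p q).
  by case: gc => _ c1 _; rewrite s1 c1 (@comparison_self x q)// addr0.
case/andP: (sI) => s0 sl.
have l0 : 0 < s by rewrite lt_neqAle eq_sym sn0.
have m0 : 0 < mdist p q - s by rewrite subr_gt0 lt_neqAle sn1.
have L1 := cosine_law x p (c s); have L2 := cosine_law x (c s) q.
have L3 := cosine_law x p q.
rewrite pm in L1; rewrite mq in L2.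
set al := comparison_angle x p (c s) in L1 *; set be := comparison_angle x (c s) q in L2 *.
set th := comparison_angle x p q in L3 *.
have alI : 0 <= al <= pi by exact: comparison_angle_bounds.
have beI : 0 <= be <= pi by exact: comparison_angle_bounds.
have thI : 0 <= th <= pi by exact: comparison_angle_bounds.
have xI : 0 <= mdist p x <= mdist p x by rewrite mdist_ge0 lexx.
have := thin_cos hX gc (geoP hX p x) sI xI.
have -> : geo hX p x (mdist p x) = x by case: (geoP hX p x).
rewrite (metric_sym p x) (metric_sym q x) (metric_sym (c s) x).
move: L1 L2 L3 a0 b0 r0 l0 m0.
set a := mdist x p; set b := mdist x q; set r := mdist x (c s); set l := mdist p q.
move=> L1 L2 L3 a0 b0 r0 l0 m0 thin.
(* Thinness bounds [r] by the length that Stewart's theorem gives in the comparison triangle of [x],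
   [p], [q]. In terms of the angles at [x] this is the hypothesis of [obtuse_sum], with [s] and
   [l - s] for its [l] and [m]. *)
have K : (l - s) * (r - a * cos al) + s * (r - b * cos be) <= 0.
  have K1 : l * r ^+ 2 <= l * (s ^+ 2 + a ^+ 2) - s * (l ^+ 2 + a ^+ 2 - b ^+ 2).
    by rewrite -(ler_pM2l a0); move: thin; lra.
  rewrite -(pmulr_rle0 _ (_ : 0 < 2 * r)) ?mulr_gt0//.
  have -> : 2 * r * ((l - s) * (r - a * cos al) + s * (r - b * cos be)) =
    (l - s) * (r ^+ 2 - a ^+ 2 + (a ^+ 2 + r ^+ 2 - 2 * a * r * cos al)) +
    s * (r ^+ 2 - b ^+ 2 + (r ^+ 2 + b ^+ 2 - 2 * r * b * cos be)) by ring.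
  by rewrite -L1 -L2; move: K1; lra.
have cosI (t : R) : -1 <= cos t <= 1 by rewrite cos_geN1 cos_le1.
have S0 := obtuse_sum a0 b0 r0 l0 m0 (cosI al) (cosI be) L1 L2 K.
have alb : al <= pi - be.
  rewrite -ler_cos0pi//; last by case/andP: beI => *; apply/andP; split; lra.
  by rewrite addrC cosDpi cosN; lra.
case/andP: alI => al0 alpi; case/andP: beI => be0 bepi.
rewrite -ler_cos0pi//; last by apply/andP; split; lra.
rewrite -(ler_pM2l (_ : 0 < 2 * a * b)) ?mulr_gt0// cosD.
have := minkowski_plane (ltW l0) (ltW m0) (cos2Dsin2 al) (cos2Dsin2 be) L1 L2.
by rewrite subrKC L3; lra.
Qed.

(** A scale-invariant bound, uniform in the points, that turns first-order distance estimates into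
    angle estimates. *)
Lemma comparison_small (e : R) : 0 < e -> exists2 k, 0 < k <= 1 / 2 &
  forall x p q : X, x != p -> mdist p q <= k * mdist x p ->
  x != q /\ comparison_angle x p q < e.
Proof.
move=> e0; pose e' := Num.min e pi.
have e'0 : 0 < e' by rewrite lt_min e0 pi_gt0.
have e'pi : e' <= pi by rewrite ge_min lexx orbT.
have e'I : 0 <= e' <= pi by rewrite e'pi ltW.
pose w := 1 - cos e'.
have w0 : 0 < w.
  by rewrite subr_gt0 -(@cos0 R) ltr_cos ?in_itv//= lexx pi_ge0.
have w2 : w <= 2 by have := cos_geN1 e'; rewrite /w; lra.
exists (w / 4); first by apply/andP; split; lra.
move=> x p q xp pq; have A0 : 0 < mdist x p by rewrite mdist_gt0.
have D := metric_triangle x q p; rewrite (metric_sym q p) in D.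
have w4 : w / 4 * mdist x p <= 1 / 2 * mdist x p by rewrite ler_pM2r//; lra.
have B0 : mdist x p / 2 <= mdist x q by lra.
have xq : x != q by rewrite -mdist_gt0; lra.
split=> //; apply: (@lt_le_trans _ _ e'); last by rewrite ge_min lexx.
rewrite -ltr_cos ?in_itv/= ?comparison_angle_bounds//.
have Bp : 0 < mdist x q by rewrite mdist_gt0.
rewrite -(ltr_pM2l (_ : 0 < 2 * mdist x p * mdist x q)) ?mulr_gt0//.
have L := cosine_law x p q; have C0 := mdist_ge0 p q.
move: pq D w4 B0 L A0 Bp C0.
set a := mdist x p; set b := mdist x q; set d := mdist p q; set C := cos _.
move=> pq D w4 B0 L A0 Bp C0.
have -> : cos e' = 1 - w by rewrite /w; ring.
have d2 : d ^+ 2 <= (w / 4 * a) ^+ 2 by rewrite ler_sqr ?nnegrE// mulr_ge0//; lra.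
have wab : w * a * (a / 2) <= w * a * b by rewrite ler_pM2l// mulr_gt0.
have : (w / 4 * a) ^+ 2 < w * a * a.
  have -> : (w / 4 * a) ^+ 2 = w * a * a * (w / 16) by field.
  by rewrite gtr_pMr ?mulr_gt0//; lra.
have : 0 <= (a - b) ^+ 2 by exact: sqr_ge0.
by rewrite sqrrB; lra.
Qed.

End Superadditivity.

(** * The intrinsic distance of directions is their angle below pi *)

Section DirectionDist.
Context {R : realType} {X : metricType R}.
Hypothesis hX : @CAT0 R X.
Variable x : X.
Implicit Types (g h k : geodesic_from x) (s t : R).

Lemma geod_to (p : X) : x != p -> exists g : geodesic_from x, geod_end g = p.
Proof. by move=> xp; exists (GeodesicFrom xp (geoP hX x p)). Qed.

Lemma geod_endE g : g (glen g) = geod_end g.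
Proof. by case: (geodP g). Qed.

Lemma angle_le_comparison g h s t p q : 0 < s <= glen g -> 0 < t <= glen h ->
  g s = p -> h t = q -> alexandrov_angle g h <= comparison_angle x p q.
Proof. by move=> sI tI <- <-; exact: angle_le. Qed.

Lemma direction_dist_ge g h : ((alexandrov_angle g h)%:E <= direction_dist g h)%E.
Proof.
apply: le_ereal_inf_tmp => _ [c [_ c0 c1] <-].
have := @chain_length _ _ (@alexandrov_angle _ _ x) c 0 1 [:: 1].
by rewrite /= addr0 c0 c1; apply=> //; rewrite ltr01.
Qed.

Lemma direction_dist_ge0 g h : (0 <= direction_dist g h)%E.
Proof. by apply: le_trans (direction_dist_ge g h); rewrite lee_fin angle_ge0. Qed.

(* The directions of the points of a segment form a curve, whose length is at
   most the comparison angle by superadditivity. *)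
Lemma direction_dist_le g h s t : 0 < s <= glen g -> 0 < t <= glen h ->
  comparison_angle x (g s) (h t) < pi ->
  (direction_dist g h <= (comparison_angle x (g s) (h t))%:E)%E.
Proof.
move=> sI tI; set p := g s; set q := h t; set th := comparison_angle x p q => thpi.
have xp : x != p := gneq sI; have xq : x != q := gneq tI.
have gc := geoP hX p q; set c := geo hX p q in gc.
set l := mdist p q in gc.
pose pt u := c (u * l).
have l0 : 0 <= l by exact: mdist_ge0.
have uI u : 0 <= u <= 1 -> 0 <= u * l <= l.
  by move=> /andP[u0 u1]; rewrite mulr_ge0//= ler_piMl.
(* A segment through [x] would make the comparison angle equal to pi. *)
have xpt u : 0 <= u <= 1 -> x != pt u.
  move=> /uI ul; apply/eqP => xE.
  have E1 := geodesic_distl gc ul; have E2 := geodesic_distr gc ul.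
  rewrite -/(pt u) -xE in E1 E2; rewrite (metric_sym p x) in E1.
  have L := cosine_law x p q; rewrite -/l -/th in L.
  have lE : mdist p q = mdist x p + mdist x q by rewrite E1 E2 -/l; ring.
  rewrite -/l in lE; rewrite lE in L.
  have a0 : 0 < mdist x p by rewrite mdist_gt0.
  have b0 : 0 < mdist x q by rewrite mdist_gt0.
  have : 2 * mdist x p * mdist x q * (cos th + 1) = 0 by move: L; lra.
  move/eqP; rewrite mulf_eq0 gt_eqF ?mulr_gt0//= => /eqP E.
  suff : th = pi by move=> E'; rewrite E' ltxx in thpi.
  apply: cos_inj; rewrite ?in_itv/=; first exact: comparison_angle_bounds.
    by rewrite pi_ge0 lexx.
  by rewrite cospi; lra.
have pt0 : pt 0 = p by rewrite /pt mul0r; case: gc.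
have pt1 : pt 1 = q by rewrite /pt mul1r; case: gc.
(* At the ends the values must be [g] and [h] themselves, not geodesics to [p] and [q], since the
   curve has to join [g] to [h]. *)
have kex u : exists k, 0 <= u <= 1 ->
    [/\ exists2 r, 0 < r <= glen k & k r = pt u, u = 0 -> k = g & u = 1 -> k = h].
  have [u0|u0] := eqVneq u 0.
    exists g => _; split=> //; first by rewrite u0 pt0; exists s.
    by rewrite u0 => /eqP; rewrite eq_sym oner_eq0.
  have [u1|u1] := eqVneq u 1.
    exists h => _; split=> //; first by rewrite u1 pt1; exists t.
    by rewrite u1 => /eqP; rewrite oner_eq0.
  have [uI'|uI'] := boolP (0 <= u <= 1); last by exists g.
  have [k kE] := geod_to (xpt u uI'); exists k => _; split.
  - exists (glen k); first by rewrite glen_gt0 lexx.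
    by rewrite geod_endE.
  - by move/eqP; rewrite (negbTE u0).
  - by move/eqP; rewrite (negbTE u1).
have [k Hk] := choice kex.
have I0 : 0 <= (0 : R) <= 1 by rewrite lexx ler01.
have I1 : 0 <= (1 : R) <= 1 by rewrite lexx ler01.
have k0 : k 0 = g by have [_ E _] := Hk 0 I0; exact: E.
have k1 : k 1 = h by have [_ _ E] := Hk 1 I1; exact: E.
have ak u v : 0 <= u <= 1 -> 0 <= v <= 1 ->
    alexandrov_angle (k u) (k v) <= comparison_angle x (pt u) (pt v).
  move=> /Hk[[r rI rE] _ _] /Hk[[r' r'I r'E] _ _].
  exact: angle_le_comparison rI r'I rE r'E.
have ptd u v : 0 <= u <= 1 -> 0 <= v <= 1 -> mdist (pt u) (pt v) = `|u - v| * l.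
  move=> /uI u0 /uI v0; rewrite (geodesic_dist gc)//.
  by rewrite -mulrBl normrM (ger0_norm l0).
have sup u v w : 0 <= u -> u < v -> v <= w -> w <= 1 ->
    comparison_angle x (pt u) (pt v) + comparison_angle x (pt v) (pt w) <=
    comparison_angle x (pt u) (pt w).
  move=> u0 uv vw w1.
  have u01 : 0 <= u <= 1 by apply/andP; split; lra.
  have v01 : 0 <= v <= 1 by apply/andP; split; lra.
  have w01 : 0 <= w <= 1 by apply/andP; split; lra.
  have g1 := geodesic_shift gc (uI u u01); rewrite -/(pt u) in g1.
  have uq : mdist (pt u) q = (1 - u) * l.
    by rewrite -pt1 ptd// distrC ger0_norm//; lra.
  have wI : 0 <= (w - u) * l <= mdist (pt u) q.
    by rewrite uq mulr_ge0 ?ler_wpM2r//; lra.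
  have g2 := geodesic_sub g1 wI.
  have -> : pt w = c (u * l + (w - u) * l) by rewrite /pt; congr c; ring.
  have -> : pt v = c (u * l + (v - u) * l) by rewrite /pt; congr c; ring.
  apply: (comparison_superadditive hX g2).
  - rewrite (geodesic_distl g1 wI).
    by rewrite mulr_ge0 ?ler_wpM2r//; lra.
  - exact: xpt.
  - by have -> : u * l + (w - u) * l = w * l; [ring|exact: xpt].
  - by have -> : u * l + (v - u) * l = v * l; [ring|exact: xpt].
apply: (@le_trans _ _ (curve_length (@alexandrov_angle _ _ x) 0 1 k)).
  apply: ereal_inf_lbound; exists k => //; split=> //.
  apply/curve_continuousP; first by move=> g' h'; exact: angle_ge0.
  move=> u u01 e e0; have [d /andP[d0 _] Hd] := comparison_small (X := X) e0.
  have A0 : 0 < mdist x (pt u) by rewrite mdist_gt0 xpt.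
  have l10 : 0 < l + 1 by lra.
  exists (d * mdist x (pt u) / (l + 1)); first by rewrite divr_gt0// mulr_gt0.
  move=> v v01; rewrite ltr_pdivlMr// => uv.
  apply: le_lt_trans (ak u v u01 v01) _.
  have [] := Hd x (pt u) (pt v) (xpt u u01) _ => //.
  rewrite ptd// distrC; apply: le_trans (ltW uv).
  by rewrite ler_wpM2l//; lra.
have ge0 u v : 0 <= u <= 1 -> 0 <= v <= 1 -> 0 <= comparison_angle x (pt u) (pt v).
  by move=> /xpt a /xpt b; have /andP[] := comparison_angle_bounds a b.
(* Each angle is at most a comparison angle between neighbouring points, and these telescope by
   superadditivity. *)
have chain_le w a : 0 <= a -> path <%R a w -> last a w <= 1 ->
    chain (@alexandrov_angle _ _ x) k a w <= comparison_angle x (pt a) (pt (last a w)).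
  elim: w a => [|y w IH] a a0 /=.
    by move=> _ a1; apply: ge0; rewrite a0.
  move=> /andP[ay pw] l1.
  have y0 : 0 <= y by lra.
  have yl : y <= last y w.
    by have /andP[] := path_lt_in pw (mem_head _ _).
  have H := IH y y0 pw l1; apply: le_trans (sup a y (last y w) a0 ay yl l1).
  apply: lerD => //; apply: ak; apply/andP; split; lra.
apply: length_le => w pw lw; rewrite lee_fin.
by have := chain_le w 0 (lexx _) pw; rewrite lw pt0 pt1; apply.
Qed.

(** Near the vertex the comparison angles are still below pi, so [direction_dist_le] applies at
    every small scale. *)
Lemma direction_dist_angle g h : alexandrov_angle g h < pi ->
  direction_dist g h = (alexandrov_angle g h)%:E.
Proof.
move=> api; apply/le_anti; rewrite direction_dist_ge andbT.
apply/lee_addgt0Pr => e e0.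
pose e' := Num.min e (pi - alexandrov_angle g h).
have e'0 : 0 < e' by rewrite lt_min e0 subr_gt0.
have [r [r0 rg rh H]] := angle_near hX g h e'0.
have rI : 0 < r <= r by rewrite r0 lexx.
have := H r r rI rI; set th := comparison_angle _ _ _ => thr.
apply: (@le_trans _ _ th%:E).
  apply: direction_dist_le; rewrite ?r0//.
  apply: lt_le_trans thr _; rewrite -lerBrDl; rewrite /e' ge_min lexx orbT//.
rewrite -EFinD lee_fin (le_trans (ltW thr))// lerD2l.
by rewrite /e' ge_min lexx.
Qed.

(** For angle pi the intrinsic distance can be larger, even infinite, as for the two directions at a
    point of a line; the truncation used by the cone agrees with the angle in all cases. *)
Lemma mine_direction_dist g h :
  mine (direction_dist g h) pi%:E = (alexandrov_angle g h)%:E.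
Proof.
have [api|] := ltP (alexandrov_angle g h) pi.
  rewrite direction_dist_angle// min_l// lee_fin; exact: angle_lepi.
move=> pia; have E : alexandrov_angle g h = pi.
  by apply/le_anti; rewrite pia angle_lepi.
by rewrite E min_r// -E direction_dist_ge.
Qed.

Lemma direction_dist_triangle h g k :
  (direction_dist g k <= direction_dist g h + direction_dist h k)%E.
Proof.
apply: intrinsic_triangle.
- by move=> y; exact: alexandrov_angle_refl.
- by move=> y u z; exact: angle_triangle.
- by move=> y z; exact: angle_ge0.
Qed.

End DirectionDist.

(** * Angles in the completed space of directions *)

Section CompletionAngle.
Context {R : realType} {X : metricType R}.
Hypothesis hX : @CAT0 R X.
Variable x : X.
Implicit Types (g h k : geodesic_from x).
Local Notation dd := (@direction_dist R X x).
Local Notation ang := (@alexandrov_angle R X x).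

Lemma cauchy_seqP (u : cauchy_seq dd) (e : R) : 0 < e ->
  exists N, forall m n, (N <= m)%N -> (N <= n)%N -> (dd (u m) (u n) < e%:E)%E.
Proof. by case: u => u H e0; exact: H. Qed.

(* Rules out the junk value of [limn] in [cauchy_dist]. *)
Lemma cauchy_dist_cases (u v : cauchy_seq dd) :
  (exists l : R, [/\ cauchy_dist u v = l%:E, 0 <= l &
     forall e, 0 < e -> exists N, forall n, (N <= n)%N ->
       exists r, dd (u n) (v n) = r%:E /\ `|r - l| < e]) \/
  (cauchy_dist u v = +oo%E /\
     exists N, forall n, (N <= n)%N -> dd (u n) (v n) = +oo%E).
Proof.
have step e : 0 < e -> exists N, forall m n, (N <= m)%N -> (N <= n)%N ->
    (dd (u n) (v n) <= dd (u m) (v m) + e%:E)%E.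
  move=> e0; have e20 : 0 < e / 2 by rewrite divr_gt0.
  have [N1 H1] := cauchy_seqP u e20; have [N2 H2] := cauchy_seqP v e20.
  exists (maxn N1 N2) => m n; rewrite !geq_max => /andP[m1 m2] /andP[n1 n2].
  have T1 := direction_dist_triangle hX (u m) (u n) (v n).
  have T2 := direction_dist_triangle hX (v m) (u m) (v n).
  apply: le_trans T1 _.
  have -> : (dd (u m) (v m) + e%:E = (e / 2)%:E + (dd (u m) (v m) + (e / 2)%:E))%E.
    by rewrite addeCA -EFinD -splitr.
  apply: leeD; first by apply/ltW/H1.
  by apply: le_trans T2 _; apply: leeD => //; apply/ltW/H2.
(* Past [N0], one finite distance makes all of them finite, so the distances are eventually finite
   or eventually infinite. *)
have [N0 HN0] := step 1 ltr01.
have [[n0 Nn0 fin0]|infty] := EM (exists2 n, (N0 <= n)%N & (dd (u n) (v n) < +oo)%E).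
  left; have fin n : (N0 <= n)%N -> dd (u n) (v n) \is a fin_num.
    move=> Nn; rewrite ge0_fin_numE ?direction_dist_ge0//.
    apply: le_lt_trans (HN0 n0 n Nn0 Nn) _.
    by rewrite lte_add_pinfty// ltry.
  pose r n := fine (dd (u n) (v n)).
  have rE n : (N0 <= n)%N -> dd (u n) (v n) = (r n)%:E.
    by move=> Nn; rewrite /r fineK// fin.
  have rC : cauchy (r @ \oo).
    apply/cauchy_ballP => e e0; have e20 : 0 < e / 2 by rewrite divr_gt0.
    have [N HN] := step _ e20; pose M := maxn N N0.
    exists (r @` [set n | (M <= n)%N], r @` [set n | (M <= n)%N]) => /=.
      by split; exists M => // n /= Nn; exists n.
    move=> [_ _] [/= [m Hm <-] [n Hn <-]].
    move: Hm Hn; rewrite !geq_max => /andP[m1 m2] /andP[n1 n2].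
    rewrite /ball/=; have := HN m n m1 n1; have := HN n m n1 m1.
    rewrite !rE// -!EFinD !lee_fin => h1 h2.
    by rewrite ltr_norml; apply/andP; split; lra.
  have /cauchy_cvgP rl := rC; pose l := limn r.
  have near_l e : 0 < e -> exists N, forall n, (N <= n)%N -> `|r n - l| < e.
    move=> e0; have /cvgrPdist_lt/(_ e e0)[N _ HN] := rl; exists N => n Nn.
    by rewrite distrC; exact: HN.
  exists l; split.
  - apply: cvg_lim => //.
    by apply: cvg_EFin => //; exists N0.
  - rewrite leNgt; apply/negP => l0; have l0' : 0 < - l by rewrite oppr_gt0.
    have [N HN] := near_l _ l0'; pose M := maxn N N0.
    have := HN M (leq_maxl _ _); rewrite ltr_norml => /andP[_ H].
    have := direction_dist_ge0 hX (u M) (v M); rewrite rE ?leq_maxr// lee_fin.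
    lra.
  - move=> e e0; have [N HN] := near_l e e0; exists (maxn N N0) => n.
    rewrite geq_max => /andP[n1 n2]; exists (r n); rewrite rE//; split=> //.
    exact: HN.
have inf n : (N0 <= n)%N -> dd (u n) (v n) = +oo%E.
  move=> Nn; apply/eqP; rewrite -leye_eq leNgt; apply/negP => H.
  by apply: infty; exists n.
right; split; last by exists N0.
apply: cvg_lim => //; apply: (@cvg_trans _ ((fun=> +oo%E : \bar R) @ \oo)); last exact: cvg_cst.
by apply: near_eq_cvg; exists N0 => // n /= Nn; rewrite inf.
Qed.

Lemma cauchy_angle_lim (u v : cauchy_seq dd) (e : R) : 0 < e ->
  exists N, forall n, (N <= n)%N ->
    `|ang (u n) (v n) - fine (mine (cauchy_dist u v) pi%:E)| < e.
Proof.
move=> e0; have [[l [-> l0 H]]|[-> [N HN]]] := cauchy_dist_cases u v.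
  have [N HN] := H e e0; exists N => n /HN[r [rE rl]].
  have := mine_direction_dist hX (u n) (v n); rewrite rE -!EFin_min => -[<-].
  rewrite /= /Order.min; move: rl; rewrite !ltr_norml => /andP[h1 h2].
  by case: (ltP r pi) => h3; case: (ltP l pi) => h4; apply/andP; split; lra.
exists N => n /HN E; have := mine_direction_dist hX (u n) (v n); rewrite E.
by rewrite min_r ?leey// => -[<-]; rewrite /= subrr normr0.
Qed.

(** The angle that enters [tinner]. Its properties are inherited from Alexandrov angles of
    representatives through [cangle_lim]. *)
Definition cangle (xi eta : directions x) : R :=
  fine (mine (dist_directions xi eta) pi%:E).

Lemma cangle_lim (xi eta : directions x) (e : R) : 0 < e ->
  exists N, forall n, (N <= n)%N ->
    `|ang (completion_repr xi n) (completion_repr eta n) - cangle xi eta| < e.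
Proof. exact: cauchy_angle_lim. Qed.

Lemma cangleE (xi eta : directions x) :
  mine (dist_directions xi eta) pi%:E = (cangle xi eta)%:E.
Proof.
rewrite /cangle /dist_directions /completion_dist.
have [[l [-> l0 _]]|[-> _]] := cauchy_dist_cases (completion_repr xi) (completion_repr eta).
  by rewrite -EFin_min.
by rewrite min_r ?leey.
Qed.

Lemma cangle_le_lim (xi eta : directions x) (b : R) :
  (forall e, 0 < e -> exists N, forall n, (N <= n)%N ->
    ang (completion_repr xi n) (completion_repr eta n) <= b + e) ->
  cangle xi eta <= b.
Proof.
move=> H; apply/ler_addgt0Pr => e e0; have e20 : 0 < e / 2 by rewrite divr_gt0.
have [N1 H1] := H _ e20; have [N2 H2] := cangle_lim xi eta e20.
have := H1 (maxn N1 N2) (leq_maxl _ _); have := H2 (maxn N1 N2) (leq_maxr _ _).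
by rewrite ltr_norml => /andP[h1 h2] h3; lra.
Qed.

Lemma cangle_ge_lim (xi eta : directions x) (b : R) :
  (forall e, 0 < e -> exists N, forall n, (N <= n)%N ->
    b <= ang (completion_repr xi n) (completion_repr eta n) + e) ->
  b <= cangle xi eta.
Proof.
move=> H; apply/ler_addgt0Pr => e e0; have e20 : 0 < e / 2 by rewrite divr_gt0.
have [N1 H1] := H _ e20; have [N2 H2] := cangle_lim xi eta e20.
have := H1 (maxn N1 N2) (leq_maxl _ _); have := H2 (maxn N1 N2) (leq_maxr _ _).
by rewrite ltr_norml => /andP[h1 h2] h3; lra.
Qed.

Lemma cangle_ge0 (xi eta : directions x) : 0 <= cangle xi eta.
Proof.
apply: cangle_ge_lim => e e0; exists 0%N => n _.
by rewrite addr_ge0 ?(ltW e0)// angle_ge0.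
Qed.

Lemma cangle_lepi (xi eta : directions x) : cangle xi eta <= pi.
Proof.
apply: cangle_le_lim => e e0; exists 0%N => n _.
by apply: le_trans (angle_lepi hX _ _) _; rewrite lerDl ltW.
Qed.

Lemma cangle_refl (xi : directions x) : cangle xi xi = 0.
Proof.
apply/le_anti; rewrite cangle_ge0 andbT; apply: cangle_le_lim => e e0; exists 0%N => n _.
by rewrite alexandrov_angle_refl add0r ltW.
Qed.

Lemma cangle_triangle (eta xi zeta : directions x) :
  cangle xi zeta <= cangle xi eta + cangle eta zeta.
Proof.
apply: cangle_le_lim => e e0; have e20 : 0 < e / 2 by rewrite divr_gt0.
have [N1 H1] := cangle_lim xi eta e20; have [N2 H2] := cangle_lim eta zeta e20.
exists (maxn N1 N2) => n; rewrite geq_max => /andP[n1 n2].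
have := angle_triangle hX (completion_repr eta n) (completion_repr xi n) (completion_repr zeta n).
have := H1 n n1; have := H2 n n2; rewrite !ltr_norml => /andP[h1 h2] /andP[h3 h4]; lra.
Qed.

Lemma cangle_lt (xi eta : directions x) (e : R) :
  (dist_directions xi eta < e%:E)%E -> cangle xi eta < e.
Proof.
move=> H; rewrite -lte_fin -cangleE; apply: le_lt_trans H.
by rewrite ge_min lexx.
Qed.

Lemma completion_reprE (xi : directions x) :
  sval xi = cauchy_class (completion_repr xi).
Proof. exact: (projT2 (cid (proj2_sig xi))). Qed.

(** The representative chosen by [completion_repr] need not be the constant sequence; it is only
    known to be at distance 0 from it. *)
Lemma repr_direction g (e : R) : 0 < e -> exists N, forall n, (N <= n)%N ->
  ang (completion_repr (direction g) n) g < e.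
Proof.
move=> e0; set u := completion_repr (direction g).
have := completion_reprE (direction g); rewrite -/u /=.
set c := CauchySeq _ => E.
have cc : cauchy_class c c.
  rewrite /cauchy_class/= /cauchy_dist.
  by under eq_fun do rewrite direction_dist_refl; rewrite lim_cst.
rewrite E in cc.
have [N HN] := cauchy_angle_lim u c e0; exists N => n /HN.
rewrite [cauchy_dist u c](_ : _ = 0%E)// min_l ?lee_fin ?pi_ge0//= subr0 ger0_norm//.
exact: angle_ge0.
Qed.

Lemma cangle_direction g h : cangle (direction g) (direction h) = ang g h.
Proof.
set xi := direction g; set eta := direction h.
apply/le_anti/andP; split; [apply: cangle_le_lim => e e0|apply: cangle_ge_lim => e e0].
all: have e20 : 0 < e / 2 by rewrite divr_gt0.
all: have [N1 H1] := repr_direction g e20; have [N2 H2] := repr_direction h e20.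
all: exists (maxn N1 N2) => n; rewrite geq_max => /andP[/H1 n1 /H2 n2]; rewrite -/xi -/eta in n1 n2.
  apply: le_trans (angle_triangle hX g _ _) _.
  rewrite (splitr e) addrCA; apply: lerD (ltW n1) _.
  apply: le_trans (angle_triangle hX h _ _) _.
  by rewrite (angle_sym hX h) lerD2l ltW.
apply: le_trans (angle_triangle hX (completion_repr xi n) _ _) _.
rewrite (angle_sym hX g) (splitr e) addrCA; apply: lerD (ltW n1) _.
apply: le_trans (angle_triangle hX (completion_repr eta n) _ _) _.
by rewrite lerD2l ltW.
Qed.

Lemma dist_direction_lt g h (e : R) : ang g h < pi -> ang g h < e ->
  (dist_directions (direction g) (direction h) < e%:E)%E.
Proof.
move=> api ae; have := cangleE (direction g) (direction h).
rewrite cangle_direction /Order.min; case: ltP => _ [E].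
  by rewrite E lte_fin.
by rewrite E ltxx in api.
Qed.

End CompletionAngle.

(** * First variation and the gradient of the distance to a point *)

Section Gradient.
Context {R : realType} {X : metricType R}.
Hypothesis hX : @CAT0 R X.

Lemma cos_cont (a e : R) : 0 < e -> exists2 d, 0 < d &
  forall b, `|b - a| < d -> `|cos b - cos a| < e.
Proof.
move=> e0; have /cvgrPdist_lt/(_ e e0)/nbhs_ballP[d /= d0 Hd] := @continuous_cos R a.
exists d => // b ba; rewrite distrC; apply: Hd.
by rewrite /ball/= distrC.
Qed.

(** The right-hand side is the chord of an arc [c] of the unit circle, which bounds the difference
    of the first coordinates. It is also the angular part of [cone_dist]. *)
Lemma cos_diff_le (a b c : R) : `|a - b| <= c -> c <= pi ->
  `|cos a - cos b| <= Num.sqrt (2 * (1 - cos c)).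
Proof.
move=> abc cpi; apply: sq_le; first exact: sqrtr_ge0.
rewrite sqr_sqrtr; last by rewrite mulr_ge0// subr_ge0 cos_le1.
rewrite real_normK ?num_real//.
have c0 : 0 <= c by exact: le_trans abc.
have : cos c <= cos (a - b).
  by rewrite -(cos_norm (a - b)) ler_cos0pi ?normr_ge0 ?c0//; exact: le_trans cpi.
rewrite cosB; have := cos2Dsin2 a; have := cos2Dsin2 b.
have := sqr_ge0 (sin a - sin b); rewrite sqrrB (sqrrB (cos a)); lra.
Qed.

Section AtPoint.
Variable x : X.
Implicit Types (g h : geodesic_from x).
Local Notation ang := (@alexandrov_angle R X x).
Local Notation cangle := (@cangle R X x).

Lemma cangle_sym (xi eta : directions x) : cangle xi eta = cangle eta xi.
Proof.
suff H a b : cangle a b <= cangle b a by apply/le_anti; rewrite !H.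
apply: (cangle_le_lim hX) => e e0; have [N HN] := cangle_lim hX b a e0.
exists N => n /HN; rewrite (angle_sym hX) ltr_norml => /andP[_]; lra.
Qed.

Lemma cangle_diff (zeta xi eta : directions x) :
  `|cangle zeta xi - cangle zeta eta| <= cangle xi eta.
Proof.
have := cangle_triangle hX xi zeta eta; have := cangle_triangle hX eta zeta xi.
rewrite (cangle_sym eta xi) ler_norml => h1 h2; apply/andP; split; lra.
Qed.

Lemma cone_distE (xi eta : directions x) (r s : {posnum R}) :
  cone_dist (Ray xi r) (Ray eta s) =
  Num.sqrt ((r%:num - s%:num) ^+ 2 + r%:num * s%:num * (2 * (1 - cos (cangle xi eta)))).
Proof.
by rewrite /cone_dist /= -/(cangle xi eta); congr Num.sqrt; ring.
Qed.

Lemma cone_dist_ge (xi eta : directions x) (r s : {posnum R}) :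
  `|r%:num - s%:num| <= cone_dist (Ray xi r) (Ray eta s) /\
  Num.min r%:num s%:num * Num.sqrt (2 * (1 - cos (cangle xi eta))) <=
    cone_dist (Ray xi r) (Ray eta s).
Proof.
rewrite cone_distE; set w := 2 * _.
have w0 : 0 <= w by rewrite mulr_ge0// subr_ge0 cos_le1.
have rs0 : 0 <= r%:num * s%:num by rewrite mulr_ge0.
split; apply: sq_le; rewrite ?sqrtr_ge0// sqr_sqrtr ?addr_ge0 ?sqr_ge0 ?mulr_ge0//.
  by rewrite real_normK ?num_real// lerDl mulr_ge0.
rewrite exprMn sqr_sqrtr// ler_wpDl ?sqr_ge0// ler_wpM2r//.
by rewrite expr2 ler_pM// ?ge_min ?lexx ?orbT// le_min !ge0.
Qed.

(** The constant 2 is one for the change of norm and one for the change of direction. The latter is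
    weighted by the smaller norm, as in [cone_dist_ge]; hence the case distinction. *)
Lemma tinner_lipschitz (v : directions x) :
  tangent_lipschitz (fun w => - tinner (Ray v 1%:pos) w).
Proof.
exists 2 => w w'; rewrite -opprD normrN /tinner/=.
case: w => [|xi r]; case: w' => [|eta s]; rewrite ?mul1r.
- by rewrite subrr normr0 mulr_ge0 ?sqrtr_ge0.
- rewrite add0r normrN normrM /cone_dist/= mulr0 subr0 expr0n add0r sqrtr_sqr.
  rewrite mulrC ler_pM// ?cos_max//; apply: le_trans (cos_max _) _; lra.
- rewrite subr0 normrM /cone_dist/= mulr0 subr0 expr0n addr0 sqrtr_sqr.
  rewrite mulrC ler_pM//; apply: le_trans (cos_max _) _; lra.
rewrite -/(cangle v xi) -/(cangle v eta).
have [H1 H2] := cone_dist_ge xi eta r s.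
have C := cos_diff_le (cangle_diff v xi eta) (cangle_lepi hX xi eta).
set d := cone_dist _ _ in H1 H2 *; set q := Num.sqrt _ in H2 C.
have [rs|sr] := leP r%:num s%:num.
  have -> : r%:num * cos (cangle v xi) - s%:num * cos (cangle v eta) =
     r%:num * (cos (cangle v xi) - cos (cangle v eta)) +
     (r%:num - s%:num) * cos (cangle v eta) by ring.
  apply: le_trans (ler_normD _ _) _; rewrite mulr_natl mulr2n; apply: lerD.
    apply: le_trans H2; rewrite normrM ger0_norm// min_l//.
    by rewrite ler_wpM2l.
  by apply: le_trans H1; rewrite normrM ler_piMr// cos_max.
have -> : r%:num * cos (cangle v xi) - s%:num * cos (cangle v eta) =
   s%:num * (cos (cangle v xi) - cos (cangle v eta)) +
   (r%:num - s%:num) * cos (cangle v xi) by ring.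
apply: le_trans (ler_normD _ _) _; rewrite mulr_natl mulr2n; apply: lerD.
  apply: le_trans H2; rewrite normrM ger0_norm// min_r ?(ltW sr)//.
  by rewrite ler_wpM2l.
by apply: le_trans H1; rewrite normrM ler_piMr// cos_max.
Qed.

(** The lower bound holds because the angle is at most the comparison angle towards [y]. The upper
    bound passes through the point [gam r] at a fixed scale, where the comparison angle is already
    close to the angle. *)
Lemma first_variation (gam g : geodesic_from x) (e : R) : 0 < e ->
  exists r, [/\ 0 < r, r <= glen g & forall s, 0 < s <= r ->
    `|mdist (g s) (geod_end gam) - mdist x (geod_end gam) + s * cos (ang gam g)| <= e * s].
Proof.
move=> e0; set y := geod_end gam.
have e20 : 0 < e / 2 by rewrite divr_gt0.
have [d d0 Hd] := cos_cont (ang gam g) e20.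
have [r [r0 rgam rg H]] := angle_near hX gam g d0.
set c := cos (ang gam g) in Hd *.
(* The bound [s <= e * r] absorbs the quadratic term: [s ^+ 2 <= e * r * s]. *)
exists (Num.min r (e * r)); split; first by rewrite lt_min r0 mulr_gt0.
  by rewrite ge_min rg.
move=> s /andP[s0]; rewrite le_min => /andP[sr ser].
have L0 : 0 < mdist x y := glen_gt0 gam.
have LI : 0 < glen gam <= glen gam by rewrite lexx glen_gt0.
have sI : 0 < s <= glen g by rewrite s0 (le_trans sr).
have rI : 0 < r <= glen gam by rewrite r0.
have wI g' u : 0 < u <= glen g' -> 0 <= u <= glen g' by move=> /andP[/ltW-> ->].
have lower : mdist x y - s * c <= mdist (g s) y.
  have := angle_le hX LI sI; rewrite geod_endE -/y => A.
  have xy : x != y by rewrite -mdist_gt0.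
  have cc : cos (comparison_angle x y (g s)) <= c.
    by rewrite ler_cos0pi ?angle_bounds// comparison_angle_bounds// (gneq sI).
  have Lw := cosine_law x y (g s); rewrite gdist ?wI// in Lw.
  apply: sq_le; first exact: mdist_ge0.
  have H1 : 2 * mdist x y * s * cos (comparison_angle x y (g s)) <= 2 * mdist x y * s * c.
    by rewrite ler_wpM2l// !mulr_ge0// ltW.
  have c2 : c ^+ 2 <= 1.
    by have := cos2Dsin2 (ang gam g); have := sqr_ge0 (sin (ang gam g)); rewrite -/c; lra.
  have := ler_wpM2l (sqr_ge0 s) c2.
  by rewrite (metric_sym (g s)) Lw sqrrB exprMn; lra.
have rr : 0 < r <= r by rewrite r0 lexx.
have sr' : 0 < s <= r by rewrite s0.
have upper : mdist (g s) y <= mdist x y - s * c + e * s.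
  have thlt := H r s rr sr'; have thge := angle_le hX rI sI.
  have := Hd (comparison_angle x (gam r) (g s)).
  rewrite ger0_norm ?subr_ge0// ltrBlDl => /(_ thlt); rewrite ltr_norml => /andP[cc _].
  have Lw := cosine_law x (gam r) (g s); rewrite !gdist ?wI// in Lw.
  set C := cos (comparison_angle _ _ _) in cc Lw.
  have sq : s ^+ 2 <= e * r * s by rewrite expr2 ler_wpM2r// ltW.
  have d1 : mdist (gam r) (g s) <= r - s * C + s * (e / 2).
    have h0 : 0 <= r - s * C + s * (e / 2).
      have C1 : C <= 1 by exact: cos_le1.
      have := ler_wpM2l (ltW s0) C1; have := mulr_ge0 (ltW s0) (ltW e20); lra.
    apply: sq_le => //; rewrite Lw.
    have -> : (r - s * C + s * (e / 2)) ^+ 2 =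
      r ^+ 2 - 2 * r * s * C + e * r * s + s ^+ 2 * (C - e / 2) ^+ 2 by field.
    have := mulr_ge0 (sqr_ge0 s) (sqr_ge0 (C - e / 2)); lra.
  have ryI : 0 <= r <= mdist x y by rewrite (ltW r0).
  have d2 := geodesic_distr (geodP gam) ryI; rewrite -/y in d2.
  have d3 := metric_triangle (g s) (gam r) y; rewrite (metric_sym (g s) (gam r)) d2 in d3.
  have : s * (c - e / 2) <= s * C by rewrite ler_wpM2l// ltW//; lra.
  lra.
by rewrite ler_norml; apply/andP; split; have := mulr_gt0 e0 s0; lra.
Qed.

Lemma norm_div_lt (a b e t : R) : 0 < t -> `|a - b * t| <= e / 2 * t -> 0 < e ->
  `|b - a / t| < e.
Proof.
move=> t0 H e0; rewrite -(ltr_pM2r t0) -[X in _ * X](gtr0_norm t0) -normrM mulrBl.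
rewrite divfK ?gt_eqF// distrC (le_lt_trans H)// ltr_pM2r//; lra.
Qed.

(** The curve is replaced by the constant-speed geodesic [h] that approximates it. The direction of
    [h] is close to [xi], by way of the geodesic from [x] to [c t], and [first_variation] gives the
    slope along [h]. *)
Lemma differential_dist (gam : geodesic_from x) :
  is_differential (fun p => mdist p (geod_end gam))
    (fun w => - tinner (Ray (direction gam) 1%:pos) w).
Proof.
split; first exact: tinner_lipschitz.
set y := geod_end gam; move=> c a v a0 _ [c0 speed dir] fog.
rewrite c0; set rho := tnorm v in speed.
have speedP e : 0 < e -> exists2 d, 0 < d & forall t, 0 < t < d ->
    `|mdist (c t) x - rho * t| <= e * t.
  move=> e0; have /cvgrPdist_lt/(_ e e0)/near_rightP[d d0 Hd] := speed.
  exists d => // t /andP[t0 td]; have := Hd t; rewrite add0r t0 td => /(_ isT).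
  rewrite subr0 c0 -(ltr_pM2r t0) -[X in _ * X < _](gtr0_norm t0) -normrM mulrBl.
  by rewrite divfK ?gt_eqF// distrC => /ltW.
case: v @rho speed dir speedP => [|xi rho'] rho speed dir speedP.
  rewrite /= oppr0; apply/cvgrPdist_lt => e e0; apply/near_rightP.
  have e20 : 0 < e / 2 by rewrite divr_gt0.
  have [d d0 Hd] := speedP _ e20; exists d => // t; rewrite add0r => tI.
  have /andP[t0 _] := tI; apply: norm_div_lt => //; rewrite mul0r subr0.
  apply: le_trans (Hd t tI); rewrite mul0r subr0 [leRHS]ger0_norm ?mdist_ge0//.
  exact: mdist_diff.
rewrite /rho /= mul1r -/(cangle (direction gam) xi) in speedP *.
have r00 : 0 < rho'%:num by [].
set r0 := rho'%:num in speedP r00 *.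
set al := cangle (direction gam) xi.
apply/cvgrPdist_lt => e e0.
(* Four errors of rates e/12, e/24, e/12 and e/24 add up to e/4, below the [e / 2] required by
   [norm_div_lt]. *)
pose e3 := e / (24 * r0).
have e30 : 0 < e3 by rewrite divr_gt0// mulr_gt0.
have e3E : e3 * r0 = e / 24 by rewrite /e3; field; rewrite gt_eqF.
have [e2' e2'0 He2] := cos_cont al e30.
pose e2 := e2' / 2; have e20 : 0 < e2 by rewrite divr_gt0.
have [k /andP[k0 k2] Hk] := comparison_small (X := X) e20.
(* The three bounds serve the final error, the positivity of the speed of [h], and
   [comparison_small], where [c t] is at distance at least [r0 / 2 * t] from [x]. *)
pose e1 := Num.min (e / 24) (Num.min (r0 / 8) (k * r0 / 2)).
have e10 : 0 < e1 by rewrite !lt_min !divr_gt0// mulr_gt0.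
have e1e : e1 <= e / 24 by rewrite ge_min lexx.
have e1r : e1 <= r0 / 8 by rewrite /e1 !ge_min lexx orbT.
have e1k : e1 <= k * r0 / 2 by rewrite /e1 !ge_min lexx !orbT.
have [a' [r [h [a'0 r_ge0 hI]]]] := fog e1 e10.
move=> /near_rightP[d1 d10 near_h].
have [d2 d20 Hs] := speedP e1 e10.
have /near_rightP[d3 d30 Hdir] := dir e2 e20.
(* The approximation concerns positive times only, so the starting point of [h] is recovered as a
   limit. *)
have h0x : h 0 = x.
  apply: mdist0_eq; apply/ler_addgt0Pr => z z0; rewrite add0r.
  pose q := r + r0 + 1; have q0 : 0 < q by rewrite /q; lra.
  pose m := Num.min (Num.min d1 d2) (Num.min a' (z / (2 * q))).
  have m0 : 0 < m by rewrite !lt_min d10 d20 a'0 divr_gt0// mulr_gt0.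
  have : m / 2 < m by lra.
  rewrite !lt_min => /andP[/andP[md1 md2] /andP[ma mz]].
  have t0 : 0 < m / 2 by rewrite divr_gt0.
  set t := m / 2 in md1 md2 ma mz t0.
  have := near_h t; rewrite add0r t0 md1 => /(_ isT) A1.
  have := Hs t; rewrite t0 md2 => /(_ isT); rewrite ler_norml => /andP[_ A2].
  have := hI 0 t; rewrite !in_itv/= lexx (ltW a'0) (ltW t0) (ltW ma) => /(_ isT isT).
  rewrite sub0r normrN gtr0_norm// => A3.
  have := metric_triangle (h 0) (h t) x; have := metric_triangle (h t) (c t) x.
  rewrite (metric_sym (h t) (c t)) => A4 A5.
  have A6 : e1 * t <= r0 / 8 * t by rewrite ler_wpM2r// ltW.
  have A7 : t * (2 * q) < z by rewrite -ltr_pdivlMr// mulr_gt0.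
  rewrite /q in A7.
  have := mulr_gt0 r00 t0; have := mulr_ge0 r_ge0 (ltW t0); lra.
have hx t : 0 <= t <= a' -> mdist (h t) x = r * t.
  move=> tI; rewrite -h0x hI ?in_itv//=; first by rewrite subr0 ger0_norm//; case/andP: tI.
  by rewrite lexx ltW.
have r_r0 : `|r - r0| <= 2 * e1.
  pose m := Num.min (Num.min d1 d2) a'.
  have m0 : 0 < m by rewrite !lt_min d10 d20 a'0.
  have : m / 2 < m by lra.
  rewrite !lt_min => /andP[/andP[md1 md2] ma].
  have t0 : 0 < m / 2 by rewrite divr_gt0.
  set t := m / 2 in md1 md2 ma t0.
  have := near_h t; rewrite add0r t0 md1 => /(_ isT) A1.
  have := Hs t; rewrite t0 md2 => /(_ isT) A2.
  have := hx t; rewrite (ltW t0) (ltW ma) => /(_ isT) A3.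
  have := mdist_diff (c t) (h t) x; rewrite A3 => A4.
  rewrite -(ler_pM2r t0) -[X in `|_| * X](gtr0_norm t0) -normrM mulrBl.
  move: A2 A4; rewrite !ler_norml => /andP[B1 B2] /andP[B3 B4].
  by apply/andP; split; lra.
have rpos : 0 < r by move: r_r0; rewrite ler_norml => /andP[]; lra.
have end_neq : x != h a'.
  by rewrite -mdist_gt0 metric_sym hx ?(ltW a'0) ?lexx// mulr_gt0.
have hgeod : geodesic x (h a') (fun s => h (s / r)).
  have E : mdist x (h a') = r * a' by rewrite metric_sym hx ?(ltW a'0) ?lexx.
  rewrite /geodesic E mul0r mulrAC mulfV ?mul1r ?gt_eqF//; split=> //.
  move=> s t; rewrite !in_itv/= => /andP[s0 s1] /andP[t0 t1].
  rewrite hI ?in_itv/= ?divr_ge0 ?ler_pdivrMr ?(mulrC a')//.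
  by rewrite -{1}(gtr0_norm rpos) -normrM mulrBr !(mulrC r) !divfK// gt_eqF.
pose g := GeodesicFrom end_neq hgeod.
have glenE : glen g = r * a' by rewrite /glen/= metric_sym hx ?(ltW a'0) ?lexx.
have [rv [rv0 rvg Hv]] := first_variation gam g e30; rewrite -/y in Hv.
apply/near_rightP; exists (Num.min (Num.min d1 (Num.min d2 d3)) (Num.min a' (rv / r))).
  by rewrite !lt_min d10 d20 d30 a'0 divr_gt0.
move=> t; rewrite add0r !lt_min => /andP[t0 /andP[/andP[td1 /andP[td2 td3]] /andP[ta trv]]].
have := near_h t; rewrite add0r t0 td1 => /(_ isT) A1.
have := Hs t; rewrite t0 td2 => /(_ isT) A2.
have := Hdir t; rewrite add0r t0 td3 => /(_ isT) A3.
have tI : 0 <= t <= a' by rewrite !ltW.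
have ctx : r0 / 2 * t <= mdist (c t) x.
  move: A2; rewrite ler_norml => /andP[A2 _].
  have : e1 * t <= r0 / 8 * t by rewrite ler_wpM2r// ltW.
  have := mulr_gt0 r00 t0; lra.
have xct : x != c t.
  rewrite -mdist_gt0 metric_sym (lt_le_trans _ ctx)// mulr_gt0// divr_gt0//.
have rtI : 0 < r * t <= glen g by rewrite mulr_gt0//= glenE ler_pM2l// ltW.
have gE : g (r * t) = h t by rewrite /= mulrAC mulfV ?mul1r// gt_eqF.
have [gt gtE] := geod_to hX xct.
have gam_gt : ang g gt < e2.
  have [|_] := Hk x (c t) (h t) xct.
    rewrite (metric_sym x); apply: le_trans A1 _.
    apply: (@le_trans _ _ (k * r0 / 2 * t)); first by rewrite ler_wpM2r// ltW.
    by rewrite -!mulrA ler_wpM2l ?(ltW k0)//; move: ctx; lra.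
  apply: le_lt_trans; rewrite comparison_angle_sym -gE -gtE -geod_endE.
  by apply: (angle_le hX rtI); rewrite lexx glen_gt0.
have gt_xi : cangle (direction gt) xi < e2 by apply: (cangle_lt hX); exact: A3.
have al_g : `|ang gam g - al| < e2'.
  rewrite -(cangle_direction hX) /al.
  apply: le_lt_trans (cangle_diff _ _ _) _.
  apply: le_lt_trans (cangle_triangle hX (direction gt) _ _) _.
  by rewrite (cangle_direction hX) /e2 in gam_gt gt_xi *; lra.
have := He2 _ al_g; set C := cos (ang gam g) => CC.
have := Hv (r * t); rewrite mulr_gt0// mulrC -ler_pdivlMr// (ltW trv) => /(_ isT).
rewrite [t * r]mulrC gE -/C => A4.
apply: norm_div_lt => //.
have A5 := mdist_diff (c t) (h t) y.
have rt : r * t <= 2 * r0 * t.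
  by rewrite ler_wpM2r ?(ltW t0)//; move: r_r0; rewrite ler_norml => /andP[]; lra.
have A6 : `|(r - r0) * (t * C)| <= 2 * e1 * t.
  rewrite normrM; apply: ler_pM => //.
  by rewrite normrM (gtr0_norm t0) ler_piMr ?cos_max// ltW.
have A7 : `|r0 * t * (C - cos al)| <= r0 * t * e3.
  have rt0 : 0 <= r0 * t by rewrite mulr_ge0// ltW.
  by rewrite normrM (ger0_norm rt0) ler_wpM2l// ltW.
have A8 : e1 * t <= e / 24 * t by rewrite ler_wpM2r// ltW.
have A9 : e3 * (r * t) <= e3 * (2 * r0 * t) by rewrite ler_wpM2l// ltW.
have A10 : r0 * t * e3 = e / 24 * t by rewrite -e3E; ring.
have A11 : e3 * (2 * r0 * t) = e / 12 * t.
  by rewrite (_ : e3 * _ = 2 * (e3 * r0) * t); [rewrite e3E; field|ring].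
have E1 : mdist (c t) y - mdist x y - - (r0 * cos al) * t =
  (mdist (c t) y - mdist (h t) y) + (mdist (h t) y - mdist x y + r * t * C) -
  (r - r0) * (t * C) - r0 * t * (C - cos al) by ring.
rewrite E1; move: A4 A5 A6 A7; rewrite !ler_norml.
move=> /andP[? ?] /andP[? ?] /andP[? ?] /andP[? ?].
by have := mulr_gt0 e0 t0; move=> ?; apply/andP; split; lra.
Qed.

Lemma gradient_dist (gam : geodesic_from x) :
  is_gradient_opp (fun p => mdist p (geod_end gam)) (Ray (direction gam) 1%:pos).
Proof.
by exists (fun w => - tinner (Ray (direction gam) 1%:pos) w); split=> //; exact: differential_dist.
Qed.

End AtPoint.
End Gradient.

(** * First-order chasing curves are pursuit curves *)

Section PursuitExists.
Context {R : realType} {X : metricType R}.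
Hypothesis hX : @CAT0 R X.

Lemma chase_pursuit (Y c : R -> X) (t : R) : c t <> Y t ->
  (forall e, 0 < e -> chase_err hX Y c t e) ->
  exists v : tangent_cone (c t),
    right_tangent v c t /\ is_gradient_opp (fun p => mdist p (Y t)) v.
Proof.
move=> /eqP xY Hc; set x := c t in xY *.
pose gam := GeodesicFrom xY (geoP hX x (Y t)).
exists (Ray (direction gam) 1%:pos); split; last exact: (gradient_dist hX gam).
have L0 : 0 < glen gam by exact: glen_gt0.
have near_gam e : 0 < e -> exists2 d, 0 < d & forall h, 0 < h < d ->
    [/\ 0 < h <= glen gam, mdist x (gam h) = h & mdist (c (t + h)) (gam h) <= e * h].
  move=> e0; have [d d0 Hd] := Hc e e0; exists (Num.min d (glen gam)).
    by rewrite lt_min d0.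
  move=> h /andP[h0]; rewrite lt_min => /andP[hd hl].
  split; first by rewrite h0 ltW.
    by rewrite gdist// !ltW.
  by apply: Hd; rewrite h0.
split=> //.
  apply/cvgrPdist_lt => e e0; apply/near_rightP; have e20 : 0 < e / 2 by rewrite divr_gt0.
  have [d d0 Hd] := near_gam _ e20; exists d => // t' /andP[tt' t'd].
  pose h := t' - t; have hE : t' = t + h by rewrite /h subrKC.
  have h0 : 0 < h by rewrite subr_gt0.
  have [|_ dh A] := Hd h; first by rewrite h0 ltrBlDl.
  rewrite -/h hE -/x; apply: norm_div_lt => //; rewrite mul1r.
  have := mdist_diff (c (t + h)) (gam h) x; rewrite (metric_sym (gam h)) dh => B.
  exact: le_trans B A.
(* Capped at pi, because below pi the distance of two directions is known to be their angle. *)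
move=> e e0; pose e' := Num.min e pi.
have e'0 : 0 < e' by rewrite lt_min e0 pi_gt0.
have [k /andP[k0 k1] Hk] := comparison_small (X := X) e'0.
have [d d0 Hd] := near_gam _ k0.
apply/near_rightP; exists d => // t' /andP[tt' t'd] g gE.
pose h := t' - t; have hE : t' = t + h by rewrite /h subrKC.
have h0 : 0 < h by rewrite subr_gt0.
have [|hI dh A] := Hd h; first by rewrite h0 ltrBlDl.
have [] := Hk x (gam h) (c t') (gneq hI).
  by rewrite dh metric_sym hE.
rewrite -gE -geod_endE => _.
have gI : 0 < glen g <= glen g by rewrite glen_gt0 lexx.
move=> /(le_lt_trans (angle_le hX hI gI)).
rewrite (angle_sym hX) lt_min => /andP[ae api].
exact: dist_direction_lt.
Qed.

End PursuitExists.

(** * What an arbitrary gradient says about directions *)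

Section WeakPursuit.
Context {R : realType} {X : metricType R}.
Hypothesis hX : @CAT0 R X.

Section AtPoint.
Variable x : X.
Implicit Types (g : geodesic_from x).
Local Notation ang := (@alexandrov_angle R X x).
Local Notation cangle := (@cangle R X x).

Lemma chain_linear (r : R) (c : R -> X) (a b s0 : R) s : last s0 s <= b -> a <= s0 ->
  (forall u v, a <= u -> u <= v -> v <= b -> mdist (c u) (c v) = r * (v - u)) ->
  path <%R s0 s -> chain (@mdist R X) c s0 s = r * (last s0 s - s0).
Proof.
move=> + + H; elim: s s0 => [|y s IH] s0 /=; first by rewrite subrr mulr0.
move=> lb as0 /andP[s0y py].
have yl : y <= last y s by have /andP[] := path_lt_in py (mem_head _ _).
rewrite IH ?(le_trans as0 (ltW s0y))// H//; first by ring.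
- exact: ltW.
- exact: le_trans lb.
Qed.

(** Constant-speed geodesics are admissible test curves in [is_differential]; they are the ones on
    which an arbitrary differential is evaluated. *)
Lemma ray_curve g (r : {posnum R}) (c := fun u : R => g (r%:num * u)) :
  exists2 a : R, 0 < a & [/\ rectifiable 0 a c,
    right_tangent (Ray (direction g) r) c 0, first_order_geodesic c &
    {in `[0, a] &, forall u v, mdist (c u) (c v) = r%:num * `|u - v|}].
Proof.
pose a := glen g / r%:num; have a0 : 0 < a by rewrite divr_gt0// glen_gt0.
have ra : r%:num * a = glen g by rewrite mulrC divfK.
have rI u : 0 <= u <= a -> 0 <= r%:num * u <= glen g.
  by move=> /andP[u0 ua]; rewrite mulr_ge0//= -ra ler_wpM2l.
have iso : {in `[0, a] &, forall u v, mdist (c u) (c v) = r%:num * `|u - v|}.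
  move=> u v; rewrite !in_itv/= => uI vI.
  by rewrite (geodesic_dist (geodP g)) ?rI// -mulrBr normrM ger0_norm.
have c0 : c 0 = x by rewrite /c mulr0; case: (geodP g).
exists a => //; split=> //.
- split.
    apply/subspace_continuousP => u /= uI; apply/cvg_ballP => e e0.
    rewrite near_withinE; apply/nbhs_ballP; exists (e / r%:num); first by rewrite /= divr_gt0.
    move=> v uv vI; rewrite ballEmdist/= iso//.
    by move: uv; rewrite /ball/= ltr_pdivlMr// mulrC.
  apply: (@le_lt_trans _ _ (r%:num * a)%:E); last by rewrite ltry.
  apply: length_le => s ps ls; rewrite lee_fin (@chain_linear r%:num c 0 a)//.
  + by rewrite ls subr0.
  + by rewrite ls.
  + move=> u v u0 uv va; rewrite iso ?in_itv/=.
    * by rewrite distrC ger0_norm ?subr_ge0.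
    * by rewrite u0 (le_trans uv).
    * by rewrite va (le_trans u0).
- split=> //.
    apply/cvgrPdist_lt => e e0; apply/near_rightP; exists a => // t; rewrite add0r.
    move=> /andP[t0 ta]; rewrite iso ?in_itv/= ?lexx ?(ltW t0) ?(ltW ta) ?(ltW a0)//.
    by rewrite subr0 (gtr0_norm t0) mulfK ?gt_eqF// subrr normr0.
  move=> e e0; apply/near_rightP; exists a => // t; rewrite add0r => /andP[t0 ta] g' g'E.
  have tI : 0 < r%:num * t <= glen g by rewrite mulr_gt0//= -ra ler_wpM2l// ltW.
  have g'I : 0 < glen g' <= glen g' by rewrite glen_gt0 lexx.
  have : ang g' g = 0.
    apply/le_anti; rewrite angle_ge0// andbT.
    have := angle_le hX g'I tI; rewrite geod_endE g'E.
    by rewrite comparison_self// (gneq tI).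
  by move=> E; apply: (dist_direction_lt hX); rewrite E ?pi_gt0.
- move=> e e0; exists a, r%:num, c; split=> //.
  apply/near_rightP; exists a => // t; rewrite add0r => /andP[t0 _].
  by rewrite mdistxx mulr_ge0// ltW.
Qed.

(** Along [gam] the distance decreases at unit speed, so [D] is at most -1 there, and for v = (xi,
    r) at angle theta from [gam] the gradient inequality gives r cos theta >= 1. On geodesics the
    distance decreases no faster than their speed, and [xi] is a limit of directions of geodesics to
    points of [c], so D v >= - r. With D v = - r^2 this yields r <= 1, hence r = 1 and theta = 0. *)
Lemma gradient_unique (gam : geodesic_from x) (v : tangent_cone x) (c : R -> X) (t : R) :
  right_tangent v c t -> is_gradient_opp (fun p => mdist p (geod_end gam)) v ->
  exists2 xi, v = Ray xi 1%:pos & cangle xi (direction gam) = 0.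
Proof.
set y := geod_end gam.
move=> [ct speed dir] [D [[[K HK] Dcurve] Dge Dv]].
have limD g (r : {posnum R}) e : 0 < e -> exists u, [/\ 0 < u, 0 <= r%:num * u <= glen g &
    `|(mdist (g (r%:num * u)) y - mdist x y) / u - D (Ray (direction g) r)| < e].
  move=> e0; have [a a0 [rect tan fog iso]] := ray_curve g r.
  have /cvgrPdist_lt/(_ e e0)/near_rightP[d d0 Hd] := Dcurve _ _ _ a0 rect tan fog.
  pose m := Num.min d (glen g / r%:num).
  have m0 : 0 < m by rewrite lt_min d0 divr_gt0// glen_gt0.
  have : m / 2 < m by lra.
  rewrite lt_min => /andP[md mg]; have m20 : 0 < m / 2 by rewrite divr_gt0.
  exists (m / 2); split=> //.
    by rewrite mulr_ge0 ?(ltW m20)//= mulrC -ler_pdivlMr// ltW.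
  have := Hd (m / 2); rewrite add0r m20 md mulr0 distrC.
  have [g0 _ _] := geodP g.
  by rewrite g0; apply.
have Dgam : D (Ray (direction gam) 1%:pos) <= -1.
  apply/ler_addgt0Pr => e e0; have [u [u0 uI H]] := limD gam 1%:pos e e0.
  move: H uI; rewrite /= mul1r => H uI; move: H.
  rewrite (geodesic_distr (geodP gam) uI) -/y addrAC subrr sub0r mulNr divff ?gt_eqF//.
  by rewrite ltr_norml => /andP[]; lra.
have Dge' g (r : {posnum R}) : - r%:num <= D (Ray (direction g) r).
  apply/ler_addgt0Pr => e e0; have [u [u0 uI H]] := limD g r e e0.
  have := mdist_diff x (g (r%:num * u)) y; rewrite gdist// ler_norml => /andP[_ A].
  have : - r%:num <= (mdist (g (r%:num * u)) y - mdist x y) / u.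
    by rewrite ler_pdivlMr// mulNr; lra.
  by move: H; rewrite ltr_norml => /andP[]; lra.
have := le_trans (Dge (Ray (direction gam) 1%:pos)) Dgam.
case: v speed dir Dge Dv => [|xi r] speed dir Dge Dv /=.
  by rewrite oppr0; lra.
rewrite mulr1 -/(cangle xi (direction gam)) => r_ge1.
have r0 : 0 < r%:num by [].
have Dxi : - r%:num <= D (Ray xi r).
  apply/ler_addgt0Pr => e e0.
  pose K1 := `|K| + 1; have K10 : 0 < K1 by rewrite ltr_wpDl.
  pose w := e / (K1 * r%:num); have w0 : 0 < w by rewrite divr_gt0// mulr_gt0.
  (* A cosine within [w ^+ 2 / 2] of 1 puts the two rays at cone distance at most r w, and [w] is
     such that the Lipschitz bound of [D] then costs at most [e]. *)
  have w20 : 0 < w ^+ 2 / 2 by rewrite divr_gt0// exprn_gt0.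
  have [d d0 Hd] := @cos_cont R 0 _ w20.
  have /near_rightP[d1 d10 H1] := dir d d0.
  have r20 : 0 < r%:num / 2 by rewrite divr_gt0.
  have /cvgrPdist_lt/(_ _ r20)/near_rightP[d2 d20 H2] := speed.
  pose m := Num.min d1 d2; have m0 : 0 < m by rewrite lt_min d10.
  have : m / 2 < m by lra.
  rewrite lt_min => /andP[md1 md2]; have m20 : 0 < m / 2 by rewrite divr_gt0.
  have xc : x != c (t + m / 2).
    apply/eqP => E; have := H2 (t + m / 2); rewrite ltrDl m20 ltrD2l md2 => /(_ isT).
    rewrite -E ct mdistxx mul0r subr0 gtr0_norm//=; lra.
  have [g gE] := geod_to hX xc.
  have := H1 (t + m / 2); rewrite ltrDl m20 ltrD2l md1 => /(_ isT g gE) /(cangle_lt hX) ad.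
  have := Hd (cangle (direction g) xi); rewrite subr0 ger0_norm ?cangle_ge0// => /(_ ad).
  rewrite cos0 ltr_norml => /andP[cc _].
  have := HK (Ray (direction g) r) (Ray xi r); rewrite cone_distE subrr expr0n add0r.
  have := Dge' g r.
  set q := Num.sqrt _ => A B.
  have qw : q <= r%:num * w.
    apply: sq_le; first by rewrite mulr_ge0// ltW.
    rewrite /q sqr_sqrtr; last by rewrite !mulr_ge0// subr_ge0 cos_le1.
    by rewrite exprMn -expr2 ler_wpM2l ?sqr_ge0//; lra.
  have : K * q <= e.
    apply: (@le_trans _ _ (K1 * (r%:num * w))).
      apply: le_trans (ler_norm _) _; rewrite normrM (ger0_norm (sqrtr_ge0 _)).
      by apply: ler_pM => //; rewrite ?sqrtr_ge0// lerDl.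
    by rewrite /w mulrA mulrC divfK// gt_eqF// mulr_gt0.
  by move: B; rewrite ler_norml => /andP[_]; lra.
have cxx : cos (cangle xi xi) = 1 by rewrite cangle_refl// cos0.
move: Dv; rewrite /= -/(cangle xi xi) cxx mulr1 => Dv; rewrite Dv lerN2 in Dxi.
have r_le1 : r%:num <= 1 by rewrite -(ler_pM2l r0) mulr1.
have cle := cos_le1 (cangle xi (direction gam)).
have r_eq1 : r%:num = 1.
  apply/le_anti; rewrite r_le1/=; apply: (@le_trans _ _ (r%:num * cos (cangle xi (direction gam)))); first lra.
  by rewrite ler_piMr.
exists xi; first by congr Ray; apply/val_inj.
apply: cos_inj; rewrite ?in_itv/= ?cangle_ge0 ?cangle_lepi ?lexx ?pi_ge0//.
by rewrite cos0; apply/le_anti; rewrite cle/=; rewrite r_eq1 mul1r in r_ge1; lra.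
Qed.

End AtPoint.
End WeakPursuit.

(** * Comparison of an arbitrary pursuit curve with the constructed one *)

Section Uniqueness.
Context {R : realType} {X : metricType R}.
Hypothesis hX : @CAT0 R X.

Lemma isosceles (x p q : X) (l w : R) : x != p -> x != q -> mdist x p = l -> mdist x q = l ->
  0 <= w <= pi -> comparison_angle x p q <= w -> mdist p q ^+ 2 <= 2 * (1 - cos w) * l ^+ 2.
Proof.
move=> xp xq lp lq wI H; have := dist_le_comparison xp xq wI H.
by rewrite lp lq; lra.
Qed.

(* If the curve approaches [z] at almost unit speed along a sequence of times, then
   its points at these times are close to the geodesic towards [z], which makes a
   small angle with [gam]: so the sequence is close to [gam]. *)
Lemma good_step (e : R) : 0 < e -> exists2 D, 0 < D < 1 &
  forall (x z : X) (gam : geodesic_from x) (y : R -> X),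
  (exists2 d, 0 < d & forall h, 0 < h < d -> mdist x (y h) <= h) ->
  (forall w, 0 < w -> exists2 d, 0 < d & forall h, 0 < h < d ->
     forall g : geodesic_from x, geod_end g = y h -> alexandrov_angle g gam < w) ->
  (forall d, 0 < d -> exists2 h, 0 < h < d & mdist (y h) z <= mdist x z - (1 - D) * h) ->
  forall d, 0 < d -> exists2 h, 0 < h < d & mdist (y h) (gam h) <= e * h.
Proof.
move=> e0; pose e1 := Num.min e 1.
have e10 : 0 < e1 by rewrite lt_min e0 ltr01.
have e1e : e1 <= e by rewrite ge_min lexx.
have e11 : e1 <= 1 by rewrite ge_min lexx orbT.
(* If [1 - cos u <= q], two points at distance l from [x] with comparison angle at most u are within
   [e1 / 3] times l of each other. *)
pose q := (e1 / 3) ^+ 2 / 2.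
have q0 : 0 < q by rewrite divr_gt0// exprn_gt0// divr_gt0.
have qe : q <= e1 / 3.
  have -> : q = e1 / 3 * (e1 / 6) by rewrite /q; field.
  by rewrite ler_piMr; lra.
have [d0 d00 Hd0] := @cos_cont R 0 _ q0.
have pi0 : 0 < pi :> R by exact: pi_gt0.
pose w := Num.min (d0 / 4) (pi / 8).
have w0 : 0 < w by rewrite lt_min !divr_gt0.
have wd : w <= d0 / 4 by rewrite ge_min lexx.
have wpi : w <= pi / 8 by rewrite ge_min lexx orbT.
have cosq u : 0 <= u -> u <= 3 * w -> 1 - cos u <= q.
  move=> u0 u3; have := Hd0 u; rewrite subr0 ger0_norm// cos0 => H.
  have : `|cos u - 1| < q by apply: H; lra.
  by rewrite ltr_norml => /andP[]; lra.
have wI : 0 <= w <= pi by apply/andP; split; lra.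
have w3I : 0 <= 3 * w <= pi by apply/andP; split; lra.
have cw0 : 0 < cos w by apply: cos_gt0_pihalf; apply/andP; split; lra.
have cw1 : cos w < 1.
  by rewrite -(@cos0 R) ltr_cos ?in_itv//= lexx ltW.
(* With this [D], approaching [z] by at least [cos w * h] while moving by at most [h] forces a
   comparison angle at most [w] at [x]. *)
exists (1 - cos w); first by apply/andP; split; lra.
move=> x z gam y [dL dL0 HL] Hang Happ d d_gt0; rewrite subKr in Happ.
have key h : 0 < h -> h < dL -> mdist (y h) z <= mdist x z - cos w * h ->
    [/\ x != z, x != y h, mdist x (y h) <= h, cos w * h <= mdist x (y h) &
        comparison_angle x (y h) z <= w].
  move=> h0 hL Hz; have l1 : mdist x (y h) <= h by apply: HL; rewrite h0.
  have l2 : cos w * h <= mdist x (y h).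
    by have := metric_triangle x (y h) z; lra.
  have cwh : 0 < cos w * h by rewrite mulr_gt0.
  have xz : x != z by rewrite -mdist_gt0; have := mdist_ge0 (y h) z; lra.
  have xy : x != y h by rewrite -mdist_gt0; lra.
  split=> //; apply: comparison_le => //.
  have H1 : mdist (y h) z <= mdist x z - mdist x (y h) * cos w.
    apply: le_trans Hz _; rewrite lerD2l lerN2 mulrC.
    by rewrite ler_pM2l.
  have H2 : mdist (y h) z ^+ 2 <= (mdist x z - mdist x (y h) * cos w) ^+ 2.
    by rewrite ler_sqr ?nnegrE ?mdist_ge0//; apply: le_trans H1; exact: mdist_ge0.
  apply: le_trans H2 _; rewrite sqrrB exprMn (cos2sin2 w).
  by have := mulr_ge0 (sqr_ge0 (mdist x (y h))) (sqr_ge0 (sin w)); lra.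
have [dA dA0 HA] := Hang w w0.
pose m1 := Num.min dL dA; have m10 : 0 < m1 by rewrite lt_min dL0.
(* The time [h1] serves only to bound the angle between the geodesic to [z] and [gam], through the
   direction of [y h1]. Since [z] is fixed, the bound is still available when [h] is chosen below a
   scale [r] that depends on it. *)
have [h1 /andP[h10]] := Happ m1 m10; rewrite lt_min => /andP[h1L h1A] Hz1.
have [xz xy1 _ _ A1] := key h1 h10 h1L Hz1.
have [zeta zetaE] := geod_to hX xz; have [g1 g1E] := geod_to hX xy1.
have lenI (g : geodesic_from x) : 0 < glen g <= glen g by rewrite glen_gt0 lexx.
have B1 : alexandrov_angle g1 zeta <= w.
  apply: le_trans A1; rewrite -zetaE -g1E -!geod_endE.
  exact: (angle_le hX (lenI g1) (lenI zeta)).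
have B2 : alexandrov_angle g1 gam < w by apply: (HA h1) => //; rewrite h10.
have B3 : alexandrov_angle zeta gam < 2 * w.
  have := angle_triangle hX g1 zeta gam; rewrite (angle_sym hX zeta g1); lra.
have [r [r0 rz rgam Hr]] := angle_near hX zeta gam w0.
pose m := Num.min (Num.min dL d) r; have m0 : 0 < m by rewrite !lt_min dL0 d_gt0.
have [h /andP[h0]] := Happ m m0; rewrite !lt_min => /andP[/andP[hL hd] hr] Hz.
have [_ xy lh cl Az] := key h h0 hL Hz.
exists h; first by rewrite h0.
set l := mdist x (y h) in lh cl.
have l0 : 0 < l by rewrite mdist_gt0.
have lzI : 0 < l <= glen zeta by rewrite l0 (le_trans lh)// (le_trans (ltW hr)).
have lgI : 0 < l <= glen gam by rewrite l0 (le_trans lh)// (le_trans (ltW hr)).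
have lrI : 0 < l <= r by rewrite l0 (le_trans lh)// ltW.
have hgI : 0 <= h <= glen gam by rewrite (ltW h0) (le_trans (ltW hr)).
have wk (g : geodesic_from x) u : 0 < u <= glen g -> 0 <= u <= glen g.
  by move=> /andP[/ltW-> ->].
have q1 u : 0 <= u -> u <= 3 * w -> 2 * (1 - cos u) * l ^+ 2 <= (e1 / 3 * l) ^+ 2.
  move=> u0 u3; rewrite exprMn ler_wpM2r ?sqr_ge0//.
  have := cosq u u0 u3; have -> : (e1 / 3) ^+ 2 = 2 * q by rewrite /q; field.
  lra.
have el0 : 0 <= e1 / 3 * l by rewrite mulr_ge0 ?divr_ge0// ltW.
(* The way from [y h] to [gam h] goes through [zeta l] and [gam l]; each of the three pieces costs a
   third of the tolerance. *)
have D1 : mdist (y h) (zeta l) <= e1 / 3 * l.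
  apply: sq_le => //; apply: le_trans (q1 w (ltW w0) _); last lra.
  apply: (isosceles xy (gneq lzI)); rewrite ?gdist ?wk//.
  have [g gE] := geod_to hX xy.
  have glE : glen g = l by rewrite /glen gE.
  have -> : y h = g l by rewrite -glE geod_endE.
  apply: le_trans Az; rewrite -gE -zetaE -!geod_endE.
  by apply: (comparison_mono_geod hX); rewrite ?glE ?l0 ?lexx//; case/andP: lzI.
have D2 : mdist (zeta l) (gam l) <= e1 / 3 * l.
  apply: sq_le => //; apply: le_trans (q1 (3 * w) _ (lexx _)); last by case/andP: w3I.
  apply: (isosceles (gneq lzI) (gneq lgI)); rewrite ?gdist ?wk//.
  by have := Hr l l lrI lrI; lra.
have D3 : mdist (gam l) (gam h) <= e1 / 3 * h.
  rewrite (geodesic_dist (geodP gam) (wk _ _ lgI) hgI) distrC ger0_norm ?subr_ge0//.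
  have := cosq w (ltW w0); have w3 : w <= 3 * w by lra.
  move=> /(_ w3) cq; apply: (@le_trans _ _ ((1 - cos w) * h)); first lra.
  by rewrite ler_wpM2r ?(ltW h0)//; lra.
have D4 := metric_triangle (y h) (zeta l) (gam h).
have D5 := metric_triangle (zeta l) (gam l) (gam h).
have D6 : e1 / 3 * l <= e1 / 3 * h by rewrite ler_wpM2l// divr_ge0// ltW.
have D7 : e1 * h <= e * h by rewrite ler_wpM2r// ltW.
lra.
Qed.

Variable Y : R -> X.

(* What the right-side tangent vector of a pursuit curve says in terms of angles.
   The curve need not be close to the geodesic [gam] to first order. *)
Definition weak_chase (c : R -> X) (t : R) : Prop :=
  (forall e, 0 < e -> exists2 d, 0 < d & forall h, 0 < h < d ->
     `|mdist (c (t + h)) (c t) - h| <= e * h) /\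
  exists2 gam : geodesic_from (c t), geod_path gam = geo hX (c t) (Y t) &
    geod_end gam = Y t /\
    forall w, 0 < w -> exists2 d, 0 < d & forall h, 0 < h < d ->
      forall g : geodesic_from (c t), geod_end g = c (t + h) -> alexandrov_angle g gam < w.

Lemma pursuit_weak_chase (c : R -> X) t : c t <> Y t ->
  (exists v : tangent_cone (c t),
     right_tangent v c t /\ is_gradient_opp (fun p => mdist p (Y t)) v) ->
  weak_chase c t.
Proof.
move=> /eqP xY [v [tan grad]].
pose gam := GeodesicFrom xY (geoP hX (c t) (Y t)).
have [xi vE xi0] := gradient_unique hX (gam := gam) tan grad.
move: tan; rewrite vE => -[_ speed dir]; split.
  move=> e e0; have /cvgrPdist_lt/(_ e e0)/near_rightP[d d0 Hd] := speed.
  exists d => // h /andP[h0 hd]; have := Hd (t + h); rewrite ltrDl h0 ltrD2l hd => /(_ isT).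
  rewrite (_ : t + h - t = h); last by ring.
  rewrite -(ltr_pM2r h0) -[X in _ * X < _](gtr0_norm h0) -normrM mulrBl.
  by rewrite divfK ?gt_eqF//= mul1r distrC => /ltW.
exists gam => //; split=> // w w0; have /near_rightP[d d0 Hd] := dir w w0.
exists d => // h /andP[h0 hd] g gE.
have := Hd (t + h); rewrite ltrDl h0 ltrD2l hd => /(_ isT g gE) /(cangle_lt hX) A.
rewrite -(cangle_direction hX); apply: le_lt_trans (cangle_triangle hX xi _ _) _.
by rewrite xi0 addr0.
Qed.

(** Local Lipschitz constants of a pursuit curve are unknown; unit right speed at each time improves
    them to 1. *)
Lemma weak_chase_lip1 (a b : R) (c : R -> X) : cont_curve a b c ->
  (forall t, a <= t < b -> weak_chase c t) -> lip1 a b c.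
Proof.
move=> cc wc; apply: lip1_le => s t as_ st tb; apply/ler_addgt0Pr => e e0.
pose e1 := e / (t - s + 1).
have ts0 : 0 < t - s + 1 by lra.
have e10 : 0 < e1 by rewrite divr_gt0.
have cs : cont_curve s t (fun=> c s).
  by move=> u _ r r0; exists 1 => // v _ _; rewrite mdistxx.
have ct : cont_curve s t c by apply: cont_curve_sub cc.
have := growth_bound (K := 1 + e1) st (cont_mdist cs ct).
rewrite mdistxx add0r => H.
have e1e : e1 * (t - s) <= e.
  by rewrite /e1 mulrAC ler_pdivrMr// ler_pM2l//; lra.
suff : mdist (c s) (c t) <= (1 + e1) * (t - s) by lra.
apply: H => u /andP[su ut] d d0.
have [|sp _] := wc u; first by apply/andP; split; lra.
have [d1 d10 H1] := sp e1 e10.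
pose m := Num.min d d1; have m0 : 0 < m by rewrite lt_min d0.
have : m / 2 < m by lra.
rewrite lt_min => /andP[md md1]; have m20 : 0 < m / 2 by rewrite divr_gt0.
exists (m / 2); first by rewrite m20.
have := H1 (m / 2); rewrite m20 md1 => /(_ isT); rewrite ler_norml => /andP[_ A].
have := metric_triangle (c s) (c u) (c (u + m / 2)).
by rewrite (metric_sym (c u)); lra.
Qed.

(* With [f t = d(c t, c b) + t], which is nondecreasing, each time is good in the
   sense of [good_step] or [f] grows at a rate at least [D]. *)
Lemma weak_compare (e : R) : 0 < e -> exists2 D, 0 < D & forall (a b : R) (c s : R -> X),
  a <= b -> lip1 a b c -> lip1 a b s ->
  (forall t, a <= t < b -> [/\ s t <> Y t, weak_chase c t & chase_err hX Y s t e]) ->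
  mdist (c b) (s b) <= mdist (c a) (s a) + 2 * e * (b - a) +
    2 / D * ((b - a) - mdist (c a) (c b)).
Proof.
move=> e0; have [D /andP[D0 D1] good] := good_step e0; exists D => // a b c s ab lc ls H.
have bI : a <= b <= b by rewrite ab lexx.
have iD : 0 < 2 / D by rewrite divr_gt0.
(* Both curves have speed at most 1, so their distance grows at a rate at most 2. When [c] does not
   approach [c b] at almost unit speed, the last bracket grows at a rate at least [D], and the
   factor [2 / D] compensates. *)
pose f t := mdist (c t) (s t) - 2 / D * (mdist (c t) (c b) + t).
have cb : cont_curve a b (fun=> c b).
  by move=> u _ r r0; exists 1 => // v _ _; rewrite mdistxx.
have fc : continuous_on a b f.
  have c1 := cont_mdist (lip1_cont lc) (lip1_cont ls).
  have c2 := cont_mdist (lip1_cont lc) cb.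
  move=> t tI r r0.
  have r30 : 0 < r / 3 by rewrite divr_gt0.
  have r40 : 0 < r / 3 / (2 / D) by rewrite divr_gt0.
  have [d1 d10 H1] := c1 t tI _ r30; have [d2 d20 H2] := c2 t tI _ r40.
  exists (Num.min (Num.min d1 d2) (r / 3 / (2 / D))); first by rewrite !lt_min d10 d20 r40.
  move=> u uI; rewrite !lt_min => /andP[/andP[ud1 ud2] ur].
  have := H1 u uI ud1; have := H2 u uI ud2; move: ur.
  rewrite !(ltr_pdivlMr _ _ iD) => A1 A2 A3.
  have -> : f u - f t = (mdist (c u) (s u) - mdist (c t) (s t)) -
     (2 / D) * (mdist (c u) (c b) - mdist (c t) (c b)) - (2 / D) * (u - t).
    by rewrite /f; ring.
  apply: le_lt_trans (ler_normB _ _) _.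
  apply: le_lt_trans (lerD (ler_normB _ _) (lexx _)) _.
  rewrite !(normrM (2 / D)) (gtr0_norm iD); lra.
suff : f b <= f a + 2 * e * (b - a) by rewrite /f mdistxx; lra.
apply: (growth_bound ab fc) => t tI d d0; have /andP[at_ tb] := tI.
have tI' : a <= t <= b by rewrite at_ ltW.
have [sY [sp [gam gamE [gamY Hang]]] [d1 d10 Hs]] := H t tI.
have step h : 0 < h -> h < b - t -> [/\ a <= t + h <= b,
    mdist (c (t + h)) (c t) <= h & mdist (s (t + h)) (s t) <= h].
  move=> h0 hb; have thI : a <= t + h <= b by apply/andP; split; lra.
  have hE : `|t + h - t| = h by rewrite (_ : t + h - t = h) ?gtr0_norm//; ring.
  by split=> //; [have := lc _ _ thI tI'|have := ls _ _ thI tI']; rewrite hE.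
have bt0 : 0 < b - t by rewrite subr_gt0.
have cY0 : 0 < mdist (c t) (Y t) by rewrite -gamY; exact: glen_gt0.
have sY0 : 0 < mdist (s t) (Y t) by rewrite mdist_gt0; apply/eqP.
have [approach|] := EM (forall d, 0 < d -> exists2 h, 0 < h < d &
    mdist (c (t + h)) (c b) <= mdist (c t) (c b) - (1 - D) * h).
  have [||h /andP[h0]] := good _ _ gam (fun h => c (t + h)) _ Hang approach
    (Num.min (Num.min (Num.min d d1) (b - t)) (Num.min (mdist (c t) (Y t)) (mdist (s t) (Y t)))).
  - exists (b - t) => // h /andP[h0 hb]; have [_ A _] := step h h0 hb.
    by rewrite metric_sym.
  - by rewrite !lt_min d0 d10 bt0 cY0 sY0.
  rewrite !lt_min => /andP[/andP[/andP[hd hd1] hb] /andP[hc hs]].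
  rewrite gamE => A1; exists h; first by rewrite h0.
  have A2 := Hs h; rewrite h0 hd1 in A2; have {}A2 := A2 isT.
  have A3 := geo_contract hX (ltW h0) (ltW hc) (ltW hs).
  have [thI A4 _] := step h h0 hb.
  have A5 := metric_triangle (c t) (c (t + h)) (c b).
  rewrite (metric_sym (c t) (c (t + h))) in A5.
  have A6 : 0 <= 2 / D * (mdist (c (t + h)) (c b) + h - mdist (c t) (c b)).
    by rewrite mulr_ge0 ?(ltW iD)//; lra.
  have A7 := metric_triangle (c (t + h)) (geo hX (c t) (Y t) h) (s (t + h)).
  have A8 := metric_triangle (geo hX (c t) (Y t) h) (geo hX (s t) (Y t) h) (s (t + h)).
  rewrite (metric_sym (geo hX (s t) (Y t) h)) in A8.
  by rewrite /f; lra.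
move=> /existsNP[d2 /not_implyP[d20 bad]].
pose m := Num.min (Num.min d d2) (b - t); have m0 : 0 < m by rewrite !lt_min d0 d20.
have : m / 2 < m by lra.
rewrite !lt_min => /andP[/andP[md md2] mb]; have m20 : 0 < m / 2 by rewrite divr_gt0.
exists (m / 2); first by rewrite m20.
move: (m / 2) m20 md md2 mb => h h0 hd hd2 hb.
have [thI A1 A2] := step h h0 hb.
have A3 : mdist (c t) (c b) - (1 - D) * h < mdist (c (t + h)) (c b).
  by rewrite ltNge; apply/negP => A; apply: bad; exists h => //; rewrite h0.
have A4 : 2 * h <= 2 / D * (mdist (c (t + h)) (c b) + h - mdist (c t) (c b)).
  apply: (@le_trans _ _ (2 / D * (D * h))); last by rewrite ler_pM2l//; lra.
  by rewrite mulrA divfK// gt_eqF.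
have A5 := metric_triangle (c (t + h)) (c t) (s (t + h)).
have A6 := metric_triangle (c t) (s t) (s (t + h)).
rewrite (metric_sym (s t)) in A6.
have := mulr_gt0 e0 h0; rewrite /f; lra.
Qed.

(** The bound of [weak_compare] is used on [t, t + h] with [D] already fixed by the tolerance, so
    the o(h) defect of unit speed at t outweighs the possibly large factor [2 / D]. *)
Lemma weak_chase_unique (b : R) (c s : R -> X) : 0 <= b -> c 0 = s 0 ->
  lip1 0 b c -> lip1 0 b s ->
  (forall t, 0 <= t < b -> [/\ s t <> Y t, weak_chase c t &
     forall e, 0 < e -> chase_err hX Y s t e]) ->
  c b = s b.
Proof.
move=> b0 cs0 lc ls H; apply: mdist0_eq; apply/ler_addgt0Pr => e e0; rewrite add0r.
pose e1 := e / (3 * (b + 1)).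
have e10 : 0 < e1 by rewrite divr_gt0// mulr_gt0//; lra.
have [D D0 Hcmp] := weak_compare e10.
have := growth_bound (K := 3 * e1) b0 (cont_mdist (lip1_cont lc) (lip1_cont ls)).
rewrite cs0 mdistxx add0r subr0 => G; apply: le_trans (G _) _; last first.
  have -> : 3 * e1 * b = e * (b / (b + 1)) by rewrite /e1; field; rewrite gt_eqF//; lra.
  by rewrite ler_piMr ?(ltW e0)// ler_pdivrMr//; lra.
move=> t /andP[t0 tb] d d0; have [|_ [sp _] _] := H t; first by rewrite t0.
(* This makes the term with factor [2 / D] at most [e1 * h]; together with [2 * e1 * h] it gives the
   rate [3 * e1]. *)
have eD0 : 0 < e1 * D / 2 by rewrite divr_gt0// mulr_gt0.
have [d1 d10 H1] := sp _ eD0.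
pose m := Num.min (Num.min d d1) (b - t).
have m0 : 0 < m by rewrite !lt_min d0 d10 subr_gt0.
have : m / 2 < m by lra.
rewrite !lt_min => /andP[/andP[md md1] mb]; have m20 : 0 < m / 2 by rewrite divr_gt0.
exists (m / 2); first by rewrite m20.
move: (m / 2) m20 md md1 mb => h h0 hd hd1 hb.
have th : t <= t + h by lra.
have thb : t + h <= b by lra.
have := H1 h; rewrite h0 hd1 => /(_ isT); rewrite ler_norml => /andP[A _].
apply: le_trans (Hcmp t (t + h) c s th (lip1_sub t0 thb lc) (lip1_sub t0 thb ls) _) _.
  move=> u /andP[tu uh]; have [|sY wc Hs] := H u; first by apply/andP; split; lra.
  by split=> //; exact: Hs.
have -> : t + h - t = h by ring.
rewrite (metric_sym (c t) (c (t + h))).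
have : 2 / D * (h - mdist (c (t + h)) (c t)) <= e1 * h.
  apply: (@le_trans _ _ (2 / D * (e1 * D / 2 * h))).
    by rewrite ler_pM2l ?divr_gt0//; lra.
  by rewrite le_eqVlt; apply/orP; left; apply/eqP; field; rewrite gt_eqF.
lra.
Qed.

End Uniqueness.

(** * Capture times and the conclusion *)

Section Capture.
Context {R : realType} {X : metricType R}.
Implicit Types (Y s : R -> X) (T : \bar R).

Lemma before_capture Y s T t : is_capture_time Y s T -> 0 <= t -> (t%:E < T)%E ->
  s t <> Y t.
Proof.
case=> [[t1 [-> t10 _ H]] t0|[_ H] t0 _]; last exact: H.
by rewrite lte_fin => tt1; apply: H; rewrite t0.
Qed.

(** An earlier capture of [s'] would also be a capture of [s], since the two agree up to and
    including that time. *)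
Lemma capture_time_le Y s s' T T' : is_capture_time Y s T -> is_capture_time Y s' T' ->
  (forall t, 0 <= t -> (t%:E <= T)%E -> (t%:E <= T')%E -> s' t = s t) -> (T <= T')%E.
Proof.
move=> hT hT' E; rewrite leNgt; apply/negP => TT'.
case: hT' TT' E => [[t1 [-> t10 sE _]]|[-> _]] TT' E; last by rewrite ltNge leey in TT'.
by apply: (before_capture hT t10 TT'); rewrite -E// ltW.
Qed.

Lemma locally_lipschitz_cont (b : R) T s : locally_lipschitz_on (time_domain T) s ->
  (b%:E <= T)%E -> cont_curve 0 b s.
Proof.
move=> H bT t /andP[t0 tb] e e0.
have dom u : 0 <= u <= b -> time_domain T u.
  by move=> /andP[u0 ub]; split=> //; apply: le_trans bT; rewrite lee_fin.
have tD : time_domain T t by apply: dom; rewrite t0.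
have [K [r [r0 Hr]]] := H t tD.
have K0 : 0 < `|K| + 1 by rewrite ltr_wpDl.
exists (Num.min r (e / (`|K| + 1))); first by rewrite lt_min r0 divr_gt0.
move=> u uI; rewrite lt_min ltr_pdivlMr// => /andP[ur ue].
have := Hr u t (dom u uI) tD ur; rewrite subrr normr0 => /(_ r0) A.
apply: le_lt_trans ue; apply: le_trans A _.
by rewrite mulrC ler_wpM2l// (le_trans (ler_norm K))// lerDl.
Qed.

End Capture.

Theorem corollary38 (R : realType) (X : metricType R) (hX : CAT0 X)
    (Y : R -> X)
    (hY : forall t t' : R, 0 <= t -> 0 <= t' -> mdist (Y t) (Y t') <= `|t - t'|)
    (x0 : X) :
  exists (T : \bar R) (s : R -> X),
    [/\ simple_pursuit Y T s, s 0 = x0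
      & forall (T' : \bar R) (s' : R -> X),
          simple_pursuit Y T' s' -> s' 0 = x0 ->
          T' = T /\ (forall t, time_domain T t -> s' t = s t)].
Proof.
have [T [s [s0 captT lip err]]] := chase_exists hX hY x0.
exists T, s; split=> //.
  split=> //.
    move=> t _; exists 1, 1; split=> // t1 t2 [t10 t1T] [t20 t2T] _ _; rewrite mul1r.
    apply: (lip (Num.max t1 t2)).
    - by rewrite le_max t10.
    - by rewrite EFin_max ge_max t1T.
    - by rewrite t10 le_max lexx.
    - by rewrite t20 le_max lexx orbT.
  move=> t t0 tT; apply: (chase_pursuit (hX := hX)); first exact: before_capture captT t0 tT.
  exact: err.
move=> T' s' [captT' liploc grad] s'0.
(* Agreement is shown up to the earlier of the two capture times; it then forces these times to
   coincide. *)
have E t : 0 <= t -> (t%:E <= T)%E -> (t%:E <= T')%E -> s' t = s t.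
  move=> t0 tT tT'.
  have wc u : 0 <= u < t -> weak_chase hX Y s' u.
    move=> /andP[u0 ut]; have uT' : (u%:E < T')%E by apply: lt_le_trans tT'; rewrite lte_fin.
    apply: pursuit_weak_chase; first exact: before_capture captT' u0 uT'.
    exact: grad.
  apply: (weak_chase_unique (hX := hX) (Y := Y)) => //.
  - by rewrite s'0.
  - by apply: weak_chase_lip1 wc; exact: locally_lipschitz_cont liploc tT'.
  - exact: lip.
  move=> u uI; have /andP[u0 ut] := uI.
  have uT : (u%:E < T)%E by apply: lt_le_trans tT; rewrite lte_fin.
  split; [exact: before_capture captT u0 uT|exact: wc|exact: err].
have TT' : T' = T.
  apply/le_anti/andP; split.
    by apply: (capture_time_le captT' captT) => t t0 h1 h2; rewrite E.
  exact: (capture_time_le captT captT').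
by split=> // t [t0 tT]; apply: E => //; rewrite TT'.
Qed.
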